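(* Let $(T_1,T_2)$ and $(T_1',T_2')$ be two pairs of commuting contractions (on Hilbert spaces $\mathcal H$ and $\mathcal H'$, respectively) such that their products $T=T_1T_2$ and $T'=T_1'T_2'$ are completely nonunitary contractions. Then $(T_1,T_2)$ and $(T_1',T_2')$ are unitarily equivalent (i.e., there is a unitary $\phi:\mathcal H\to\mathcal H'$ with $\phi T_k=T_k'\phi$ for $k=1,2$) if and only if their characteristic triples coincide.
   Context: Conventions. For a contraction $A$, $D_A=(I-A^*A)^{1/2}$ and $\mathcal D_A=\overline{\operatorname{Ran}}\,D_A$. A contraction is completely nonunitary (c.n.u.) if it has no nonzero reducing subspace on which it is unitary. $H^2(\mathcal E)\subset L^2(\mathcal E)$ are the $\mathcal E$-valued Hardy space of the unit disk $\mathbb D$ and the $L^2$-space on the unit circle $\mathbb T$; $M_\varphi$ is multiplication by $\varphi$; $M_z$ (on $H^2$) and $M_\zeta$ (on $L^2$) are multiplication by the coordinate function. A contractive analytic function $(\mathcal D,\mathcal D_*,\Theta)$ is an analytic $\mathcal B(\mathcal D,\mathcal D_* )$-valued function $\Theta$ on $\mathbb D$ with $\|\Theta(z)\|\le1$; it is purely contractive if $\|\Theta(0)\xi\|<\|\xi\|$ for all nonzero $\xi\in\mathcal D$; $\Delta_\Theta(\zeta)=(I-\Theta(\zeta)^*\Theta(\zeta))^{1/2}$ for a.e. $\zeta\in\mathbb T$. Characteristic triple of a commuting pair of contractions $(T_1,T_2)$ on $\mathcal H$ with $T=T_1T_2$ c.n.u.: (a) $\Theta_T(z)=[-T+zD_{T^*}(I-zT^*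 )^{-1}D_T]|_{\mathcal D_T}:\mathcal D_T\to\mathcal D_{T^*}$ (Sz.-Nagy--Foias characteristic function, which is purely contractive), and $\Delta_T=\Delta_{\Theta_T}$. (b) Let $(V_1,V_2)$ be an Andô isometric dilation of $(T_1,T_2)$: commuting isometries on a Hilbert space $\mathcal K\supset\mathcal H$ with $V_k^*|_{\mathcal H}=T_k^*$. Put $V=V_1V_2$, $\mathcal L_*=\overline{(I-VT^* )\mathcal H}$, $\mathcal L_{k*}=\overline{(I-V_kT_k^* )\mathcal H}$, and let $\iota_*:\mathcal L_*\to\mathcal D_{T^*}$ be the unitary with $\iota_*(I-VT^* )h=D_{T^*}h$. Let $\Lambda_{c*}:\mathcal L_*\to\mathcal L_{1*}\oplus\mathcal L_{2*}$ be the isometry $(I-VT^* )h\mapsto(I-V_1T_1^* )T_2^*h\oplus(I-V_2T_2^* )h$, and let $U_{c*0}$ be the unitary from $\overline{\operatorname{Ran}}\,\Lambda_{c*}$ onto $\operatorname{clos}\{(I-V_1T_1^* )h\oplus(I-V_2T_2^* )T_1^*h:h\in\mathcal H\}$ given by $(I-V_1T_1^* )T_2^*h\oplus(I-V_2T_2^* )h\mapsto(I-V_1T_1^* )h\oplus(I-V_2T_2^* )T_1^*h$. Let $\mathcal F_{c*}=\mathcal L_{1*}\oplus\mathcal L_{2*}$ if the domain and range of $U_{c*0}$ have orthogonal complements of equal dimension there, and $\mathcal F_{c*}=\mathcal L_{1*}\oplus\mathcal L_{2*}\oplus\ell^2$ ($\ell^2$ an infinite-dimensional Hilbert space) otherwise;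 let $U_{c*}$ be any unitary on $\mathcal F_{c*}$ extending $U_{c*0}$ and $P_{c*}$ the orthogonal projection of $\mathcal F_{c*}$ onto the summand $\mathcal L_{1*}$; $P_{c*}^\perp=I-P_{c*}$. Regarding $\Lambda_{c*}$ as a map into $\mathcal F_{c*}$, define contractions on $\mathcal D_{T^*}$ by $G_{\sharp1}=\iota_*\Lambda_{c*}^*P_{c*}^\perp U_{c*}\Lambda_{c*}\iota_*^*$ and $G_{\sharp2}=\iota_*\Lambda_{c*}^*U_{c*}^*P_{c*}\Lambda_{c*}\iota_*^*$ (they do not depend on the choices made). (c) Let $Q\ge0$, $Q^2=\operatorname{SOT-lim}_nT^nT^{*n}$. The formulas $X_k^*Qh=QT_k^*h$ ($k=1,2$) define commuting isometries $X_1^*,X_2^*$ on $\overline{\operatorname{Ran}}\,Q$; put $X^*=X_1^*X_2^*$. Let $W_D^*$ on $\mathcal R_D\supset\overline{\operatorname{Ran}}\,Q$ be the minimal unitary extension of the isometry $X^*$ (so $\mathcal R_D=\overline{\operatorname{span}}\{W_D^nx:n\ge0,x\in\overline{\operatorname{Ran}}\,Q\}$), and let $(W_{\partial1}^*,W_{\partial2}^* )$ be the commuting unitary extension of $(X_1^*,X_2^* )$ to $\mathcal R_D$ with $W_{\partial1}^*W_{\partial2}^*=W_D^*$. Let $\mathcal U$ on $\widetilde{\mathcal K}\supset\mathcal H$ be the minimal unitary dilation of $T$, $\mathcal L=\overline{(\mathcal U-T)\mathcal H}$, $\mathcal L_*^{\min}=\overline{(I-\mathcal UT^* )\mathcal H}$,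 $M(\mathcal L)=\bigoplus_{n\in\mathbb Z}\mathcal U^n\mathcal L$, $M(\mathcal L_*^{\min})=\bigoplus_{n\in\mathbb Z}\mathcal U^n\mathcal L_*^{\min}$, $\mathcal R=\widetilde{\mathcal K}\ominus M(\mathcal L_*^{\min})$. Let $\boldsymbol\iota:M(\mathcal L)\to L^2(\mathcal D_T)$ be the unitary with $\boldsymbol\iota\,\mathcal U^n(\mathcal U-T)h=\zeta^nD_Th$. Let $\omega_D:\mathcal R\to\mathcal R_D$ and $\omega_{NF}:\mathcal R\to\overline{\Delta_TL^2(\mathcal D_T)}$ be the unitaries determined by $\omega_D\,\mathcal U^nP_{\mathcal R}h=W_D^nQh$ ($h\in\mathcal H,n\ge0$) and $\omega_{NF}P_{\mathcal R}\ell=\Delta_T\cdot\boldsymbol\iota\ell$ ($\ell\in M(\mathcal L)$). Put $u=\omega_{NF}\omega_D^*$ and $W_{\sharp k}=uW_{\partial k}u^*$, $k=1,2$; these are commuting unitaries on $\overline{\Delta_TL^2(\mathcal D_T)}$ with product $M_\zeta$. The characteristic triple of $(T_1,T_2)$ is $((G_{\sharp1},G_{\sharp2}),(W_{\sharp1},W_{\sharp2}),\Theta_T)$. Coincidence. Consider triples $((G_1,G_2),(W_1,W_2),\Theta)$ and $((G_1',G_2'),(W_1',W_2'),\Theta')$, where $(\mathcal D,\mathcal D_*,\Theta)$, $(\mathcal D',\mathcal D_*',\Theta')$ are purely contractive analytic functions, $G_k$ on $\mathcal D_*$ and $G_k'$ on $\mathcal D_*'$ are contractions, and $(W_1,W_2)$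 on $\overline{\Delta_\Theta L^2(\mathcal D)}$, $(W_1',W_2')$ on $\overline{\Delta_{\Theta'}L^2(\mathcal D')}$ are commuting unitaries with product $M_\zeta$. They coincide if there are unitaries $u:\mathcal D\to\mathcal D'$ and $u_*:\mathcal D_*\to\mathcal D_*'$ with $u_*\Theta(z)=\Theta'(z)u$ for all $z\in\mathbb D$, $G_k'=u_*G_ku_*^*$ and $W_k'=\omega_uW_k\omega_u^*$ for $k=1,2$, where $\omega_u=(I_{L^2}\otimes u)|_{\overline{\Delta_\Theta L^2(\mathcal D)}}:\overline{\Delta_\Theta L^2(\mathcal D)}\to\overline{\Delta_{\Theta'}L^2(\mathcal D')}$. *)

(* Defs.v *)
From HB Require Import structures.
From mathcomp Require Import all_boot all_order all_algebra complex.
From mathcomp Require Import all_classical all_reals all_analysis.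

Set Implicit Arguments.
Unset Strict Implicit.
Unset Printing Implicit Defensive.

Import Order.TTheory GRing.Theory Num.Theory.
Import numFieldNormedType.Exports.

Local Open Scope classical_set_scope.
Local Open Scope complex_scope.
Local Open Scope ring_scope.

(* Complex Hilbert spaces; the inner product is linear on the left. *)
HB.mixin Record isHilbert (R : realType) V of CompleteNormedModule R[i] V := {
  inner : {dot V for (@Num.conj R[i])};
  innerE : forall x : V, inner x x = `|x| ^+ 2 }.

#[short(type="hilbertType")]
HB.structure Definition Hilbert (R : realType) :=
  {V of isHilbert R V & CompleteNormedModule R[i] V}.

(* An operator from a closed subspace A of E to a closed subspace B of F is
   represented by a function E -> F of which only the values on A matter;
   operators on a whole space have A = setT. *)

Section Operators.
Variable R : realType.
Implicit Types E F : hilbertType R.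

Definition closed_subspace E (A : set E) :=
  [/\ A 0, (forall (a : R[i]) x y, A x -> A y -> A (a *: x + y)) & closed A].

Definition orthogonal E (A B : set E) :=
  forall x y, A x -> B y -> inner x y = 0.

(* The part of S orthogonal to A, i.e. S (-) A when A `<=` S. *)
Definition ocompl E (S A : set E) : set E :=
  [set x | S x /\ forall y, A y -> inner x y = 0].

Definition linear_on E F (A : set E) (f : E -> F) :=
  forall (a : R[i]) x y, A x -> A y -> f (a *: x + y) = a *: f x + f y.

Definition bounded_op E F (A : set E) (B : set F) (f : E -> F) :=
  [/\ linear_on A f, f @` A `<=` B &
      exists M : R, forall x, A x -> `|f x| <= M%:C * `|x| ].

Definition contraction E F (A : set E) (B : set F) (f : E -> F) :=
  [/\ linear_on A f, f @` A `<=` B & forall x, A x -> `|f x| <= `|x| ].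

Definition isometry E F (A : set E) (B : set F) (f : E -> F) :=
  [/\ linear_on A f, f @` A `<=` B & forall x, A x -> `|f x| = `|x| ].

Definition unitary E F (A : set E) (B : set F) (f : E -> F) :=
  [/\ linear_on A f, f @` A = B & forall x, A x -> `|f x| = `|x| ].

Definition positive_op E (A : set E) (f : E -> E) :=
  bounded_op A A f /\ forall x, A x -> 0 <= inner (f x) x.

Definition adjoint E F (A : set E) (B : set F) (f : E -> F) : F -> E :=
  xget (fun=> 0) [set g | g @` B `<=` A /\
    forall x y, A x -> B y -> inner (f x) y = inner x (g y)].

Definition adj E F (f : E -> F) : F -> E := adjoint setT setT f.

Definition psqrt E (A : set E) (f : E -> E) : E -> E :=
  xget (fun=> 0) [set g | positive_op A g /\ forall x, A x -> g (g x) = f x].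

Definition op_inverse E (f : E -> E) : E -> E :=
  xget (fun x : E => x) [set g | cancel f g /\ cancel g f].

Definition proj E (A : set E) (x : E) : E :=
  xget 0 [set y | A y /\ forall a, A a -> inner (x - y) a = 0].

Definition orthonormal_basis E (A S : set E) :=
  [/\ S `<=` A,
      (forall x, S x -> `|x| = 1),
      (forall x y, S x -> S y -> x <> y -> inner x y = 0) &
      smallest (@closed_subspace E) S = A].

Definition same_dim E (A B : set E) :=
  exists S S', [/\ orthonormal_basis A S, orthonormal_basis B S' & (S #= S')%card].

Definition infinite_dim E (A : set E) :=
  exists S, orthonormal_basis A S /\ infinite_set S.

Definition defect E (T : E -> E) : E -> E :=
  psqrt setT (fun x => x - adj T (T x)).

Definition defect_space E (T : E -> E) : set E := closure (range (defect T)).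

Definition cnu E (T : E -> E) :=
  forall M : set E, closed_subspace M -> T @` M `<=` M -> adj T @` M `<=` M ->
    unitary M M T -> M = [set 0].

Definition commuting_contractions E (T1 T2 : E -> E) :=
  [/\ contraction setT setT T1, contraction setT setT T2 &
      forall x, T1 (T2 x) = T2 (T1 x)].

Definition unitarily_equivalent E F (T1 T2 : E -> E) (T1' T2' : F -> F) :=
  exists phi : E -> F, [/\ unitary setT setT phi,
    forall x, phi (T1 x) = T1' (phi x) & forall x, phi (T2 x) = T2' (phi x)].

(* U ^ n for U unitary and n : int. *)
Definition zpow E (U : E -> E) (n : int) : E -> E :=
  match n with Posz m => iter m U | Negz m => iter m.+1 (adj U) end.

End Operators.

(* Elements of L^2(E) are represented by functions R[i] -> E, of which only the
   values on the unit circle matter, up to equality almost everywhere for the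
   normalized arc length: the circle is parametrized by t in [0, 1]. For a closed
   subspace D of E, L^2(D) is the set L2 D of the functions with values in D
   almost everywhere. *)

Section L2.
Variable R : realType.
Implicit Types E F : hilbertType R.

Definition circ (t : R) : R[i] := cos (2 * pi * t) +i* sin (2 * pi * t).

Definition aeT (P : R[i] -> Prop) :=
  {ae lebesgue_measure, forall t : R, t \in `[0, 1] -> P (circ t)}.

Definition eqT E (f g : R[i] -> E) := aeT (fun z => f z = g z).

(* Strong (Bochner) measurability. *)
Definition strongly_measurable E (f : R[i] -> E) :=
  exists s : nat -> R -> E,
    (forall n, finite_set (range (s n)) /\
               forall x, measurable (s n @^-1` [set x])) /\
    {ae lebesgue_measure, forall t : R, t \in `[0, 1] ->
       s n t @[n --> \oo] --> f (circ t)}.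

Definition nrm E (x : E) : R := complex.Re `|x|.

Definition L2sqnorm E (f : R[i] -> E) : \bar R :=
  (\int[lebesgue_measure]_(t in `[0%R, 1%R]) ((nrm (f (circ t))) ^+ 2)%:E)%E.

Definition L2 E (D : set E) : set (R[i] -> E) :=
  [set f | [/\ strongly_measurable f, aeT (fun z => D (f z)) &
               (L2sqnorm f < +oo)%E]].

Definition L2closure E (S : set (R[i] -> E)) : set (R[i] -> E) :=
  [set f : R[i] -> E | L2 setT f /\ forall e : R, 0 < e ->
     exists2 g, S g & (L2sqnorm (fun z => (f z - g z)%R) < e%:E)%E].

(* A unitary from the subspace A of E onto the subspace S of L^2(F). *)
Definition unitary_toL2 E F (A : set E) (S : set (R[i] -> F))
    (w : E -> R[i] -> F) :=
  [/\ (forall (a : R[i]) x y, A x -> A y ->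
         eqT (w (a *: x + y)) (fun z => a *: w x z + w y z)),
      (forall x, A x -> S (w x)),
      (forall f, S f -> exists2 x, A x & eqT (w x) f) &
      (forall x, A x -> L2sqnorm (w x) = (nrm x ^+ 2)%:E)].

(* A unitary from the subspace S of L^2(E) onto itself. *)
Definition unitary_L2 E (S : set (R[i] -> E))
    (W : (R[i] -> E) -> (R[i] -> E)) :=
  [/\ (forall f g, S f -> S g -> eqT f g -> eqT (W f) (W g)),
      (forall (a : R[i]) f g, S f -> S g ->
         eqT (W (fun z => a *: f z + g z)) (fun z => a *: W f z + W g z)),
      (forall f, S f -> S (W f)),
      (forall g, S g -> exists2 f, S f & eqT (W f) g) &
      (forall f, S f -> L2sqnorm (W f) = L2sqnorm f)].

(* I (x) u *)
Definition amp E F (u : E -> F) (f : R[i] -> E) : R[i] -> F :=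
  fun z => u (f z).

End L2.

Section Triples.
Variable R : realType.

Section ContractiveAnalytic.
Variables (E Es : hilbertType R) (D : set E) (Ds : set Es).
Variable Theta : R[i] -> E -> Es.

Definition contractive_analytic :=
  (exists c : nat -> E -> Es,
     (forall n, bounded_op D Ds (c n)) /\
     forall z x, `|z| < 1 -> D x ->
       series (fun n => z ^+ n *: c n x) @ \oo --> Theta z x) /\
  (forall z, `|z| < 1 -> contraction D Ds (Theta z)).

Definition purely_contractive :=
  forall x, D x -> x <> 0 -> `|Theta 0 x| < `|x|.

(* The boundary values of Theta are its strong radial limits. They exist almost
   everywhere when D is separable; in general Delta is only meaningful under
   has_boundary_values. *)
Definition has_boundary_values :=
  aeT (fun z => forall x, D x -> cvg (Theta (r%:C * z) x @[r --> (1 : R)^'-])).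

Definition boundary (z : R[i]) (x : E) : Es :=
  lim (Theta (r%:C * z) x @[r --> (1 : R)^'-]).

Definition Delta (z : R[i]) : E -> E :=
  psqrt D (fun x => x - adjoint D Ds (boundary z) (boundary z x)).

Definition mulDelta (f : R[i] -> E) : R[i] -> E := fun z => Delta z (f z).

Definition DeltaL2 : set (R[i] -> E) := L2closure (mulDelta @` L2 D).

End ContractiveAnalytic.

Record triple (E Es : hilbertType R) := Triple {
  tdom : set E;
  tcod : set Es;
  tG1 : Es -> Es;
  tG2 : Es -> Es;
  tW1 : (R[i] -> E) -> (R[i] -> E);
  tW2 : (R[i] -> E) -> (R[i] -> E);
  tTheta : R[i] -> E -> Es;
  tdom_closed : closed_subspace tdom;
  tcod_closed : closed_subspace tcod;
  tTheta_analytic : contractive_analytic tdom tcod tTheta;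
  tTheta_pure : purely_contractive tdom tTheta;
  tTheta_boundary : has_boundary_values tdom tTheta;
  tG1_contraction : contraction tcod tcod tG1;
  tG2_contraction : contraction tcod tcod tG2;
  tW1_unitary : unitary_L2 (DeltaL2 tdom tcod tTheta) tW1;
  tW2_unitary : unitary_L2 (DeltaL2 tdom tcod tTheta) tW2;
  tW_comm : forall f, DeltaL2 tdom tcod tTheta f ->
    eqT (tW1 (tW2 f)) (tW2 (tW1 f));
  tW_prod : forall f, DeltaL2 tdom tcod tTheta f ->
    eqT (tW1 (tW2 f)) (fun z => z *: f z) }.

Definition coincide (E Es E' Es' : hilbertType R)
    (t : triple E Es) (t' : triple E' Es') :=
  exists (u : E -> E') (us : Es -> Es'),
    let uadj := adjoint (tdom t) (tdom t') u in
    let usadj := adjoint (tcod t) (tcod t') us in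
    let S' := DeltaL2 (tdom t') (tcod t') (tTheta t') in
    [/\ unitary (tdom t) (tdom t') u /\ unitary (tcod t) (tcod t') us,
        (forall z x, `|z| < 1 -> tdom t x ->
           us (tTheta t z x) = tTheta t' z (u x)),
        (forall y, tcod t' y -> tG1 t' y = us (tG1 t (usadj y))) /\
        (forall y, tcod t' y -> tG2 t' y = us (tG2 t (usadj y))),
        (forall f, S' f -> eqT (tW1 t' f) (amp u (tW1 t (amp uadj f)))) &
        (forall f, S' f -> eqT (tW2 t' f) (amp u (tW2 t (amp uadj f))))].

End Triples.

Section CharacteristicTriple.
Variables (R : realType) (H : hilbertType R) (T1 T2 : H -> H).

Let T : H -> H := T1 \o T2.
Let DT := defect_space T.
Let DTs := defect_space (adj T).

Definition char_fun (z : R[i]) (x : H) : H :=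
  - T x + z *: defect (adj T)
               (op_inverse (fun y => y - z *: adj T y) (defect T x)).

(* The inclusion of H in a dilation space K is an isometry J : H -> K. *)
Definition ando_dilation (K : hilbertType R) (J : H -> K) (V1 V2 : K -> K) :=
  [/\ isometry setT setT J,
      isometry setT setT V1 /\ isometry setT setT V2,
      forall x, V1 (V2 x) = V2 (V1 x),
      forall h, adj V1 (J h) = J (adj T1 h) &
      forall h, adj V2 (J h) = J (adj T2 h)].

(* The closure of (I - V A^* )H in K. *)
Definition wandering (K : hilbertType R) (J : H -> K) (V : K -> K)
    (A : H -> H) : set K :=
  closure (range (fun h => J h - V (J (adj A h)))).

(* F_{c*} is rendered as a Hilbert space F that is the orthogonal direct sum of
   the copies e1 @` L1s, e2 @` L2s of L_{1*}, L_{2*} and of N, where N stands for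
   0 or for the infinite-dimensional summand. *)
Definition ando_tuple (G1 G2 : H -> H) (K F : hilbertType R)
    (J : H -> K) (V1 V2 : K -> K) (iota : K -> H) (e1 e2 : K -> F) (N : set F)
    (Lambda : K -> F) (U : F -> F) :=
  let V := V1 \o V2 in
  let Ls := wandering J V T in
  let L1s := wandering J V1 T1 in
  let L2s := wandering J V2 T2 in
  let I_V h := J h - V (J (adj T h)) in
  let I_V1 h := J h - V1 (J (adj T1 h)) in
  let I_V2 h := J h - V2 (J (adj T2 h)) in
  let S := [set x | exists a b, [/\ L1s a, L2s b & x = e1 a + e2 b]] in
  let dom0 := closure (Lambda @` Ls) in
  let ran0 := closure (range (fun h => e1 (I_V1 h) + e2 (I_V2 (adj T1 h)))) in
  let dims := same_dim (ocompl S dom0) (ocompl S ran0) in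
  let P := proj (e1 @` L1s) in
  let Pperp x := x - P x in
  let iotas := adjoint Ls DTs iota in
  let Lambdas := adjoint Ls setT Lambda in
  [/\ ando_dilation J V1 V2,
      unitary Ls DTs iota /\ (forall h, iota (I_V h) = defect (adj T) h),
      [/\ isometry L1s setT e1, isometry L2s setT e2, closed_subspace N,
          [/\ orthogonal (e1 @` L1s) (e2 @` L2s), orthogonal (e1 @` L1s) N &
              orthogonal (e2 @` L2s) N] &
          forall x, exists s n, [/\ S s, N n & x = s + n]],
      (dims -> N = [set 0]) /\ (~ dims -> infinite_dim N) &
      [/\ isometry Ls setT Lambda,
          forall h, Lambda (I_V h) = e1 (I_V1 (adj T2 h)) + e2 (I_V2 h),
          unitary setT setT U /\
          (forall h, U (e1 (I_V1 (adj T2 h)) + e2 (I_V2 h)) =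
                     e1 (I_V1 h) + e2 (I_V2 (adj T1 h))),
          forall x, DTs x ->
            G1 x = iota (Lambdas (Pperp (U (Lambda (iotas x))))) &
          forall x, DTs x ->
            G2 x = iota (Lambdas (adj U (P (Lambda (iotas x)))))]].

Definition char_contractions (G1 G2 : H -> H) :=
  exists (K F : hilbertType R) (J : H -> K) (V1 V2 : K -> K) (iota : K -> H)
    (e1 e2 : K -> F) (N : set F) (Lambda : K -> F) (U : F -> F),
    ando_tuple G1 G2 J V1 V2 iota e1 e2 N Lambda U.

Definition Qop : H -> H :=
  psqrt setT (fun h => lim (iter n T (iter n (adj T) h) @[n --> \oo])).

Let RanQ := closure (range Qop).

(* j : RanQ -> RD is the inclusion; X1s and X2s are the isometries X_1^* and
   X_2^* on RanQ. *)
Definition canonical_extension (RD : hilbertType R) (j : H -> RD)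
    (X1s X2s : H -> H) (WD W1 W2 : RD -> RD) :=
  [/\ [/\ isometry RanQ RanQ X1s, isometry RanQ RanQ X2s,
          forall h, X1s (Qop h) = Qop (adj T1 h) &
          forall h, X2s (Qop h) = Qop (adj T2 h)],
      isometry RanQ setT j,
      [/\ unitary setT setT WD,
          forall x, RanQ x -> adj WD (j x) = j (X1s (X2s x)) &
          smallest (@closed_subspace R RD)
            [set y | exists n x, RanQ x /\ y = iter n WD (j x)] = setT],
      [/\ unitary setT setT W1, unitary setT setT W2 &
          forall y, adj W1 (adj W2 y) = adj W2 (adj W1 y)] &
      [/\ forall x, RanQ x -> adj W1 (j x) = j (X1s x),
          forall x, RanQ x -> adj W2 (j x) = j (X2s x) &
          forall y, adj W1 (adj W2 y) = adj WD y]].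

Definition minimal_unitary_dilation (K : hilbertType R) (J : H -> K)
    (U : K -> K) :=
  [/\ isometry setT setT J, unitary setT setT U,
      forall n h, proj (range J) (iter n U (J h)) = J (iter n T h) &
      smallest (@closed_subspace R K)
        [set x | exists n h, x = zpow U n (J h)] = setT].

(* M(A): the closed span of the U ^ n A, n : int. *)
Definition bilateral (K : hilbertType R) (U : K -> K) (A : set K) : set K :=
  smallest (@closed_subspace R K)
    [set x | exists n a, A a /\ x = zpow U n a].

Definition canonical_tuple (Theta : R[i] -> H -> H)
    (W1 W2 : (R[i] -> H) -> (R[i] -> H)) (RD : hilbertType R) (j : H -> RD)
    (X1s X2s : H -> H) (WD Wd1 Wd2 : RD -> RD)
    (K : hilbertType R) (J : H -> K) (U : K -> K) (iota : K -> R[i] -> H)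
    (omegaD : K -> RD) (omegaNF : K -> R[i] -> H) :=
  let L := closure (range (fun h => U (J h) - J (T h))) in
  let Ls := wandering J U T in
  let Res := ocompl setT (bilateral U Ls) in
  let u x := omegaNF (adjoint Res setT omegaD x) in
  [/\ canonical_extension j X1s X2s WD Wd1 Wd2,
      minimal_unitary_dilation J U,
      unitary_toL2 (bilateral U L) (L2 DT) iota /\
      (forall n h, eqT (iota (zpow U n (U (J h) - J (T h))))
                       (fun z => z ^ n *: defect T h)),
      [/\ unitary Res setT omegaD,
          forall n h, omegaD (iter n U (proj Res (J h))) = iter n WD (j (Qop h)),
          unitary_toL2 Res (DeltaL2 DT DTs Theta) omegaNF &
          forall l, bilateral U L l ->
            eqT (omegaNF (proj Res l)) (mulDelta DT DTs Theta (iota l))] &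
      (* W_k = u Wd_k u^* *)
      (forall x, eqT (W1 (u x)) (u (Wd1 x))) /\
      (forall x, eqT (W2 (u x)) (u (Wd2 x)))].

Definition char_unitaries (Theta : R[i] -> H -> H)
    (W1 W2 : (R[i] -> H) -> (R[i] -> H)) :=
  exists (RD : hilbertType R) (j : H -> RD) (X1s X2s : H -> H)
    (WD Wd1 Wd2 : RD -> RD) (K : hilbertType R) (J : H -> K) (U : K -> K)
    (iota : K -> R[i] -> H) (omegaD : K -> RD) (omegaNF : K -> R[i] -> H),
    canonical_tuple Theta W1 W2 j X1s X2s WD Wd1 Wd2 J U iota omegaD omegaNF.

(* The choices made in the construction do not matter: any triple obtained from
   some choice is a characteristic triple of (T1, T2). *)
Definition characteristic_triple (t : triple H H) :=
  [/\ tdom t = DT, tcod t = DTs,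
      forall z x, `|z| < 1 -> DT x -> tTheta t z x = char_fun z x,
      char_contractions (tG1 t) (tG2 t) &
      char_unitaries (tTheta t) (tW1 t) (tW2 t)].

End CharacteristicTriple.

(* Main.v *)
(* A unitary phi with phi T_k = T_k' phi transports every ingredient of the triple,
   so u = u_* = phi works; that the choices in the triple do not matter follows
   from intrinsic formulas: D_{T^*} G_1 D_{T^*} = T_1^* - T_2 T^*, and
   D_{T^*} G_2 D_{T^*} = T_2^* - T_1 T^*, while W_k is determined by Q h |-> Q T_k^* h.

   Conversely, let L and L_* be the wandering subspaces of the minimal unitary
   dilation U of T.  As T is c.n.u., the U^n L and U^n L_* span the dilation space,
   and the inner products of U^n L with U^m L_* are given by the Taylor coefficients
   of Theta_T.  Hence Theta_T' u = u_* Theta_T yields a unitary between the dilation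
   spaces which restricts to phi : H -> H' with phi T = T' phi, extending u and u_*.
   Put A_k = phi T_k^* - T_k'^* phi.  Equality of the W_k gives Q' A_k = 0, i.e.
   T'^*n A_k h -> 0.  Equality of the G_k gives <A_k h, phi g> = <A_k T^* h, phi T^* g>,
   and iterating this identity shows A_k = 0. *)
Require Import Defs.
From HB Require Import structures.
From mathcomp Require Import all_boot all_order all_algebra complex.
From mathcomp Require Import all_classical all_reals all_analysis.
From mathcomp Require Import measurable_realfun.
From mathcomp Require Import ring lra zify.
Import Defs.
Set Implicit Arguments.
Unset Strict Implicit.
Unset Printing Implicit Defensive.
Import Order.TTheory GRing.Theory Num.Theory.
Import numFieldNormedType.Exports.
Local Open Scope classical_set_scope.
Local Open Scope complex_scope.
Local Open Scope ring_scope.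

(** * Inner products *)

Section InnerProduct.
Variable R : realType.
Implicit Types E F : hilbertType R.

(** Square roots, adjoints and inverses are arbitrary choices with a default value, so each must
    either be shown to exist or be transported by unitaries in both cases. Existence of D_T and
    D_{T^*} is read off from the triple: the isometries iota and iota_* force |D_T h|^2 = |h|^2 - |T
    h|^2 and its dual. One Sylvester-type statement, that A^2 T = T B^2 implies A T = T B for
    positive A and B, yields the transport of square roots and T D_T = D_{T^*} T.

    Elements of L^2 are functions up to null sets, and u is a unitary on D_T only. Density arguments
    are therefore run in the dilation space and in the space of W_D, and functions in the closure of
    Delta L^2 are shown to take values in D_T almost everywhere, which makes u and phi
    interchangeable on them.

    In the converse G_1 and G_2 act together for each index: the relation from G_1 rewrites <A_1 h,
    phi g> as <phi T^* h, A_2 g>, and the one from G_2 leads back to A_1. The decay of T'^*n A_k h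
    comes from omega_D P_R h = Q h and P_R h = lim U^n T^*n h. *)

Definition cabs (a : R[i]) : R := complex.Re `|a|.

Lemma cabsE a : `|a| = (cabs a)%:C.
Proof.
rewrite /cabs; have := normr_ge0 a; case: `|a| => x y.
by rewrite lecE /= => /andP[/eqP -> _].
Qed.

Lemma cabs_ge0 a : 0 <= cabs a.
Proof. by rewrite -ler0c -cabsE. Qed.

Lemma cabs_eq0 a : cabs a = 0 -> a = 0.
Proof. by move=> h; apply/eqP; rewrite -normr_eq0 cabsE h. Qed.

Lemma cabsM a b : cabs (a * b) = cabs a * cabs b.
Proof. by apply: complexI; rewrite -cabsE normrM !cabsE rmorphM. Qed.

Lemma cabsD a b : cabs (a + b) <= cabs a + cabs b.
Proof. by rewrite -lecR -cabsE rmorphD /= -!cabsE ler_normD. Qed.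

Lemma cabsN a : cabs (- a) = cabs a.
Proof. by rewrite /cabs normrN. Qed.

Lemma cabsr (x : R) : 0 <= x -> cabs x%:C = x.
Proof. by move=> x0; rewrite /cabs ger0_norm ?ler0c. Qed.

Lemma cabs_sqr a : cabs a ^+ 2 = complex.Re a ^+ 2 + complex.Im a ^+ 2.
Proof. by apply: complexI; rewrite add_Re2_Im2 cabsE rmorphXn. Qed.

Lemma ReM (a b : R[i]) :
  complex.Re (a * b) =
  complex.Re a * complex.Re b - complex.Im a * complex.Im b.
Proof. by case: a => ? ?; case: b => ? ?. Qed.

Lemma ImM (a b : R[i]) :
  complex.Im (a * b) =
  complex.Re a * complex.Im b + complex.Im a * complex.Re b.
Proof. by case: a => ? ?; case: b => ? ?. Qed.

Lemma ReD (a b : R[i]) : complex.Re (a + b) = complex.Re a + complex.Re b.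
Proof. by case: a => ? ?; case: b => ? ?. Qed.

Lemma ImD (a b : R[i]) : complex.Im (a + b) = complex.Im a + complex.Im b.
Proof. by case: a => ? ?; case: b => ? ?. Qed.

Lemma ReN (a : R[i]) : complex.Re (- a) = - complex.Re a.
Proof. by case: a. Qed.

Lemma Re_conj (a : R[i]) : complex.Re (Num.conj a) = complex.Re a.
Proof. by case: a. Qed.

Lemma Im_conj (a : R[i]) : complex.Im (Num.conj a) = - complex.Im a.
Proof. by case: a. Qed.

Lemma complex_eq (a b : R[i]) :
  complex.Re a = complex.Re b -> complex.Im a = complex.Im b -> a = b.
Proof. by case: a => ? ?; case: b => ? ? /= -> ->. Qed.

Lemma innerC E (x y : E) : inner x y = Num.conj (inner y x).
Proof. by rewrite hermC expr0 mul1r. Qed.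

Lemma innerDl E (x y z : E) : inner (x + y) z = inner x z + inner y z.
Proof. exact: linearDl. Qed.
Lemma innerDr E (x y z : E) : inner z (x + y) = inner z x + inner z y.
Proof. exact: linearDr. Qed.
Lemma innerNl E (x z : E) : inner (- x) z = - inner x z.
Proof. exact: linearNl. Qed.
Lemma innerNr E (x z : E) : inner z (- x) = - inner z x.
Proof. exact: linearNr. Qed.
Lemma innerBl E (x y z : E) : inner (x - y) z = inner x z - inner y z.
Proof. exact: linearBl. Qed.
Lemma innerBr E (x y z : E) : inner z (x - y) = inner z x - inner z y.
Proof. exact: linearBr. Qed.
Lemma inner0l E (z : E) : inner 0 z = 0.
Proof. exact: linear0l. Qed.
Lemma inner0r E (z : E) : inner z 0 = 0.
Proof. exact: linear0r. Qed.
Lemma innerZl E a (x z : E) : inner (a *: x) z = a * inner x z.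
Proof. exact: linearZl_LR. Qed.
Lemma innerZr E a (x z : E) : inner z (a *: x) = Num.conj a * inner z x.
Proof. exact: linearZr_LR. Qed.

Lemma nrmE E (x : E) : `|x| = (nrm x)%:C.
Proof.
rewrite /nrm; have := normr_ge0 x; case: `|x| => a b.
by rewrite lecE /= => /andP[/eqP -> _].
Qed.

Lemma inner_nrm E (x : E) : inner x x = (nrm x ^+ 2)%:C.
Proof. by rewrite innerE nrmE rmorphXn. Qed.

Lemma nrm_ge0 E (x : E) : 0 <= nrm x.
Proof. by rewrite -ler0c -nrmE. Qed.

Lemma nrm_eq0 E (x : E) : nrm x = 0 -> x = 0.
Proof. by move=> h; apply/eqP; rewrite -normr_eq0 nrmE h. Qed.

Lemma nrm0 E : nrm (0 : E) = 0.
Proof. by rewrite /nrm normr0. Qed.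

Lemma nrmD E (x y : E) : nrm (x + y) <= nrm x + nrm y.
Proof. by rewrite -lecR -nrmE rmorphD /= -!nrmE ler_normD. Qed.

Lemma nrmN E (x : E) : nrm (- x) = nrm x.
Proof. by rewrite /nrm normrN. Qed.

Lemma nrmC E (x y : E) : nrm (x - y) = nrm (y - x).
Proof. by rewrite -nrmN opprB. Qed.

Lemma nrmZ E a (x : E) : nrm (a *: x) = cabs a * nrm x.
Proof. by apply: complexI; rewrite -nrmE normrZ nrmE cabsE rmorphM. Qed.

Lemma nrm_triB E (y x z : E) : nrm (x - z) <= nrm (x - y) + nrm (y - z).
Proof. by have := nrmD (x - y) (y - z); rewrite addrA subrK. Qed.

Definition dot E (x y : E) : R := complex.Re (inner x y).

Lemma dotC E (x y : E) : dot x y = dot y x.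
Proof. by rewrite /dot innerC Re_conj. Qed.
Lemma dotDl E (x y z : E) : dot (x + y) z = dot x z + dot y z.
Proof. by rewrite /dot innerDl ReD. Qed.
Lemma dotDr E (x y z : E) : dot z (x + y) = dot z x + dot z y.
Proof. by rewrite /dot innerDr ReD. Qed.
Lemma dotNl E (x z : E) : dot (- x) z = - dot x z.
Proof. by rewrite /dot innerNl ReN. Qed.
Lemma dotNr E (x z : E) : dot z (- x) = - dot z x.
Proof. by rewrite /dot innerNr ReN. Qed.
Lemma dot0l E (z : E) : dot 0 z = 0.
Proof. by rewrite /dot inner0l. Qed.
Lemma dot0r E (z : E) : dot z 0 = 0.
Proof. by rewrite /dot inner0r. Qed.
Lemma dotZl E (a : R) (x z : E) : dot (a%:C *: x) z = a * dot x z.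
Proof. by rewrite /dot innerZl ReM /= mul0r subr0. Qed.
Lemma dotZr E (a : R) (x z : E) : dot z (a%:C *: x) = a * dot z x.
Proof. by rewrite dotC dotZl dotC. Qed.
Lemma dotxx E (x : E) : dot x x = nrm x ^+ 2.
Proof. by rewrite /dot inner_nrm. Qed.

Lemma nrmD_sqr E (x y : E) :
  nrm (x + y) ^+ 2 = nrm x ^+ 2 + 2 * dot x y + nrm y ^+ 2.
Proof. by rewrite -!dotxx dotDl !dotDr (dotC y x); ring. Qed.

Lemma nrmB_sqr E (x y : E) :
  nrm (x - y) ^+ 2 = nrm x ^+ 2 - 2 * dot x y + nrm y ^+ 2.
Proof. by rewrite nrmD_sqr nrmN dotNr; ring. Qed.

Lemma parallelogram E (x y : E) :
  nrm (x + y) ^+ 2 + nrm (x - y) ^+ 2 = 2 * (nrm x ^+ 2 + nrm y ^+ 2).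
Proof. by rewrite nrmD_sqr nrmB_sqr; ring. Qed.

(** The imaginary part of <x, y> is Re <x, i y>, so identities for the real form [dot] extend to
    [inner] on complex subspaces. *)
Lemma inner_dot E (x y : E) : inner x y = dot x y +i* dot x ('i *: y).
Proof.
apply: complex_eq => //=; rewrite /dot innerZr ReM Re_conj Im_conj /=.
by rewrite mul0r sub0r mulN1r opprK.
Qed.

(** Expand the squared norm of |y| x - |x| y and divide by 2 |x| |y|. *)
Lemma nrm_dot_le E (x y : E) : dot x y <= nrm x * nrm y.
Proof.
have [x0|x0] := eqVneq (nrm x) 0.
  by rewrite (nrm_eq0 x0) dot0l nrm0 mul0r.
have := nrm_ge0 ((nrm y)%:C *: x - (nrm x)%:C *: y).
move=> /(fun h => sqr_ge0 (nrm ((nrm y)%:C *: x - (nrm x)%:C *: y))).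
rewrite nrmB_sqr !nrmZ !cabsr ?nrm_ge0 // dotZl dotZr => h.
have [y0|y0] := eqVneq (nrm y) 0.
  by rewrite (nrm_eq0 y0) dot0r nrm0 mulr0.
have xy : 0 < nrm x * nrm y.
  by rewrite mulr_gt0 // lt_def nrm_ge0 ?x0 ?y0.
rewrite -(ler_pM2l xy); nra.
Qed.

(** The real inequality at x and <x, y> y reads |<x, y>|^2 <= |<x, y>| |x| |y|. *)
Lemma cabs_inner_le E (x y : E) : cabs (inner x y) <= nrm x * nrm y.
Proof.
set a := inner x y.
have h : dot x (a *: y) = cabs a ^+ 2.
  by rewrite /dot innerZr -/a cabs_sqr ReM Re_conj Im_conj; ring.
have := nrm_dot_le x (a *: y); rewrite h nrmZ.
have [->|a0] := eqVneq (cabs a) 0; first by rewrite mulr_ge0 ?nrm_ge0.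
have a1 : 0 < cabs a by rewrite lt_def a0 cabs_ge0.
by rewrite mulrCA expr2 ler_pM2l.
Qed.

(** Norms and radii of balls live in [R[i]]; a positive element there is real, so real radii
    suffice. *)
Lemma closureP E (A : set E) x :
  closure A x <-> forall e : R, 0 < e -> exists2 a, A a & nrm (x - a) < e.
Proof.
split=> [cA e e0|h B].
  have /cA [a [Aa ha]] : nbhs x [set y | nrm (x - y) < e].
    apply/nbhs_ballP; exists e%:C; first by rewrite /= ltcR.
    by move=> y; rewrite -ball_normE /= nrmE ltcR.
  by exists a.
move=> /nbhs_ballP [e /= e0 eB].
have eE : e = (complex.Re e)%:C.
  by apply: complex_eq => //=; rewrite (ger0_Im (ltW e0)).
have [|a Aa ha] := h (complex.Re e); first by rewrite -ltcR -eE.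
by exists a; split => //; apply: eB; rewrite -ball_normE /= nrmE eE ltcR.
Qed.

Lemma closedP E (A : set E) :
  closed A <-> forall x, (forall e : R, 0 < e -> exists2 a, A a & nrm (x - a) < e) -> A x.
Proof.
split=> [cA x /closureP|h]; first by rewrite -(closure_id A).1.
by move=> x /closureP /h.
Qed.

Definition seq_lim E (u : nat -> E) (l : E) :=
  forall e : R, 0 < e -> exists N, forall n, (N <= n)%N -> nrm (u n - l) < e.

Lemma cvg_seq_lim E (u : nat -> E) (l : E) : u @ \oo --> l <-> seq_lim u l.
Proof.
split=> [/cvgrPdist_lt h e e0|h].
  have [|N _ hN] := h e%:C; first by rewrite ltcR.
  by exists N => n /hN /=; rewrite nrmE ltcR nrmC.
apply/cvgrPdist_lt => e e0.
have eE : e = (complex.Re e)%:C.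
  by apply: complex_eq => //=; rewrite (ger0_Im (ltW e0)).
have [|N hN] := h (complex.Re e); first by rewrite -ltcR -eE.
by exists N => // n /= /hN; rewrite nrmE eE ltcR nrmC.
Qed.

Lemma complete_seq E (u : nat -> E) :
  (forall e : R, 0 < e -> exists N, forall m n, (N <= m)%N -> (N <= n)%N ->
     nrm (u m - u n) < e) ->
  exists l, seq_lim u l.
Proof.
move=> h; have : cvg (u @ \oo).
  apply/cauchy_cvgP/cauchy_ballP => e e0.
  have eE : e = (complex.Re e)%:C.
    by apply: complex_eq => //=; rewrite (ger0_Im (ltW e0)).
  have [|N hN] := h (complex.Re e); first by rewrite -ltcR -eE.
  have hU : nbhs (u @ \oo) (u @` [set n | (N <= n)%N]).
    by exists N => // n hn; exists n.
  exists (u @` [set n | (N <= n)%N], u @` [set n | (N <= n)%N]) => //=.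
  move=> [x y] /= [[m hm <-] [n hn <-]].
  by rewrite -ball_normE /= nrmE eE ltcR hN.
by move=> /cvg_ex [l /cvg_seq_lim]; exists l.
Qed.

End InnerProduct.

(** * Subspaces, projections and adjoints *)

Section Subspaces.
Variable R : realType.
Implicit Types E F : hilbertType R.

Lemma eps0 (c M : R) : 0 <= c -> (forall e : R, 0 < e -> c <= e * M) -> c = 0.
Proof.
move=> c0 h; apply/eqP; rewrite eq_le c0 andbT leNgt; apply/negP => cp.
have M0 : 0 < M by have := h 1 ltr01; lra.
have := h (c / (2 * M)); rewrite divr_gt0 ?mulr_gt0 // => /(_ isT).
have -> : c / (2 * M) * M = c / 2 by field; lra.
lra.
Qed.

Lemma le_eps (a b M : R) : (forall e : R, 0 < e -> a <= b + e * M) -> a <= b.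
Proof.
move=> h; rewrite leNgt; apply/negP => ab.
suff : a - b = 0 by lra.
by apply: (@eps0 _ M) => [|e /h]; lra.
Qed.

Definition subspace E (A : set E) :=
  A 0 /\ forall (a : R[i]) x y, A x -> A y -> A (a *: x + y).

Lemma closed_subspaceW E (A : set E) : closed_subspace A -> subspace A.
Proof. by case. Qed.

Lemma closed_subspaceT E : closed_subspace (@setT E).
Proof. by split => //; exact: closedT. Qed.

Lemma subspaceT E : subspace (@setT E).
Proof. by []. Qed.
Hint Resolve closed_subspaceW closed_subspaceT subspaceT : core.

Section SubspaceTheory.
Variables (E F : hilbertType R) (A : set E) (hA : subspace A).

Lemma sub_L a x y : A x -> A y -> A (a *: x + y).
Proof. by case: hA => _; apply. Qed.
Lemma sub_0 : A 0. Proof. by case: hA. Qed.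
Lemma sub_D x y : A x -> A y -> A (x + y).
Proof. by case: hA => _ h Ax Ay; rewrite -[x]scale1r; apply: h. Qed.
Lemma sub_Z a x : A x -> A (a *: x).
Proof. by case: hA => h0 h Ax; rewrite -[_ *: _]addr0; apply: h. Qed.
Lemma sub_N x : A x -> A (- x).
Proof. by move=> Ax; rewrite -scaleN1r; apply: sub_Z. Qed.
Lemma sub_B x y : A x -> A y -> A (x - y).
Proof. by move=> Ax Ay; apply: sub_D => //; apply: sub_N. Qed.

Variables (f : E -> F) (hf : linear_on A f).
Lemma lin_0 : f 0 = 0.
Proof.
have := hf 1 sub_0 sub_0; rewrite !scale1r addr0 => h.
by apply: (addrI (f 0)); rewrite addr0 -h.
Qed.
Lemma lin_D x y : A x -> A y -> f (x + y) = f x + f y.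
Proof. by move=> Ax Ay; have := hf 1 Ax Ay; rewrite !scale1r. Qed.
Lemma lin_Z a x : A x -> f (a *: x) = a *: f x.
Proof. by move=> Ax; have := hf a Ax sub_0; rewrite lin_0 !addr0. Qed.
Lemma lin_N x : A x -> f (- x) = - f x.
Proof. by move=> Ax; rewrite -scaleN1r lin_Z // scaleN1r. Qed.
Lemma lin_B x y : A x -> A y -> f (x - y) = f x - f y.
Proof. by move=> Ax Ay; rewrite lin_D ?lin_N //; apply: sub_N. Qed.

Lemma linear_image_subspace : subspace (f @` A).
Proof.
split; first by exists 0; [exact: sub_0|exact: lin_0].
move=> a _ _ [x Ax <-] [y Ay <-]; exists (a *: x + y); last by rewrite hf.
by case: hA => _; apply.
Qed.

End SubspaceTheory.

Lemma bounded_nrm E F (A : set E) (f : E -> F) (M : R) :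
  (forall x, A x -> `|f x| <= M%:C * `|x|) ->
  forall x, A x -> nrm (f x) <= M * nrm x.
Proof. by move=> h x /h; rewrite !nrmE -rmorphM /= lecR. Qed.

Lemma boundedP E F (A : set E) (B : set F) (f : E -> F) : bounded_op A B f <->
  [/\ linear_on A f, (forall x, A x -> B (f x)) &
      exists2 M : R, 0 <= M & forall x, A x -> nrm (f x) <= M * nrm x].
Proof.
split=> [[lf fB [M hM]]|[lf fB [M M0 hM]]].
  split => //; first by move=> x Ax; apply: fB; exists x.
  exists `|M| => // x Ax; apply: le_trans (bounded_nrm hM Ax) _.
  by rewrite ler_wpM2r ?nrm_ge0 ?ler_norm.
split => //; first by move=> _ [x Ax <-]; apply: fB.
by exists M => x Ax; rewrite !nrmE -rmorphM lecR hM.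
Qed.

Lemma contractionP E F (A : set E) (B : set F) (f : E -> F) : contraction A B f <->
  [/\ linear_on A f, (forall x, A x -> B (f x)) &
      forall x, A x -> nrm (f x) <= nrm x].
Proof.
split=> [[lf fB hM]|[lf fB hM]].
  split => //; first by move=> x Ax; apply: fB; exists x.
  by move=> x /hM; rewrite !nrmE lecR.
split => //; first by move=> _ [x Ax <-]; apply: fB.
by move=> x Ax; rewrite !nrmE lecR hM.
Qed.

Lemma isometryP E F (A : set E) (B : set F) (f : E -> F) : isometry A B f <->
  [/\ linear_on A f, (forall x, A x -> B (f x)) &
      forall x, A x -> nrm (f x) = nrm x].
Proof.
split=> [[lf fB hM]|[lf fB hM]].
  split => //; first by move=> x Ax; apply: fB; exists x.
  by move=> x /hM; rewrite /nrm => ->.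
split => //; first by move=> _ [x Ax <-]; apply: fB.
by move=> x Ax; rewrite !nrmE hM.
Qed.

Lemma unitaryP E F (A : set E) (B : set F) (f : E -> F) : unitary A B f <->
  [/\ linear_on A f, (forall x, A x -> B (f x)),
      (forall y, B y -> exists2 x, A x & f x = y) &
      forall x, A x -> nrm (f x) = nrm x].
Proof.
split=> [[lf fB hM]|[lf fB fo hM]].
  split => //; [by move=> x Ax; rewrite -fB; exists x
    |by move=> y; rewrite -fB => -[x]; exists x|].
  by move=> x /hM; rewrite /nrm => ->.
split => //; last by move=> x Ax; rewrite !nrmE hM.
by apply/seteqP; split => [_ [x Ax <-]|y /fo [x ? ?]]; [apply: fB|exists x].
Qed.

Lemma contraction_bounded E F (A : set E) (B : set F) (f : E -> F) :
  contraction A B f -> bounded_op A B f.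
Proof.
move=> /contractionP[lf fB h]; apply/boundedP; split => //.
by exists 1 => // x Ax; rewrite mul1r h.
Qed.

Lemma isometry_contraction E F (A : set E) (B : set F) (f : E -> F) :
  isometry A B f -> contraction A B f.
Proof. by case=> h1 h2 h3; split => // x /h3 ->. Qed.

Lemma unitary_isometry E F (A : set E) (B : set F) (f : E -> F) :
  unitary A B f -> isometry A B f.
Proof. by case=> h1 h2 h3; split => //; rewrite h2. Qed.

Lemma iso_dot E F (A : set E) (f : E -> F) : subspace A -> linear_on A f ->
  (forall x, A x -> nrm (f x) = nrm x) ->
  forall x y, A x -> A y -> dot (f x) (f y) = dot x y.
Proof.
move=> sA lf hf x y Ax Ay; have := hf _ (sub_D sA Ax Ay).
move=> /(congr1 (fun t => t ^+ 2)); rewrite (lin_D lf) // !nrmD_sqr !hf //.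
lra.
Qed.

Lemma iso_inner E F (A : set E) (f : E -> F) : subspace A -> linear_on A f ->
  (forall x, A x -> nrm (f x) = nrm x) ->
  forall x y, A x -> A y -> inner (f x) (f y) = inner x y.
Proof.
move=> sA lf hf x y Ax Ay; rewrite !inner_dot -(lin_Z sA lf) //.
by rewrite !(iso_dot sA lf hf) //; apply: sub_Z.
Qed.

Lemma isometry_inner E F (A : set E) (B : set F) (f : E -> F) : subspace A ->
  isometry A B f -> forall x y, A x -> A y -> inner (f x) (f y) = inner x y.
Proof. by move=> sA /isometryP[lf _ hf]; exact: iso_inner. Qed.

Lemma isometry_inj E F (A : set E) (B : set F) (f : E -> F) : subspace A ->
  isometry A B f -> forall x y, A x -> A y -> f x = f y -> x = y.
Proof.
move=> sA /isometryP[lf _ nf] x y Ax Ay xy; apply/eqP; rewrite -subr_eq0.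
apply/eqP/nrm_eq0; rewrite -nf; last exact: sub_B.
by rewrite (lin_B sA lf) // xy subrr nrm0.
Qed.

Lemma inner_eq0_dot E (A : set E) x : subspace A ->
  (forall a, A a -> dot x a = 0) -> forall a, A a -> inner x a = 0.
Proof. by move=> sA h a Aa; rewrite inner_dot !h //; apply: sub_Z. Qed.

Lemma inner_self0 E (x : E) : inner x x = 0 -> x = 0.
Proof.
rewrite inner_nrm => /(@complexI _ _ 0) /eqP.
by rewrite sqrf_eq0 => /eqP /nrm_eq0.
Qed.

Lemma inner_eq_sub E (A : set E) x y : subspace A -> A x -> A y ->
  (forall a, A a -> inner x a = inner y a) -> x = y.
Proof.
move=> sA Ax Ay h; apply/eqP; rewrite -subr_eq0; apply/eqP/inner_self0.
by rewrite innerBl h ?subrr //; apply: sub_B.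
Qed.

Lemma inner_eq0C E (x y : E) : inner x y = 0 -> inner y x = 0.
Proof. by move=> h; rewrite innerC h rmorph0. Qed.

Lemma ocompl_closed E (S A : set E) : closed_subspace S -> closed_subspace (ocompl S A).
Proof.
move=> [S0 SL Sc]; split.
- by split => // y _; rewrite inner0l.
- move=> a x y [Sx hx] [Sy hy]; split; first exact: SL.
  by move=> z Az; rewrite innerDl innerZl hx ?hy // mulr0 addr0.
- apply/closedP => x h; split.
    by apply/(closedP S).1 => // e /h[a [Sa _] ?]; exists a.
  move=> y Ay; apply: cabs_eq0; apply: (@eps0 _ (nrm y)); first exact: cabs_ge0.
  move=> e e0; have [a [_ /(_ y Ay) ha] xa] := h e e0.
  have -> : inner x y = inner (x - a) y by rewrite innerBl ha subr0.
  by apply: le_trans (cabs_inner_le _ _) _; rewrite ler_wpM2r ?nrm_ge0 ?ltW.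
Qed.

Lemma seq_lim_mem E (A : set E) (u : nat -> E) l :
  closed A -> (forall n, A (u n)) -> seq_lim u l -> A l.
Proof.
move=> /closedP cA hu ul; apply: cA => e /ul [N /(_ N (leqnn N))].
by rewrite nrmC; exists (u N).
Qed.

Lemma agree_closed E F (A : set E) (f g : E -> F) : closed_subspace A ->
  bounded_op A setT f -> bounded_op A setT g ->
  closed_subspace [set x | A x /\ f x = g x].
Proof.
move=> hA /boundedP[lf _ [M M0 hM]] /boundedP[lg _ [N N0 hN]].
have sA := closed_subspaceW hA; split.
- by split; [exact: sub_0|rewrite (lin_0 sA lf) (lin_0 sA lg)].
- move=> a x y [Ax hx] [Ay hy]; split; first exact: sub_L.
  by rewrite lf // lg // hx hy.
- apply/closedP => x h.
  have Ax : A x.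
    by case: hA => _ _ /closedP; apply => e /h[a [Aa _] ?]; exists a.
  split => //; apply/eqP; rewrite -subr_eq0; apply/eqP/nrm_eq0.
  apply: (@eps0 _ (M + N)); first exact: nrm_ge0.
  move=> e /h [a [Aa fga] xa].
  have -> : f x - g x = f (x - a) - g (x - a).
    rewrite (lin_B sA lf) // (lin_B sA lg) // fga opprB addrA.
    by rewrite subrK.
  have Axa := sub_B sA Ax Aa.
  apply: le_trans (nrmD _ _) _; rewrite nrmN.
  have := hM _ Axa; have := hN _ Axa; have := nrm_ge0 (x - a); nra.
Qed.

Lemma closure_subspace E (A : set E) : subspace A -> closed_subspace (closure A).
Proof.
move=> sA; split; first by apply: subset_closure; exact: sub_0.
- move=> a x y /closureP hx /closureP hy; apply/closureP => e e0.
  have d0 : 0 < e / (2 * (cabs a + 1)).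
    by rewrite divr_gt0 // mulr_gt0 //; have := cabs_ge0 a; lra.
  have [x' Ax' hx'] := hx _ d0; have [y' Ay' hy'] := hy (e / 2) ltac:(lra).
  exists (a *: x' + y'); first exact: sub_L.
  have -> : a *: x + y - (a *: x' + y') = a *: (x - x') + (y - y').
    by rewrite scalerBr opprD addrACA.
  apply: le_lt_trans (nrmD _ _) _; rewrite nrmZ.
  have : cabs a * nrm (x - x') <= e / 2; last by move=> ?; lra.
  have -> : e / 2 = (cabs a + 1) * (e / (2 * (cabs a + 1))).
    by field; have := cabs_ge0 a; lra.
  by apply: ler_pM; rewrite ?cabs_ge0 ?nrm_ge0 ?lerDl // ltW.
- exact: closed_closure.
Qed.

Definition cspan E (S : set E) : set E := smallest (@closed_subspace R E) S.

Lemma cspan_sub E (S : set E) : S `<=` cspan S.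
Proof. by move=> x Sx A [_]; apply. Qed.

Lemma cspan_min E (S A : set E) : closed_subspace A -> S `<=` A -> cspan S `<=` A.
Proof. by move=> cA SA x; apply. Qed.

Lemma cspan_closed E (S : set E) : closed_subspace (cspan S).
Proof.
split.
- by move=> A [[? _ _] _].
- by move=> a x y hx hy A hA; case: (hA) => -[_ h _] _; apply: h; [apply: hx|apply: hy].
- apply/closedP => x h A hA; case: (hA) => -[_ _ /closedP cA] _.
  by apply: cA => e /h[a ha xa]; exists a => //; apply: ha.
Qed.

Lemma cspan_subspace E (S : set E) : subspace S -> cspan S = closure S.
Proof.
move=> sS; apply/seteqP; split.
  by apply: cspan_min; [exact: closure_subspace|exact: subset_closure].
move=> x /closureP h; have [_ _ /closedP] := cspan_closed S; apply.
by move=> e /h[a Sa ?]; exists a => //; exact: cspan_sub.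
Qed.

(** A minimizing sequence for the distance from x to A is Cauchy by the parallelogram law, and at
    its limit y the first variation of |x - y|^2 along A vanishes. *)
Lemma projection_exists E (A : set E) : closed_subspace A ->
  forall x, exists2 y, A y & forall a, A a -> inner (x - y) a = 0.
Proof.
move=> cA x; have sA := closed_subspaceW cA.
pose D := [set nrm (x - a) ^+ 2 | a in A].
have D0 : lbound D 0 by move=> _ [a _ <-]; exact: sqr_ge0.
have hD : has_inf D.
  by split; [exists (nrm (x - 0) ^+ 2); exists 0 => //; exact: sub_0|exists 0].
pose d := inf D.
have dle a : A a -> d <= nrm (x - a) ^+ 2.
  by move=> Aa; apply: ge_inf; [exists 0|exists a].
have hn (n : nat) : exists a, A a /\ nrm (x - a) ^+ 2 < d + n.+1%:R^-1.
  have [|_ [a Aa <-] ha] := @inf_adherent _ D n.+1%:R^-1 _ hD; last by exists a.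
  by rewrite invr_gt0 ltr0n.
have /choice[u hu] := hn.
(* Parallelogram law at x - u n and x - u m; their midpoint is x minus a vector of A, so its squared
   norm is at least d. *)
have uu m n : nrm (u m - u n) ^+ 2 <= 2 * m.+1%:R^-1 + 2 * n.+1%:R^-1.
  have [Am hm] := hu m; have [An hn'] := hu n.
  have := parallelogram (x - u n) (x - u m).
  have -> : x - u n - (x - u m) = u m - u n.
    by rewrite opprB addrC addrA subrK.
  have -> : x - u n + (x - u m) = 2%:C *: (x - (2^-1)%:C *: (u n + u m)).
    rewrite scalerBr scalerA -rmorphM /= divff ?pnatr_eq0 // scale1r.
    by rewrite -[2]/(1 + 1) rmorphD scalerDl scale1r opprD addrACA.
  rewrite nrmZ cabsr // exprMn.
  have := dle ((2^-1)%:C *: (u n + u m)) (sub_Z sA _ (sub_D sA An Am)).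
  move: hm hn'; move: (m.+1%:R^-1) (n.+1%:R^-1) => im jn hm hn'.
  set p := nrm (x - _) ^+ 2; set q := nrm (u m - u n) ^+ 2 => h1 h2; lra.
have [e e0|y uy] := @complete_seq _ _ u.
  have e2 : 0 < e ^+ 2 / 4 by have := exprn_gt0 2 e0; lra.
  have [N hN] : exists N, N.+1%:R^-1 < e ^+ 2 / 4.
    have := near_infty_natSinv_lt (PosNum e2) => -[N _ /(_ N (leqnn N))].
    by exists N.
  have hK k : (N <= k)%N -> k.+1%:R^-1 < e ^+ 2 / 4.
    by move=> Nk; apply: le_lt_trans hN; rewrite lef_pV2 ?posrE ?ltr0n // ler_nat.
  exists N => m n /hK hm /hK hn'; rewrite -ltr_sqr ?nnegrE ?nrm_ge0 ?ltW //.
  move: (uu m n) hm hn'; move: (m.+1%:R^-1) (n.+1%:R^-1) => im jn; lra.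
have Ay : A y.
  by apply: seq_lim_mem uy; [case: cA|move=> n; case: (hu n)].
have yd : nrm (x - y) ^+ 2 <= d.
  rewrite leNgt; apply/negP => dy.
  pose g := nrm (x - y) ^+ 2 - d; have g0 : 0 < g by rewrite subr_gt0.
  have K0 : 0 < g / (2 * (2 * nrm (x - y) + 1)).
    by rewrite divr_gt0 // mulr_gt0 //; have := nrm_ge0 (x - y); lra.
  (* This e gives e (2 |x - y| + 1) <= g / 2, so a vector within e of y has squared distance to x at
     least |x - y|^2 - g / 2. *)
  pose e := Num.min 1 (g / (2 * (2 * nrm (x - y) + 1))).
  have e0 : 0 < e by rewrite lt_min ltr01.
  have [N hN] := uy e e0.
  have [M hM] : exists M, M.+1%:R^-1 < g / 2.
    have g2 : 0 < g / 2 by lra.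
    have := near_infty_natSinv_lt (PosNum g2) => -[M _ /(_ M (leqnn M))].
    by exists M.
  have hk : (maxn N M).+1%:R^-1 < g / 2.
    by apply: le_lt_trans hM; rewrite lef_pV2 ?posrE ?ltr0n // ler_nat ltnS leq_maxr.
  have := hN _ (leq_maxl N M); have [_] := hu (maxn N M).
  set a := u _ => ha hay.
  have h1 := nrm_triB a x y.
  have eg : e * (2 * nrm (x - y) + 1) <= g / 2.
    have -> : g / 2 = g / (2 * (2 * nrm (x - y) + 1)) * (2 * nrm (x - y) + 1).
      by field; have := nrm_ge0 (x - y); lra.
    by rewrite ler_wpM2r ?ge_min ?lexx ?orbT //; have := nrm_ge0 (x - y); lra.
  have p0 := nrm_ge0 (x - y); have q0 := nrm_ge0 (x - a).
  rewrite /g in hk eg; set p := nrm (x - y) in h1 eg p0 hk *; set q := nrm (x - a) in h1 q0 ha.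
  move: hk ha; move: (_.+1%:R^-1) => i hk ha.
  have [pe|ep] := ltP p e.
    have := sqr_ge0 q; have : p ^+ 2 <= p * e by rewrite expr2 ler_wpM2l // ltW.
    have : 0 <= e * p by rewrite mulr_ge0 // ltW.
    lra.
  have : (p - e) ^+ 2 <= q ^+ 2 by rewrite ler_sqr ?nnegrE; lra.
  have := sqr_ge0 e; rewrite sqrrB; lra.
exists y => //; apply: inner_eq0_dot => // a Aa.
have hq (t : R) : 0 <= t ^+ 2 * nrm a ^+ 2 - 2 * t * dot (x - y) a.
  have := dle _ (sub_D sA Ay (sub_Z sA t%:C Aa)).
  rewrite opprD addrA nrmB_sqr dotZr nrmZ exprMn.
  have -> : cabs t%:C ^+ 2 = t ^+ 2 by rewrite cabs_sqr /= expr0n addr0.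
  lra.
set b := dot _ _ in hq *; set c := nrm a ^+ 2 in hq.
have c0 : 0 <= c by exact: sqr_ge0.
(* The quadratic has its minimum at b / c; the denominator c + 1 also covers a = 0. *)
have h1 := hq (b / (c + 1)); apply/eqP; rewrite -sqrf_eq0; apply/eqP.
have := sqr_ge0 b => b0.
have : (b / (c + 1)) ^+ 2 * c - 2 * (b / (c + 1)) * b =
  - (b ^+ 2 * ((c + 2) / (c + 1) ^+ 2)) by field; lra.
move=> hE; rewrite hE in h1.
have k0 : 0 < (c + 2) / (c + 1) ^+ 2.
  by rewrite divr_gt0 ?exprn_gt0 //; lra.
set k := _ / _ in h1 k0; nra.
Qed.

Lemma projP E (A : set E) : closed_subspace A ->
  forall x, A (proj A x) /\ forall a, A a -> inner (x - proj A x) a = 0.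
Proof.
move=> cA x; have [y Ay hy] := projection_exists cA x.
by rewrite /proj; case: xgetP => [z _ [Az hz] //|/(_ y)[]].
Qed.

Lemma proj_eq E (A : set E) : subspace A ->
  forall x y, A y -> (forall a, A a -> inner (x - y) a = 0) -> proj A x = y.
Proof.
move=> sA x y Ay hy; rewrite /proj; case: xgetP => [z _ [Az hz]|/(_ y)[] //].
apply: (inner_eq_sub sA) => // a Aa; apply/eqP; rewrite -subr_eq0 -innerBl.
have -> : z - y = (x - y) - (x - z) by rewrite opprB [RHS]addrC addrA subrK.
by rewrite innerBl hy // hz // subr0.
Qed.

Lemma csub_total E (A : set E) : closed_subspace A ->
  (forall x, (forall a, A a -> inner x a = 0) -> x = 0) -> A = setT.
Proof.
move=> cA h; apply/seteqP; split => // x _; have [Ap hp] := projP cA x.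
by have /eqP := h _ hp; rewrite subr_eq0 => /eqP ->.
Qed.

Lemma cspan_total E (S : set E) :
  (forall x, (forall a, S a -> inner x a = 0) -> x = 0) -> cspan S = setT.
Proof.
move=> h; apply: csub_total; first exact: cspan_closed.
by move=> x hx; apply: h => a Sa; apply: hx; apply: cspan_sub.
Qed.

Lemma cspan_ortho E (S : set E) x :
  (forall a, S a -> inner x a = 0) -> forall a, cspan S a -> inner x a = 0.
Proof.
move=> h a ca; apply: inner_eq0C.
have [|s Ss|] := @cspan_min _ S (ocompl setT [set x]) _ _ a ca.
- exact: ocompl_closed.
- by split => // _ ->; apply: inner_eq0C; apply: h.
- by move=> _; apply.
Qed.

(** If l does not vanish, take x0 outside its kernel N and let z be the component of x0 orthogonal
    to N. For every x the vector l(z) x - l(x) z lies in N, hence is orthogonal to z, and this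
    expresses l(x) through <x, z>. *)
Lemma riesz E (A : set E) (l : E -> R[i]) (M : R) : closed_subspace A ->
  (forall a x y, A x -> A y -> l (a *: x + y) = a * l x + l y) ->
  (forall x, A x -> cabs (l x) <= M * nrm x) ->
  exists2 v, A v & forall x, A x -> l x = inner x v.
Proof.
move=> cA ll hM; have sA := closed_subspaceW cA.
have l0 : l 0 = 0.
  have := ll 1 _ _ (sub_0 sA) (sub_0 sA); rewrite scale1r mul1r addr0 => h.
  by apply: (addrI (l 0)); rewrite addr0 -h.
have [h|/existsNP[x0 /not_implyP[Ax0 hx0]]] :=
    pselect (forall x, A x -> l x = 0).
  by exists 0; [exact: sub_0|move=> x /h ->; rewrite inner0r].
pose N := [set x | A x /\ l x = 0].
have cN : closed_subspace N.
  split; first by split => //; exact: sub_0.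
    move=> a x y [Ax lx] [Ay ly]; split; first exact: sub_L.
    by rewrite ll // lx ly mulr0 addr0.
  apply/closedP => x h.
  have Ax : A x.
    by case: cA => _ _ /closedP; apply => e /h[a [Aa _] ?]; exists a.
  split => //; apply: cabs_eq0; apply: (@eps0 _ `|M|); first exact: cabs_ge0.
  move=> e /h[a [Aa la] xa].
  have -> : l x = l (x - a).
    have := ll (-1) _ _ Aa Ax; rewrite scaleN1r la mulr0 add0r addrC => ->.
    by [].
  apply: le_trans (hM _ (sub_B sA Ax Aa)) _.
  have := ler_norm M; have := nrm_ge0 (x - a); have := normr_ge0 M; nra.
have [[Ap lp] hp] := projP cN x0.
pose z := x0 - proj N x0.
have Az : A z by apply: sub_B.
have lz : l z = l x0.
  have := ll (-1) _ _ Ap Ax0; rewrite scaleN1r lp mulr0 add0r addrC => ->.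
  by [].
have z0 : inner z z != 0.
  apply/eqP => /inner_self0 zz; apply: hx0; by rewrite -lz zz.
exists (Num.conj (l z / inner z z) *: z); first exact: sub_Z.
move=> x Ax; rewrite innerZr conjCK.
have Nx : N (l z *: x - l x *: z).
  split; first by apply: sub_B => //; apply: sub_Z.
  rewrite -scaleNr addrC ll //; last exact: sub_Z.
  rewrite -[l z *: x]addr0 ll //; last exact: sub_0.
  by rewrite l0; ring.
have := hp _ Nx => /inner_eq0C; rewrite innerBl !innerZl -/z => /eqP.
rewrite subr_eq0 => /eqP h; rewrite mulrAC h; field.
exact: z0.
Qed.

(** [adjoint] picks some map with the adjoint property, or zero if there is none; one candidate [g]
    therefore secures the property for the map that is picked. *)
Lemma adjoint_spec E F (A : set E) (B : set F) (f : E -> F) g :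
  (forall y, B y -> A (g y)) ->
  (forall x y, A x -> B y -> inner (f x) y = inner x (g y)) ->
  (forall y, B y -> A (adjoint A B f y)) /\
  (forall x y, A x -> B y -> inner (f x) y = inner x (adjoint A B f y)).
Proof.
move=> hg1 hg2; rewrite /adjoint; case: xgetP => [h _ [h1 h2]|/(_ g)[]].
  by split => // y By; apply: h1; exists y.
by split => // _ [y By <-]; apply: hg1.
Qed.

Lemma adjoint_eq E F (A : set E) (B : set F) (f : E -> F) g : subspace A ->
  (forall y, B y -> A (g y)) ->
  (forall x y, A x -> B y -> inner (f x) y = inner x (g y)) ->
  forall y, B y -> adjoint A B f y = g y.
Proof.
move=> sA g1 g2 y By; have [h1 h2] := adjoint_spec g1 g2.
apply: (inner_eq_sub sA); [exact: h1|exact: g1|move=> a Aa].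
by rewrite innerC -h2 // g2 // -innerC.
Qed.

Lemma adjointP E F (A : set E) (B : set F) (f : E -> F) :
  closed_subspace A -> bounded_op A B f ->
  (forall y, B y -> A (adjoint A B f y)) /\
  (forall x y, A x -> B y -> inner (f x) y = inner x (adjoint A B f y)).
Proof.
move=> cA /boundedP[lf fB [M M0 hM]].
have h y : exists v, A v /\ forall x, A x -> inner (f x) y = inner x v.
  have [||v Av hv] := @riesz _ A (fun x => inner (f x) y) (M * nrm y) cA.
  - by move=> a x1 x2 A1 A2; rewrite lf // innerDl innerZl.
  - move=> x Ax; apply: le_trans (cabs_inner_le _ _) _.
    by rewrite mulrAC ler_wpM2r ?nrm_ge0 ?hM.
  by exists v.
have /choice[g hg] := h.
by apply: (@adjoint_spec _ _ A B f g) => [y _|x y Ax _]; case: (hg y) => // _; apply.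
Qed.

Lemma unitary_adjoint E F (A : set E) (B : set F) (f : E -> F) : subspace A ->
  unitary A B f ->
  [/\ (forall y, B y -> A (adjoint A B f y)),
      (forall x, A x -> adjoint A B f (f x) = x) &
      (forall y, B y -> f (adjoint A B f y) = y)].
Proof.
move=> sA uf; have /unitaryP[lf fB fo hf] := uf.
have hg y : exists x, B y -> A x /\ f x = y.
  have [By|nB] := pselect (B y); last by exists 0.
  by have [x Ax fx] := fo _ By; exists x.
have /choice[g {}hg] := hg.
have g1 y : B y -> A (g y) by case/hg.
have g2 x y : A x -> B y -> inner (f x) y = inner x (g y).
  move=> Ax By; have [Ag fg] := hg _ By; rewrite -{1}fg.
  exact: (iso_inner sA lf hf).
have hE := adjoint_eq sA g1 g2.
split.
- by move=> y By; rewrite hE //; apply: g1.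
- move=> x Ax; rewrite hE; last exact: fB.
  have [Ag fg] := hg _ (fB _ Ax); apply: (inner_eq_sub sA) => // a Aa.
  by rewrite -(iso_inner sA lf hf) // fg (iso_inner sA lf hf).
- by move=> y By; rewrite hE //; case: (hg _ By).
Qed.

Lemma unitary_inv E F (A : set E) (B : set F) (f : E -> F) : subspace A ->
  unitary A B f -> unitary B A (adjoint A B f).
Proof.
move=> sA uf; have /unitaryP[lf fB fo hf] := uf.
have [h1 h2 h3] := unitary_adjoint sA uf.
apply/unitaryP; split => //.
- move=> a x y Bx By; rewrite -{1}(h3 _ Bx) -{1}(h3 _ By) -lf; try exact: h1.
  by rewrite h2 //; apply: sub_L => //; apply: h1.
- by move=> x Ax; exists (f x); [exact: fB|exact: h2].
- by move=> y By; rewrite -hf ?h3 //; apply: h1.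
Qed.

End Subspaces.
#[export] Hint Resolve closed_subspaceW closed_subspaceT subspaceT : core.

(** * Isometric extensions and positive square roots *)

Section IsometricExtension.
Variables (R : realType) (I : Type).

(** The graph of the map x i |-> y i on finite linear combinations. It is a relation because
    well-definedness only follows later, from the equality of the Gram matrices. *)
Inductive gram_span (E F : hilbertType R) (x : I -> E) (y : I -> F) :
  E -> F -> Prop :=
| gram_span0 : gram_span x y 0 0
| gram_spanL a i v w : gram_span x y v w ->
    gram_span x y (a *: x i + v) (a *: y i + w).

Definition gram_closure (E F : hilbertType R) (x : I -> E) (y : I -> F) v w :=
  forall e : R, 0 < e -> exists v' w',
    [/\ gram_span x y v' w', nrm (v - v') < e & nrm (w - w') < e].

Lemma gram_closure_sym (E F : hilbertType R) (x : I -> E) (y : I -> F) v w :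
  gram_closure x y v w -> gram_closure y x w v.
Proof.
move=> h e /h[v' [w' [hs hv hw]]]; exists w', v'; split => //.
by elim: hs => *; constructor.
Qed.

Section Gram.
Variables (E F : hilbertType R) (x : I -> E) (y : I -> F).
Hypothesis gram : forall i j, inner (x i) (x j) = inner (y i) (y j).

Lemma gram_span_lin a v w v' w' : gram_span x y v w -> gram_span x y v' w' ->
  gram_span x y (a *: v + v') (a *: w + w').
Proof.
move=> h h'; elim: h => [|b i {}v {}w _ ih]; first by rewrite !scaler0 !add0r.
by rewrite !scalerDr !scalerA -!addrA; constructor.
Qed.

Lemma gram_span_inner v w v' w' : gram_span x y v w -> gram_span x y v' w' ->
  inner w w' = inner v v'.
Proof.
move=> h h'; elim: h => [|b i {}v {}w _ ih]; first by rewrite !inner0l.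
rewrite !innerDl !innerZl ih; congr (_ * _ + _).
move: h' {ih} => h'; elim: h' => [|c j {}v' {}w' _ ih']; first by rewrite !inner0r.
by rewrite !innerDr !innerZr ih' gram.
Qed.

Lemma gram_span_nrm v w : gram_span x y v w -> nrm w = nrm v.
Proof.
move=> h; have := gram_span_inner h h; rewrite !inner_nrm => /complexI.
by move=> /eqP; rewrite eqrXn2 ?nrm_ge0 // => /eqP.
Qed.

Lemma gram_closure_nrm v w : gram_closure x y v w -> nrm w = nrm v.
Proof.
move=> h; apply/eqP; rewrite -subr_eq0 -normr_eq0; apply/eqP.
apply: (@eps0 _ _ 2) => // e /h[v' [w' [/gram_span_nrm hs hv hw]]].
have h1 := nrm_triB w' w 0; have h2 := nrm_triB v' v 0.
have h3 := nrm_triB w w' 0; have h4 := nrm_triB v v' 0.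
rewrite !subr0 (nrmC w' w) (nrmC v' v) in h1 h2 h3 h4.
by rewrite ler_norml; apply/andP; split; lra.
Qed.

Lemma gram_closure_lin a v w v' w' :
  gram_closure x y v w -> gram_closure x y v' w' ->
  gram_closure x y (a *: v + v') (a *: w + w').
Proof.
move=> h h' e e0; have c0 := cabs_ge0 a.
have d0 : 0 < e / (2 * (cabs a + 1)) by rewrite divr_gt0 // mulr_gt0 //; lra.
have [p [q [hs hp hq]]] := h _ d0.
have [p' [q' [hs' hp' hq']]] := h' (e / 2) ltac:(lra).
exists (a *: p + p'), (a *: q + q'); split; first exact: gram_span_lin.
all: rewrite opprD addrACA -scalerBr; apply: le_lt_trans (nrmD _ _) _.
all: rewrite nrmZ.
- have : cabs a * nrm (v - p) <= (cabs a + 1) * (e / (2 * (cabs a + 1))).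
    by apply: ler_pM; rewrite ?nrm_ge0 ?lerDl // ltW.
  have -> : (cabs a + 1) * (e / (2 * (cabs a + 1))) = e / 2 by field; lra.
  lra.
- have : cabs a * nrm (w - q) <= (cabs a + 1) * (e / (2 * (cabs a + 1))).
    by apply: ler_pM; rewrite ?nrm_ge0 ?lerDl // ltW.
  have -> : (cabs a + 1) * (e / (2 * (cabs a + 1))) = e / 2 by field; lra.
  lra.
Qed.

Lemma gram_closure_gen i : gram_closure x y (x i) (y i).
Proof.
move=> e e0; exists (1 *: x i + 0), (1 *: y i + 0); split.
- by constructor; constructor.
- by rewrite scale1r addr0 subrr nrm0.
- by rewrite scale1r addr0 subrr nrm0.
Qed.

Lemma gram_closure0 : gram_closure x y 0 0.
Proof. by move=> e e0; exists 0, 0; rewrite !subrr !nrm0; split => //; constructor. Qed.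

Lemma gram_closureB v w v' w' :
  gram_closure x y v w -> gram_closure x y v' w' ->
  gram_closure x y (v' - v) (w' - w).
Proof.
move=> h h'; have := gram_closure_lin (-1) h h'.
by rewrite !scaleN1r ![- _ + _]addrC.
Qed.

Lemma gram_closure_fun v w w' :
  gram_closure x y v w -> gram_closure x y v w' -> w = w'.
Proof.
move=> h h'; have /gram_closure_nrm := gram_closureB h' h.
by rewrite subrr nrm0 => /nrm_eq0 /eqP; rewrite subr_eq0 => /eqP.
Qed.

(** Completeness of F: approximants v_n of v come with partners w_n, and |w_m - w_n| = |v_m - v_n|
    makes the partners Cauchy. *)
Lemma gram_closure_total v : cspan (range x) v -> exists w, gram_closure x y v w.
Proof.
apply: (@cspan_min _ _ _ [set v | exists w, gram_closure x y v w]); last first.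
  by move=> _ [i _ <-]; exists (y i); exact: gram_closure_gen.
split.
- by exists 0; exact: gram_closure0.
- move=> a p q [p' hp] [q' hq]; exists (a *: p' + q').
  exact: gram_closure_lin.
apply/closedP => z h.
have hn (n : nat) : exists pq, gram_closure x y pq.1 pq.2 /\
    nrm (z - pq.1) < n.+1%:R^-1.
  by have [|p [p' hp] zp] := h n.+1%:R^-1; [rewrite invr_gt0|exists (p, p')].
have /choice[u hu] := hn.
have hK (e : R) : 0 < e -> exists N, forall k, (N <= k)%N -> nrm (z - (u k).1) < e.
  move=> e0; have := near_infty_natSinv_lt (PosNum e0) => -[N _ hN].
  by exists N => k /hN /=; case: (hu k) => _; exact: lt_trans.
have [e e0|w hw] := @complete_seq _ _ (fun n => (u n).2).
  have [N hN] := hK (e / 2) ltac:(lra).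
  exists N => m n /hN hm /hN hn'.
  have [hum _] := hu m; have [hun _] := hu n.
  rewrite (gram_closure_nrm (gram_closureB hun hum)).
  have := nrm_triB z (u m).1 (u n).1; rewrite (nrmC (u m).1 z); lra.
exists w => e e0; have [N hN] := hK (e / 2) ltac:(lra).
have [M hM] := hw (e / 2) ltac:(lra).
have := hN _ (leq_maxl N M); have := hM _ (leq_maxr N M).
set k := maxn N M => h1 h2; have [/(_ (e / 2) ltac:(lra)) [p [q [hs hp hq]]] _] := hu k.
exists p, q; split => //.
  by have := nrm_triB (u k).1 z p; lra.
by have := nrm_triB (u k).2 w q; rewrite (nrmC w (u k).2); lra.
Qed.

Lemma gram_closure_dom v w : gram_closure x y v w -> cspan (range x) v.
Proof.
move=> h; have [_ _ /closedP] := cspan_closed (range x); apply.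
move=> e /h[v' [w' [hs hv _]]]; exists v' => //.
have sX : subspace (cspan (range x)) by apply/closed_subspaceW/cspan_closed.
elim: hs => [|a i {hv}v' {}w' _ ih]; first exact: sub_0.
by apply: (sub_L sX) => //; apply: cspan_sub; exists i.
Qed.

End Gram.

(** The closed graph is single-valued because partners have equal norms. It is symmetric in [x] and
    [y], so totality on one side is surjectivity on the other. *)
Lemma isometric_extension (E F : hilbertType R) (x : I -> E) (y : I -> F) :
  (forall i j, inner (x i) (x j) = inner (y i) (y j)) ->
  exists2 Psi, unitary (cspan (range x)) (cspan (range y)) Psi &
    forall i, Psi (x i) = y i.
Proof.
move=> gram; have gram' i j : inner (y i) (y j) = inner (x i) (x j) by rewrite gram.
have hex v : exists w, cspan (range x) v -> gram_closure x y v w.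
  have [/(gram_closure_total gram)[w hw]|nv] := pselect (cspan (range x) v).
    by exists w.
  by exists 0.
have /choice[Psi hP] := hex.
have sX : subspace (cspan (range x)) by apply/closed_subspaceW/cspan_closed.
exists Psi; last first.
  move=> i; apply: (gram_closure_fun gram); last exact: gram_closure_gen.
  by apply: hP; apply: cspan_sub; exists i.
apply/unitaryP; split.
- move=> a v w hv hw; apply: (gram_closure_fun gram); last first.
    by apply: gram_closure_lin; apply: hP.
  by apply: hP; apply: (sub_L sX).
- by move=> v /hP /gram_closure_sym /gram_closure_dom.
- move=> w /(gram_closure_total gram') [v /gram_closure_sym hv].
  have dv := gram_closure_dom hv.
  by exists v => //; apply: (gram_closure_fun gram) hv; apply: hP.
- by move=> v /hP /(gram_closure_nrm gram).
Qed.

End IsometricExtension.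

(** * Positive operators, a Sylvester equation, and transport of chosen operators *)

Section PositiveOperators.
Variable R : realType.
Implicit Types E F : hilbertType R.

Lemma discr_le (a b c : R) : 0 <= a -> 0 <= c ->
  (forall t, 0 <= a + 2 * t * b + t ^+ 2 * c) -> b ^+ 2 <= a * c.
Proof.
move=> a0 c0 h; have [c1|c1] := eqVneq c 0.
  have [->|b0] := eqVneq b 0; first by rewrite expr0n /= mulr_ge0.
  (* For c = 0 the polynomial is affine in t, and this t gives it the value -1. *)
  have := h (- (a + 1) / (2 * b)); rewrite c1 mulr0 addr0.
  have -> : a + 2 * (- (a + 1) / (2 * b)) * b = -1 by field.
  by rewrite lerNr oppr0 ler10.
have cp : 0 < c by rewrite lt_def c1.
have := h (- b / c).
have -> : a + 2 * (- b / c) * b + (- b / c) ^+ 2 * c = (a * c - b ^+ 2) / c.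
  by field; lra.
by rewrite pmulr_lge0 ?invr_gt0 // subr_ge0.
Qed.

Section Positive.
Variables (E : hilbertType R) (A : set E) (f : E -> E).
Hypotheses (sA : subspace A) (hf : positive_op A f).

(** Positivity implies symmetry: <f z, z> is real at x, y and x + i y, and its imaginary part at x +
    i y is the difference of the two sides. *)
Lemma posop_dot x y : A x -> A y -> dot (f x) y = dot x (f y).
Proof.
case: hf => /boundedP[lf fA _] hp Ax Ay.
have h z : A z -> complex.Im (inner (f z) z) = 0 by move=> /hp /ger0_Im.
have h1 := h _ (sub_D sA Ax (sub_Z sA 'i Ay)).
move: h1; rewrite (lin_D lf) //; last exact: sub_Z.
rewrite (lin_Z sA lf) // innerDl !innerDr !ImD h //.
rewrite !innerZl !innerZr !ImM !ReM !Im_conj !Re_conj /=.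
rewrite /dot (innerC x) Re_conj; have := h _ Ay; lra.
Qed.

Lemma posop_inner x y : A x -> A y -> inner (f x) y = inner x (f y).
Proof.
case: (hf) => /boundedP[lf fA _] hp Ax Ay.
by rewrite !inner_dot -(lin_Z sA lf) // !posop_dot //; apply: sub_Z.
Qed.

Lemma posop_ge0 x : A x -> 0 <= dot (f x) x.
Proof. by case: hf => _ h /h; rewrite /dot lecE => /andP[]. Qed.

(** Cauchy-Schwarz for the semidefinite form <f x, y> at the vectors x and f x: |f x|^4 <= <f x, x>
    <f f x, f x> <= <f x, x> b |f x|^2. *)
Lemma posop_nrm (b : R) : 0 <= b -> (forall x, A x -> nrm (f x) <= b * nrm x) ->
  forall x, A x -> nrm (f x) ^+ 2 <= b * dot (f x) x.
Proof.
case: (hf) => /boundedP[lf fA _] hp b0 hb x Ax; have Af := fA _ Ax.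
have := @discr_le (dot (f x) x) (nrm (f x) ^+ 2) (dot (f (f x)) (f x)).
rewrite !posop_ge0 // => /(_ isT isT) h.
have {h} : nrm (f x) ^+ 2 ^+ 2 <= dot (f x) x * dot (f (f x)) (f x).
  apply: h => t; have := posop_ge0 (sub_D sA Ax (sub_Z sA t%:C Af)).
  rewrite (lin_D lf) ?(lin_Z sA lf) //; last exact: sub_Z.
  rewrite dotDl !dotDr !dotZl !dotZr dotxx (posop_dot Af Ax) dotxx.
  lra.
have h2 : dot (f (f x)) (f x) <= b * nrm (f x) ^+ 2.
  apply: le_trans (nrm_dot_le _ _) _.
  by rewrite expr2 mulrA ler_wpM2r ?nrm_ge0 ?hb.
have := posop_ge0 Ax; set q := dot (f x) x => q0 h1.
have [->|n0] := eqVneq (nrm (f x)) 0; first by rewrite expr0n /= mulr_ge0.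
have n1 : 0 < nrm (f x) ^+ 2 by rewrite exprn_gt0 // lt_def n0 nrm_ge0.
rewrite -(ler_pM2r n1) -expr2; apply: le_trans h1 _.
by rewrite mulrAC [leRHS]mulrC ler_wpM2l.
Qed.

End Positive.

(* Pick almost maximizing unit vectors [x] for [C = AT - TB].  Since [A C = - C B],
   the positive numbers <A C x, C x> and <B x, x> both almost vanish, hence so
   do [A C x] and [B x], and |C x|^2 = <T x, A C x> - <T B x, C x>. *)
Lemma sylvester_pos E F (M : set F) (N : set E) (A : F -> F) (B : E -> E)
    (T : E -> F) : subspace M -> subspace N ->
  positive_op M A -> positive_op N B -> bounded_op N M T ->
  (forall x, N x -> A (A (T x)) = T (B (B x))) ->
  forall x, N x -> A (T x) = T (B x).
Proof.
move=> sM sN pA pB /boundedP[lT TM [tau tau0 hT]] hAB.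
have [/boundedP[lA AM [a a0 hA]] _] := pA.
have [/boundedP[lB BN [b b0 hB]] _] := pB.
pose C x := A (T x) - T (B x).
have CM x : N x -> M (C x).
  by move=> Nx; apply: sub_B => //; [apply/AM/TM|apply/TM/BN].
have lC : linear_on N C.
  move=> c x y Nx Ny; rewrite /C lT // lA; try exact: TM.
  rewrite lB // lT; try exact: BN.
  by rewrite scalerBr opprD addrACA.
have AC x : N x -> A (C x) = - C (B x).
  move=> Nx; rewrite /C (lin_B sM lA) ?hAB ?opprB //; first exact/AM/TM.
  exact/TM/BN.
have CB x : N x -> nrm (C x) <= (a * tau + tau * b) * nrm x.
  move=> Nx; apply: le_trans (nrmD _ _) _; rewrite nrmN mulrDl -!mulrA lerD //.
    apply: le_trans (hA _ (TM _ Nx)) _; by rewrite ler_wpM2l ?hT.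
  apply: le_trans (hT _ (BN _ Nx)) _; by rewrite ler_wpM2l ?hB.
pose S := [set nrm (C x) ^+ 2 | x in [set x | N x /\ nrm x <= 1]].
have S0 : S 0.
  exists 0; first by split; [exact: sub_0|rewrite nrm0].
  by rewrite (lin_0 sN lC) nrm0 expr0n.
have hS : has_sup S.
  split; first by exists 0.
  exists ((a * tau + tau * b) ^+ 2) => _ [x [Nx x1] <-].
  rewrite ler_sqr ?nnegrE ?nrm_ge0 ?addr_ge0 ?mulr_ge0 //.
  apply: le_trans (CB _ Nx) _.
  by rewrite -[leRHS]mulr1 ler_wpM2l // addr_ge0 ?mulr_ge0.
(* K is the squared operator norm of C on N; everything below serves to show that it is 0. *)
pose K := sup S.
have K0 : 0 <= K by apply: ub_le_sup => //; case: hS.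
have hK1 x : N x -> nrm x <= 1 -> nrm (C x) ^+ 2 <= K.
  by move=> Nx x1; apply: ub_le_sup; [case: hS|exists x].
have hK x : N x -> nrm (C x) ^+ 2 <= K * nrm x ^+ 2.
  move=> Nx; have [x0|x0] := eqVneq (nrm x) 0.
    by rewrite (nrm_eq0 x0) (lin_0 sN lC) !nrm0 expr0n /= mulr0.
  have xp : 0 < nrm x by rewrite lt_def x0 nrm_ge0.
  have := hK1 _ (sub_Z sN (nrm x)^-1%:C Nx).
  rewrite (lin_Z sN lC) // !nrmZ cabsr ?invr_ge0 ?nrm_ge0 // mulVf // lexx.
  move=> /(_ isT); rewrite exprMn exprVn mulrC ler_pdivrMr //.
  by rewrite exprn_gt0.
suff KE : K = 0.
  move=> x Nx; apply/eqP; rewrite -subr_eq0; apply/eqP/nrm_eq0/eqP.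
  rewrite -sqrf_eq0; apply/eqP/le_anti; rewrite sqr_ge0 andbT.
  by have := hK _ Nx; rewrite KE mul0r.
apply/eqP; apply: contraT => Kn0; have {Kn0}Kp : 0 < K by rewrite lt_def Kn0.
(* L gathers the constants of |C x|^4 <= 2 tau^2 (a + b) w and w^2 <= e K b^2, which together give
   |C x|^8 <= L e. The choice of e makes this contradict |C x|^2 >= K / 2. *)
pose L := 4 * tau ^+ 4 * (a + b) ^+ 2 * (K * b ^+ 2).
have L0 : 0 <= L.
  by rewrite /L !mulr_ge0 ?exprn_ge0 ?addr_ge0.
pose e := Num.min (K / 2) (K ^+ 4 / (16 * (L + 1))).
have e0 : 0 < e.
  by rewrite lt_min !divr_gt0 ?exprn_gt0 // mulr_gt0 //; lra.
have [_ [x [Nx x1] <-] hx] := sup_adherent e0 hS; rewrite -/K in hx.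
have hX := hK1 _ Nx x1.
pose s := K * nrm x ^+ 2 - nrm (C x) ^+ 2.
have s0 : 0 <= s by rewrite subr_ge0 hK.
have se : s <= e.
  have : K * nrm x ^+ 2 <= K * 1.
    by rewrite ler_wpM2l // expr_le1 ?nrm_ge0.
  by rewrite /s; lra.
have NB := BN _ Nx.
(* The form K <x, y> - <C x, C y> is positive and nearly vanishes at (x, x), so Cauchy-Schwarz makes
   w, its value at (B x, x), small. As C B = - A C, w is a sum of two nonnegative terms. *)
pose w := K * dot (B x) x - dot (C (B x)) (C x).
have wE : w ^+ 2 <= s * (K * b ^+ 2).
  have h : w ^+ 2 <= s * (K * nrm (B x) ^+ 2 - nrm (C (B x)) ^+ 2).
    apply: discr_le => //; first by rewrite subr_ge0 hK.
    move=> t; have := hK _ (sub_D sN Nx (sub_Z sN t%:C NB)).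
    rewrite (lin_D lC) ?(lin_Z sN lC) //; last exact: sub_Z.
    rewrite (nrmD_sqr x) (nrmD_sqr (C x)) !dotZr !nrmZ !exprMn.
    have -> : cabs t%:C ^+ 2 = t ^+ 2 by rewrite cabs_sqr /= expr0n addr0.
    by rewrite /w /s (dotC (B x) x) (dotC (C (B x))); lra.
  apply: le_trans h _; rewrite ler_wpM2l // lerBlDr.
  apply: le_trans (_ : K * b ^+ 2 * 1 <= _); last first.
    by rewrite mulr1 lerDl sqr_ge0.
  rewrite -mulrA ler_wpM2l // mulr1 ler_sqr ?nnegrE ?nrm_ge0 //.
  by apply: le_trans (hB _ Nx) _; rewrite -[leRHS]mulr1 ler_wpM2l.
pose p := dot (A (C x)) (C x); pose q := dot (B x) x.
have p0 : 0 <= p by exact: (posop_ge0 pA (CM _ Nx)).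
have q0 : 0 <= q by exact: (posop_ge0 pB Nx).
have wpq : w = p + K * q by rewrite /w /p AC // dotNl -/q addrC.
have hal := posop_nrm sM pA a0 hA (CM _ Nx); rewrite -/p in hal.
have hbe := posop_nrm sN pB b0 hB Nx; rewrite -/q in hbe.
have hC : nrm (C x) ^+ 2 <= tau * nrm (A (C x)) + tau * nrm (B x) * nrm (C x).
  rewrite -dotxx {1}/C dotDl dotNl.
  rewrite (posop_dot sM pA (TM _ Nx) (CM _ Nx)) lerD //.
    apply: le_trans (nrm_dot_le _ _) _; rewrite ler_wpM2r ?nrm_ge0 //.
    apply: le_trans (hT _ Nx) _; by rewrite -[leRHS]mulr1 ler_wpM2l.
  rewrite -dotNl; apply: le_trans (nrm_dot_le _ _) _.
  by rewrite ler_wpM2r ?nrm_ge0 // nrmN hT.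
have := nrm_ge0 (A (C x)); have := nrm_ge0 (B x); have := nrm_ge0 (C x).
set X := nrm (C x) in hx hX hC *; set al := nrm (A _) in hal hC *.
set be := nrm (B x) in hbe hC * => X0 be0 al0.
have h4 : (X ^+ 2) ^+ 2 <= 2 * tau ^+ 2 * (a + b) * w.
  apply: le_trans (_ : (tau * al + tau * be * X) ^+ 2 <= _).
    rewrite ler_sqr ?nnegrE ?sqr_ge0 // addr_ge0 ?mulr_ge0 //.
  apply: le_trans (_ : 2 * tau ^+ 2 * (al ^+ 2 + be ^+ 2 * X ^+ 2) <= _).
    by have := sqr_ge0 (tau * al - tau * be * X); lra.
  rewrite -[leRHS]mulrA ler_wpM2l ?mulr_ge0 ?sqr_ge0 // wpq.
  have : be ^+ 2 * X ^+ 2 <= b * q * K by apply: ler_pM; rewrite ?sqr_ge0.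
  have : 0 <= b * p by rewrite mulr_ge0.
  have : 0 <= a * (K * q) by rewrite !mulr_ge0.
  lra.
have w0 : 0 <= w by rewrite wpq addr_ge0 ?mulr_ge0.
have h8 : ((X ^+ 2) ^+ 2) ^+ 2 <= L * e.
  apply: le_trans (_ : (2 * tau ^+ 2 * (a + b) * w) ^+ 2 <= _).
    have Y0 : 0 <= 2 * tau ^+ 2 * (a + b) * w.
      by apply: mulr_ge0 => //; rewrite !mulr_ge0 ?sqr_ge0 ?addr_ge0.
    by rewrite ler_sqr // nnegrE; apply: sqr_ge0.
  have -> : (2 * tau ^+ 2 * (a + b) * w) ^+ 2 =
    4 * tau ^+ 4 * (a + b) ^+ 2 * w ^+ 2 by ring.
  have -> : L * e = 4 * tau ^+ 4 * (a + b) ^+ 2 * (e * (K * b ^+ 2)).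
    by rewrite /L; ring.
  rewrite ler_wpM2l ?mulr_ge0 ?exprn_ge0 ?addr_ge0 //.
  by apply: le_trans wE _; rewrite ler_wpM2r ?mulr_ge0 ?sqr_ge0.
have eK : e <= K / 2 by rewrite ge_min lexx.
have h16 : K ^+ 4 / 16 <= ((X ^+ 2) ^+ 2) ^+ 2.
  have -> : K ^+ 4 / 16 = ((K / 2) ^+ 2) ^+ 2 by field.
  by rewrite ler_sqr ?nnegrE ?sqr_ge0 // ler_sqr ?nnegrE ?sqr_ge0; lra.
have : L * e < K ^+ 4 / 16.
  apply: le_lt_trans (_ : L * (K ^+ 4 / (16 * (L + 1))) < _).
    by rewrite ler_wpM2l // ge_min lexx orbT.
  have -> : L * (K ^+ 4 / (16 * (L + 1))) = K ^+ 4 / 16 * (L / (L + 1)).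
    by field; lra.
  rewrite -[ltRHS]mulr1 ltr_pM2l ?divr_gt0 ?exprn_gt0 //.
  by rewrite ltr_pdivrMr ?mul1r; lra.
lra.
Qed.

Lemma psqrtP E (A : set E) f g :
  positive_op A g -> (forall x, A x -> g (g x) = f x) ->
  positive_op A (psqrt A f) /\ forall x, A x -> psqrt A f (psqrt A f x) = f x.
Proof.
by move=> h1 h2; rewrite /psqrt; case: xgetP => [h _ []|/(_ g)[]].
Qed.

Lemma positive_op_conj E F (A : set E) (B : set F) (u : E -> F) g :
  subspace A -> unitary A B u -> positive_op A g ->
  positive_op B (fun y => u (g (adjoint A B u y))).
Proof.
move=> sA uu [/boundedP[lg gA [M M0 hM]] hp].
have [h1 h2 h3] := unitary_adjoint sA uu.
have /unitaryP[lu uB _ hu] := uu.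
have /unitaryP[lv _ _ hv] := unitary_inv sA uu.
split.
  apply/boundedP; split.
  - by move=> a x y Bx By; rewrite lv // lg ?lu //; try apply: gA; apply: h1.
  - by move=> y By; apply/uB/gA/h1.
  - exists M => // y By; rewrite hu; last exact/gA/h1.
    by rewrite -(hv _ By) hM //; apply: h1.
move=> y By; rewrite -{2}(h3 _ By) (iso_inner sA lu hu).
- by apply: hp; apply: h1.
- exact/gA/h1.
- exact: h1.
Qed.

(** Existence of a positive root passes along u in both directions. If roots exist, [sylvester_pos]
    with u as the intertwiner identifies the chosen ones; otherwise both choices are the default
    zero. *)
Lemma psqrt_equiv E F (A : set E) (B : set F) (u : E -> F) f f' :
  subspace A -> subspace B -> unitary A B u -> (forall x, A x -> A (f x)) ->
  (forall x, A x -> f' (u x) = u (f x)) ->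
  forall x, A x -> psqrt B f' (u x) = u (psqrt A f x).
Proof.
move=> sA sB uu fA hf x Ax.
have /unitaryP[lu uB uo hu] := uu.
have [h1 h2 h3] := unitary_adjoint sA uu.
have hf' y : B y -> B (f' y).
  by move=> By; rewrite -(h3 _ By) hf; [apply/uB/fA/h1|apply: h1].
have [[g [pg hg]]|nog] := pselect (exists g, positive_op A g /\ forall x, A x -> g (g x) = f x).
  have [p1 s1] := psqrtP pg hg.
  have [|p2 s2] := @psqrtP _ B f' _ (positive_op_conj sA uu pg).
    have [/boundedP[_ gA _] _] := pg.
    move=> y By; rewrite h2 ?hg; try exact/gA/h1; last exact: h1.
    by rewrite -hf ?h3 //; apply: h1.
  apply: (sylvester_pos sB sA p2 p1) Ax.
    by apply/contraction_bounded/isometry_contraction/unitary_isometry.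
  by move=> y Ay; rewrite s2 ?s1 ?hf //; apply: uB.
have nog' : ~ exists g, positive_op B g /\ forall x, B x -> g (g x) = f' x.
  move=> [g [pg hg]]; apply: nog.
  have uv := unitary_inv sA uu; have [k1 k2 k3] := unitary_adjoint sB uv.
  exists (fun y => adjoint A B u (g (adjoint B A (adjoint A B u) y))).
  split; first exact: (positive_op_conj sB uv pg).
  have [/boundedP[_ gB _] _] := pg.
  have kE y : A y -> adjoint B A (adjoint A B u) y = u y.
    by move=> Ay; rewrite -{1}(h2 _ Ay) k2 //; apply: uB.
  move=> y Ay; rewrite kE // kE ?h3 ?hg ?hf ?h2 //; try exact: fA.
  - exact: uB.
  - exact/gB/uB.
  - exact/h1/gB/uB.
have -> : psqrt B f' = fun=> 0.
  by rewrite /psqrt; case: xgetP => // g _ hg; case: nog'; exists g.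
have -> : psqrt A f = fun=> 0.
  by rewrite /psqrt; case: xgetP => // g _ hg; case: nog; exists g.
by rewrite (lin_0 sA lu).
Qed.

(** Either adjoints exist on both sides, where the adjoint relation determines them, or both choices
    are the default zero. It is applied to the boundary values of Theta. *)
Lemma adjoint_equiv E F E' F' (A : set E) (B : set F) (A' : set E') (B' : set F')
    (u : E -> E') (w : F -> F') (b : E -> F) (b' : E' -> F') :
  subspace A -> subspace B -> subspace A' ->
  unitary A A' u -> unitary B B' w -> (forall x, A x -> B (b x)) ->
  (forall x, A x -> b' (u x) = w (b x)) ->
  forall y, B y -> adjoint A' B' b' (w y) = u (adjoint A B b y).
Proof.
move=> sA sB sA' uu uw bB hb y By.
have /unitaryP[lu uA' uo hu] := uu.
have /unitaryP[lw wB' wo hw] := uw.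
have [h1 h2 h3] := unitary_adjoint sA uu.
have [k1 k2 k3] := unitary_adjoint sB uw.
have [[g [g1 g2]]|nog] := pselect (exists g, (forall y, B y -> A (g y)) /\
    forall x y, A x -> B y -> inner (b x) y = inner x (g y)).
  rewrite (adjoint_eq sA g1 g2 By).
  rewrite (@adjoint_eq _ _ _ A' B' b' (fun z => u (g (adjoint B B' w z)))) //.
  - by rewrite k2.
  - by move=> z B'z; apply/uA'/g1/k1.
  - move=> x z A'x B'z; rewrite -{1}(h3 _ A'x) hb; last exact: h1.
    rewrite -{1}(k3 _ B'z) (iso_inner sB lw hw); try exact: k1; last exact/bB/h1.
    rewrite g2; try exact: k1; last exact: h1.
    rewrite -(iso_inner sA lu hu) ?h3 //; [exact: h1|exact/g1/k1].
  - exact: wB'.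
have -> : adjoint A B b = fun=> 0.
  rewrite /adjoint; case: xgetP => // g _ [hg1 hg2]; case: nog; exists g; split => // z Bz.
  by apply: hg1; exists z.
have -> : adjoint A' B' b' = fun=> 0.
  rewrite /adjoint; case: xgetP => // g _ [hg1 hg2]; case: nog.
  have g1 z : B' z -> A' (g z) by move=> B'z; apply: hg1; exists z.
  exists (fun z => adjoint A A' u (g (w z))); split.
    by move=> z Bz; apply/h1/g1/wB'.
  move=> x z Ax Bz; rewrite -(iso_inner sB lw hw) //; last exact: bB.
  rewrite -hb // hg2; [|exact: uA'|exact: wB'].
  rewrite -{1}(h3 (g (w z))); last exact/g1/wB'.
  by rewrite (iso_inner sA lu hu) //; exact/h1/g1/wB'.
by rewrite (lin_0 sA lu).
Qed.

(** Invertibility is invariant under conjugation by phi, and the default, the identity, is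
    compatible with phi as well. *)
Lemma op_inverse_equiv E F (phi : E -> F) f f' :
  unitary setT setT phi -> (forall x, f' (phi x) = phi (f x)) ->
  forall x, op_inverse f' (phi x) = phi (op_inverse f x).
Proof.
move=> uphi hf x; have [_ h2 h3] := unitary_adjoint (subspaceT _) uphi.
set psi := adjoint _ _ _ in h2 h3.
have {}h2 y : psi (phi y) = y by exact: h2.
have {}h3 y : phi (psi y) = y by exact: h3.
rewrite /op_inverse; case: xgetP => [g' _ [g1 g2]|no'].
  case: xgetP => [g _ [k1 k2]|no].
    by rewrite -{1}(k2 x) -hf g1.
  have [] := no (fun z => psi (g' (phi z))); split => z.
    by rewrite -hf g1 h2.
  by rewrite -[f _]h2 -hf h3 g2 h2.
case: xgetP => [g _ [k1 k2]|no] //.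
have [] := no' (fun z => phi (g (psi z))); split => z.
  by rewrite -{1}(h3 z) hf h2 k1 h3.
by rewrite hf k2 h3.
Qed.

End PositiveOperators.

(** * Contractions and their defect operators *)

Section OperatorLemmas.
Variable R : realType.
Implicit Types E F G : hilbertType R.

Lemma conj_semilinear (a p q : R[i]) :
  Num.conj (Num.conj a * p + q) = a * Num.conj p + Num.conj q.
Proof.
by apply: complex_eq; rewrite ?(Re_conj, Im_conj, ReD, ImD, ReM, ImM); ring.
Qed.

Lemma contraction_adjP E F (T : E -> F) : contraction setT setT T ->
  forall x y, inner (T x) y = inner x (adj T y).
Proof.
move=> /contraction_bounded bT x y.
by have [_ h] := adjointP (closed_subspaceT E) bT; apply: h.
Qed.

Lemma contraction_adj E F (T : E -> F) : contraction setT setT T ->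
  contraction setT setT (adj T).
Proof.
move=> cT; have hT := contraction_adjP cT.
have /contractionP[lT _ nT] := cT.
apply/contractionP; split => //.
- move=> a x y _ _; apply: (inner_eq_sub (subspaceT E)) => // z _.
  by rewrite innerDl innerZl !(innerC (adj T _)) -!hT innerDr innerZr conj_semilinear.
- move=> y _; have [->|n0] := eqVneq (nrm (adj T y)) 0; first exact: nrm_ge0.
  have np : 0 < nrm (adj T y) by rewrite lt_def n0 nrm_ge0.
  rewrite -(ler_pM2l np) -expr2 -dotxx /dot -hT.
  by apply: le_trans (nrm_dot_le _ _) _; rewrite ler_wpM2r ?nrm_ge0 ?nT.
Qed.

Lemma adj_adj E F (T : E -> F) : contraction setT setT T -> adj (adj T) = T.
Proof.
move=> cT; apply/funext => x; have hT := contraction_adjP cT.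
have hTs := contraction_adjP (contraction_adj cT).
apply: (inner_eq_sub (subspaceT F)) => // y _.
by rewrite hT innerC -hTs -innerC.
Qed.

Lemma contraction_comp E F G (S : F -> G) (T : E -> F) :
  contraction setT setT S -> contraction setT setT T ->
  contraction setT setT (S \o T).
Proof.
move=> /contractionP[lS _ nS] /contractionP[lT _ nT]; apply/contractionP; split => //.
- by move=> a x y _ _; rewrite /= lT // lS.
- by move=> x _; apply: le_trans (nS _ I) (nT _ I).
Qed.

Lemma adj_comp E F G (S : F -> G) (T : E -> F) :
  contraction setT setT S -> contraction setT setT T ->
  forall x, adj (S \o T) x = adj T (adj S x).
Proof.
move=> cS cT x; apply: (inner_eq_sub (subspaceT E)) => // y _.
rewrite innerC -(contraction_adjP (contraction_comp cS cT)) /=.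
by rewrite (contraction_adjP cS) (contraction_adjP cT) -innerC.
Qed.

Lemma isometryT_inner E F (J : E -> F) : isometry setT setT J ->
  forall x y, inner (J x) (J y) = inner x y.
Proof. by move=> iJ x y; apply: isometry_inner iJ _ _ _ _. Qed.

Lemma bounded_below_range_closed E F (f : E -> F) (c M : R) :
  linear_on setT f -> 0 < c -> (forall x, c * nrm x <= nrm (f x)) ->
  (forall x, nrm (f x) <= M * nrm x) -> closed_subspace (range f).
Proof.
move=> lf c0 cf Mf.
have [h0 hL] := linear_image_subspace (subspaceT E) lf.
have fB x y : f (x - y) = f x - f y by rewrite (lin_B (subspaceT E) lf).
split => //; apply/closedP => z h.
have hn (n : nat) : exists x, nrm (z - f x) < n.+1%:R^-1.
  by have [|_ [x _ <-] zx] := h n.+1%:R^-1; [rewrite invr_gt0|exists x].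
have /choice[u hu] := hn.
have hK (e : R) : 0 < e -> exists N, forall k, (N <= k)%N -> nrm (z - f (u k)) < e.
  move=> e0; have := near_infty_natSinv_lt (PosNum e0) => -[N _ hN].
  by exists N => k /hN /=; exact: lt_trans.
have [e e0|x hx] := @complete_seq _ _ u.
  have [|N hN] := hK (c * e / 2); first by rewrite !mulr_gt0.
  exists N => m n /hN hm /hN hn'; rewrite -(ltr_pM2l c0).
  apply: le_lt_trans (cf _) _; rewrite fB.
  have := nrm_triB z (f (u m)) (f (u n)); rewrite (nrmC (f (u m)) z); lra.
exists x => //; apply/eqP; rewrite -subr_eq0; apply/eqP/nrm_eq0.
apply: (@eps0 _ _ (`|M| + 1)) => [|e e0]; first exact: nrm_ge0.
have [N hN] := hK e e0; have [L hL'] := hx e e0.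
have := hN _ (leq_maxl N L); have := hL' _ (leq_maxr N L).
set k := maxn N L => h1 h2.
have := nrm_triB (f (u k)) (f x) z.
rewrite (nrmC (f x) (f (u k))) (nrmC (f (u k)) z) -fB.
have := Mf (u k - x); have := ler_norm M; have := nrm_ge0 (u k - x).
have := normr_ge0 M; nra.
Qed.

Lemma isometry_range_closed E F (J : E -> F) : isometry setT setT J ->
  closed_subspace (range J).
Proof.
move=> /isometryP[lJ _ nJ].
by apply: (@bounded_below_range_closed _ _ J 1 1) => // x; rewrite mul1r nJ.
Qed.

(** From |f x| >= (1 - |z|) |x| the range of f is closed, and a vector x orthogonal to it satisfies
    |x|^2 = Re <x, z A x> <= |z| |x|^2, so x = 0. *)
Lemma resolvent_exists E (A : E -> E) (z : R[i]) : contraction setT setT A ->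
  cabs z < 1 -> let f y := y - z *: A y in
  cancel f (op_inverse f) /\ cancel (op_inverse f) f.
Proof.
move=> /contractionP[lA _ nA] z1 f; have z0 := cabs_ge0 z.
have lf : linear_on setT f.
  move=> a x y _ _; rewrite /f lA // scalerBr scalerDr !scalerA (mulrC z).
  by rewrite opprD addrACA.
have nz x : nrm (z *: A x) <= cabs z * nrm x by rewrite nrmZ ler_wpM2l ?nA.
have bf x : (1 - cabs z) * nrm x <= nrm (f x).
  by have := nrm_triB (z *: A x) x 0; have := nz x; rewrite !subr0 -/(f x); lra.
have cR : closed_subspace (range f).
  apply: (@bounded_below_range_closed _ _ f (1 - cabs z) 2) => //; first lra.
  move=> x; apply: le_trans (nrmD _ _) _; rewrite nrmN.
  by have := nz x; have := nrm_ge0 x; nra.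
have Rf : range f = setT.
  apply: csub_total => // x hx; apply: nrm_eq0.
  have /(congr1 (@complex.Re R)) := hx _ (ltac:(by exists x) : range f (f x)).
  rewrite -/(dot _ _) dotDr dotNr dotxx => h.
  have := nrm_dot_le x (z *: A x); have := nz x; have := nrm_ge0 x.
  rewrite [complex.Re _]/= in h => n0 h1 h2.
  have [->//|xn] := eqVneq (nrm x) 0; have xp : 0 < nrm x by rewrite lt_def xn.
  have : nrm x * nrm (z *: A x) <= nrm x * (cabs z * nrm x) by rewrite ler_wpM2l.
  by have := mulr_gt0 xp xp; rewrite expr2 in h; nra.
have ex y : exists x, f x = y.
  by have : range f y by [rewrite Rf]; case=> x _; exists x.
have /choice[g fg] := ex.
have gf x : g (f x) = x.
  apply/eqP; rewrite -subr_eq0; apply/eqP/nrm_eq0/eqP; rewrite eq_le nrm_ge0 andbT.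
  have := bf (g (f x) - x); rewrite (lin_B (subspaceT E) lf) // fg subrr nrm0.
  by rewrite pmulr_rle0 //; lra.
by rewrite /op_inverse; case: xgetP => [k _ []|/(_ g)[]].
Qed.

(** Both sides are linear and continuous in x. Separate targets F and G allow the comparison of
    inner products taken in different spaces. *)
Lemma cspan_agree_inner E F G (S : set E) (f : E -> F) (g : E -> G) w w' :
  bounded_op (cspan S) setT f -> bounded_op (cspan S) setT g ->
  (forall s, S s -> inner (f s) w = inner (g s) w') ->
  forall x, cspan S x -> inner (f x) w = inner (g x) w'.
Proof.
move=> /boundedP[lf _ [M M0 hM]] /boundedP[lg _ [N N0 hN]] hS x hx.
have sA : subspace (cspan S) by apply/closed_subspaceW/cspan_closed.
have [|s Ss|] := @cspan_min _ _ S [set x | cspan S x /\ inner (f x) w = inner (g x) w'] _ _ x hx.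
- split.
  + split; first exact: sub_0.
    by rewrite (lin_0 sA lf) (lin_0 sA lg) !inner0l.
  + move=> a y z [Ay hy] [Az hz]; split; first exact: (sub_L sA).
    by rewrite lf // lg // !innerDl !innerZl hy hz.
  + apply/closedP => z h.
    have Az : cspan S z.
      by have [_ _ /closedP] := cspan_closed S; apply => e /h[a [Aa _] ?]; exists a.
    split => //; apply/eqP; rewrite -subr_eq0; apply/eqP/cabs_eq0.
    apply: (@eps0 _ _ (M * nrm w + N * nrm w')) => [|e e0]; first exact: cabs_ge0.
    have [a [Aa ha] za] := h e e0; have Aza := sub_B sA Az Aa.
    have -> : inner (f z) w - inner (g z) w' =
      inner (f (z - a)) w - inner (g (z - a)) w'.
      rewrite (lin_B sA lf) // (lin_B sA lg) // !innerBl ha; ring.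
    apply: le_trans (cabsD _ _) _; rewrite cabsN mulrDr lerD //.
      apply: le_trans (cabs_inner_le _ _) _; rewrite mulrA ler_wpM2r ?nrm_ge0 //.
      apply: le_trans (hM _ Aza) _; rewrite mulrC ler_wpM2r //; exact: ltW.
    apply: le_trans (cabs_inner_le _ _) _; rewrite mulrA ler_wpM2r ?nrm_ge0 //.
    apply: le_trans (hN _ Aza) _; rewrite mulrC ler_wpM2r //; exact: ltW.
- by split; [exact: cspan_sub|exact: hS].
- by [].
Qed.

Lemma cspan_agree E F (S : set E) (f g : E -> F) :
  bounded_op (cspan S) setT f -> bounded_op (cspan S) setT g ->
  (forall s, S s -> f s = g s) -> forall x, cspan S x -> f x = g x.
Proof.
move=> bf bg h x hx; apply: (inner_eq_sub (subspaceT F)) => // y _.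
by apply: (cspan_agree_inner bf bg) hx => s /h ->.
Qed.

Lemma isometric_bounded E F (A : set E) (f : E -> F) : linear_on A f ->
  (forall x, A x -> nrm (f x) = nrm x) -> bounded_op A setT f.
Proof.
by move=> lf nf; apply/boundedP; split => //; exists 1 => // x Ax; rewrite nf // mul1r.
Qed.

Lemma unitary_adjK E F (f : E -> F) : unitary setT setT f -> cancel f (adj f).
Proof. by move=> uf x; have [_ h _] := unitary_adjoint (subspaceT E) uf; apply: h. Qed.

Lemma unitary_adjVK E F (f : E -> F) : unitary setT setT f -> cancel (adj f) f.
Proof. by move=> uf x; have [_ _ h] := unitary_adjoint (subspaceT E) uf; apply: h. Qed.

End OperatorLemmas.

Section UnitaryPowers.
Variables (R : realType) (K : hilbertType R) (U : K -> K).
Hypothesis hU : unitary setT setT U.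

Lemma unitaryK x : adj U (U x) = x.
Proof. exact: unitary_adjK. Qed.

Lemma unitaryVK x : U (adj U x) = x.
Proof. exact: unitary_adjVK. Qed.

Lemma unitaryT_inner x y : inner (U x) (U y) = inner x y.
Proof. exact: (isometryT_inner (unitary_isometry hU)). Qed.

Lemma unitary_adj_inner x y : inner (U x) y = inner x (adj U y).
Proof. by rewrite -(unitaryT_inner x) unitaryVK. Qed.

Lemma unitary_adj : unitary setT setT (adj U).
Proof. exact: unitary_inv. Qed.

Lemma unitary_iter n : unitary setT setT (iter n U).
Proof.
have /unitaryP[lU _ oU nU] := hU.
elim: n => [|n /unitaryP[l _ o nn]]; apply/unitaryP; split => //=.
- by move=> y _; exists y.
- by move=> a x y _ _; rewrite /= l // lU.
- move=> y _; have [x _ <-] := oU y I; have [z _ <-] := o x I; by exists z.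
- by move=> x _; rewrite nU // nn.
Qed.

Lemma zpow_add1 n x : zpow U (n + 1) x = U (zpow U n x).
Proof.
case: n => [n|[|n]] /=.
- by rewrite addn1.
- by rewrite unitaryVK.
- by rewrite unitaryVK subn1.
Qed.

Lemma zpow_sub1 n x : zpow U (n - 1) x = adj U (zpow U n x).
Proof. by rewrite -{2}(subrK 1 n) zpow_add1 unitaryK. Qed.

Lemma zpowD m n x : zpow U (m + n) x = zpow U m (zpow U n x).
Proof.
elim/int_rect: m => [|m ih|m ih]; first by rewrite add0r.
- by rewrite -addn1 PoszD addrAC !zpow_add1 ih.
- by rewrite -addn1 PoszD opprD addrAC !zpow_sub1 ih.
Qed.

Lemma zpow0 x : zpow U 0 x = x. Proof. by []. Qed.

Lemma unitary_zpow n : unitary setT setT (zpow U n).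
Proof.
case: n => n; first exact: unitary_iter.
have /unitaryP[lU _ oU nU] := unitary_adj.
rewrite /zpow; elim: n.+1 => [|{}n /unitaryP[l _ o nn]]; apply/unitaryP; split => //=.
- by move=> y _; exists y.
- by move=> a x y _ _; rewrite /= l // lU.
- move=> y _; have [x _ <-] := oU y I; have [z _ <-] := o x I; by exists z.
- by move=> x _; rewrite nU // nn.
Qed.

Lemma zpow_inner n x y : inner (zpow U n x) (zpow U n y) = inner x y.
Proof. exact: (isometryT_inner (unitary_isometry (unitary_zpow n))). Qed.

Lemma zpow_shift n m x y :
  inner (zpow U n x) (zpow U m y) = inner (zpow U (n - m) x) y.
Proof. by rewrite -(zpow_inner m _ y) -zpowD addrC subrK. Qed.

Lemma zpow_shiftr n m x y :
  inner (zpow U n x) (zpow U m y) = inner x (zpow U (m - n) y).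
Proof. by rewrite innerC zpow_shift -innerC. Qed.

Lemma zpowB n x y : zpow U n (x - y) = zpow U n x - zpow U n y.
Proof. by have [l _ _] := unitary_zpow n; rewrite (lin_B (subspaceT K) l). Qed.

Lemma iterB n x y : iter n U (x - y) = iter n U x - iter n U y.
Proof. exact: (zpowB n). Qed.

Lemma zpow_nat (n : nat) x : zpow U n%:Z x = iter n U x. Proof. by []. Qed.

Lemma zpow_ortho_cspan (I : Type) (f : I -> K) n m :
  (forall h k, inner (zpow U n (f h)) (zpow U m (f k)) = 0) ->
  forall x y, cspan (range f) x -> cspan (range f) y ->
    inner (zpow U n x) (zpow U m y) = 0.
Proof.
have step p (w : K) : (forall h, inner (zpow U p (f h)) w = 0) ->
    forall v, cspan (range f) v -> inner (zpow U p v) w = 0.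
  move=> hw v; rewrite -(inner0l (0 : K)).
  apply: (cspan_agree_inner (f := zpow U p) (g := fun=> 0)).
  - have /unitaryP[lz _ _ nz] := unitary_zpow p.
    apply/boundedP; split => //; first by move=> a b c _ _; rewrite lz.
    by exists 1 => // b _; rewrite nz // mul1r.
  - apply/boundedP; split => //; first by move=> a b c _ _; rewrite scaler0 addr0.
    by exists 0 => // b _; rewrite nrm0 mul0r.
  - by move=> _ [h _ <-]; rewrite hw inner0l.
move=> hf x y hx hy; apply: (step) hx => h; apply: inner_eq0C.
by apply: (step) hy => k; apply: inner_eq0C.
Qed.

End UnitaryPowers.

(** * Defect operators under the identity |D_T h|^2 = |h|^2 - |T h|^2 *)

Section Defect.
Variables (R : realType) (H : hilbertType R) (T : H -> H).
Hypothesis hT : contraction setT setT T.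
Hypothesis hD : forall h, nrm (defect T h) ^+ 2 = nrm h ^+ 2 - nrm (T h) ^+ 2.

(** The norm identity [hD] secures the square root: if there were none, D_T would be the default
    zero, T would be isometric, and I - T^*T = 0 would have the root zero after all. *)
Lemma defectP : positive_op setT (defect T) /\
  forall x, defect T (defect T x) = x - adj T (T x).
Proof.
suff [g [pg hg]] : exists g, positive_op setT g /\
    forall x, setT x -> g (g x) = x - adj T (T x).
  by have [? h] := psqrtP pg hg; split => // x; apply: h.
apply: contrapT => nog.
have D0 h : defect T h = 0.
  by rewrite /defect /psqrt; case: xgetP => // g _ hg; case: nog; exists g.
have /contractionP[lT _ _] := hT.
have nT x : setT x -> nrm (T x) = nrm x.
  move=> _; have /eqP := hD x; rewrite D0 nrm0 expr0n /= eq_sym subr_eq0.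
  by rewrite eqrXn2 ?nrm_ge0 // => /eqP.
apply: nog; exists (fun=> 0); split; last first.
  move=> x _; apply: (inner_eq_sub (subspaceT H)) => // y _.
  rewrite inner0l innerBl (innerC (adj T _)) -contraction_adjP // -innerC.
  by rewrite (iso_inner (subspaceT H) lT nT) // subrr.
split; last by move=> x _; rewrite inner0l.
apply/boundedP; split => //; first by move=> a x y _ _; rewrite scaler0 addr0.
by exists 0 => // x _; rewrite nrm0 mul0r.
Qed.

Lemma defect_linear : linear_on setT (defect T).
Proof. by have [[/boundedP[? _ _] _] _] := defectP. Qed.

Lemma defect_selfadj x y : inner (defect T x) y = inner x (defect T y).
Proof. by have [p _] := defectP; apply: (posop_inner (subspaceT H) p). Qed.

Lemma defect_inner x y :
  inner (defect T x) (defect T y) = inner x y - inner (T x) (T y).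
Proof.
rewrite -defect_selfadj; have [_ ->] := defectP.
by rewrite innerBl (innerC (adj T _)) -contraction_adjP // -innerC.
Qed.

Lemma defect_space_cspan : defect_space T = cspan (range (defect T)).
Proof.
rewrite cspan_subspace //.
exact: (linear_image_subspace (subspaceT H) defect_linear).
Qed.

Lemma defect_space_closed : closed_subspace (defect_space T).
Proof. by rewrite defect_space_cspan; exact: cspan_closed. Qed.

Lemma defect_mem h : defect_space T (defect T h).
Proof. by rewrite defect_space_cspan; apply: cspan_sub; exists h. Qed.

End Defect.

(** [sylvester_pos] for the positive operators D_{T^*} and D_T, whose squares satisfy D_{T^*}^2 T =
    T - T T^* T = T D_T^2. *)
Lemma defect_intertwine (R : realType) (H : hilbertType R) (T : H -> H) :
  contraction setT setT T ->
  (forall h, nrm (defect T h) ^+ 2 = nrm h ^+ 2 - nrm (T h) ^+ 2) ->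
  (forall h, nrm (defect (adj T) h) ^+ 2 = nrm h ^+ 2 - nrm (adj T h) ^+ 2) ->
  forall x, defect (adj T) (T x) = T (defect T x).
Proof.
move=> cT hD hDs x; have [p e] := defectP cT hD.
have [ps es] := defectP (contraction_adj cT) hDs.
apply: (sylvester_pos (subspaceT H) (subspaceT H) ps p (contraction_bounded cT)) => //.
move=> y _; rewrite es e (adj_adj cT).
by have [lT _ _] := cT; rewrite (lin_B (subspaceT H) lT).
Qed.

Lemma unitary_adj_intertwine (R : realType) (E F : hilbertType R) (T : E -> E)
    (T' : F -> F) (phi : E -> F) :
  contraction setT setT T -> contraction setT setT T' -> unitary setT setT phi ->
  (forall x, phi (T x) = T' (phi x)) ->
  forall x, phi (adj T x) = adj T' (phi x).
Proof.
move=> cT cT' uphi h x; apply: (inner_eq_sub (subspaceT F)) => // y _.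
have /unitaryP[_ _ o _] := uphi; have [z _ <-] := o y I.
have ip := isometryT_inner (unitary_isometry uphi).
rewrite ip (innerC (adj T' _)) -(contraction_adjP cT') -h ip.
by rewrite (contraction_adjP cT) -innerC.
Qed.

Lemma defect_equiv (R : realType) (E F : hilbertType R) (T : E -> E)
    (T' : F -> F) (phi : E -> F) :
  contraction setT setT T -> contraction setT setT T' -> unitary setT setT phi ->
  (forall x, phi (T x) = T' (phi x)) ->
  forall x, phi (defect T x) = defect T' (phi x).
Proof.
move=> cT cT' uphi h x; rewrite /defect.
symmetry; apply: (psqrt_equiv (subspaceT E) (subspaceT F) uphi) => // y _.
have [l _ _] := uphi.
by rewrite -h (lin_B (subspaceT E) l) // (unitary_adj_intertwine cT cT' uphi).
Qed.

(** * The minimal unitary dilation *)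

Section Dilation.
Variables (R : realType) (H K : hilbertType R) (T : H -> H) (J : H -> K) (U : K -> K).
Hypothesis hT : contraction setT setT T.
Hypothesis hJ : isometry setT setT J.
Hypothesis hU : unitary setT setT U.
Hypothesis hdil : forall n h, proj (range J) (iter n U (J h)) = J (iter n T h).
Hypothesis hmin : cspan [set x | exists n h, x = zpow U n (J h)] = setT.

Let Ts := adj T.
(** [lam] and [lams] give the generating vectors of the wandering subspaces L and L_* of the
    dilation. *)
Definition lam (h : H) : K := U (J h) - J (T h).
Definition lams (h : H) : K := J h - U (J (adj T h)).

Lemma dil_Jlin : linear_on setT J. Proof. by case: hJ. Qed.
Lemma dil_JB x y : J (x - y) = J x - J y.
Proof. by rewrite (lin_B (subspaceT H) dil_Jlin). Qed.
Lemma dil_J x y : inner (J x) (J y) = inner x y.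
Proof. exact: isometryT_inner. Qed.
Lemma dil_Tlin : linear_on setT T. Proof. by case: hT. Qed.
Lemma dil_TB x y : T (x - y) = T x - T y.
Proof. by rewrite (lin_B (subspaceT H) dil_Tlin). Qed.
Lemma dil_adj x y : inner (T x) y = inner x (Ts y).
Proof. exact: contraction_adjP. Qed.

Lemma dil_range_closed : closed_subspace (range J).
Proof. exact: isometry_range_closed. Qed.

Lemma dil_inner n h k : inner (iter n U (J h)) (J k) = inner (iter n T h) k.
Proof.
have [_ hp] := projP dil_range_closed (iter n U (J h)).
have := hp (J k) ltac:(by exists k); rewrite hdil innerBl dil_J => /eqP.
by rewrite subr_eq0 => /eqP.
Qed.

Lemma dil_innerU n h k : inner (iter n.+1 U (J h)) (U (J k)) = inner (iter n T h) k.
Proof. by rewrite /= (unitaryT_inner hU) dil_inner. Qed.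

(** Only T enters the right-hand side: the dilation property fixes the Gram matrix of the vectors
    U^n J h, which is why minimal unitary dilations are unique. *)
Lemma zpow_gram n m h k : inner (zpow U n (J h)) (zpow U m (J k)) =
  match n - m with Posz d => inner (iter d T h) k | Negz d => inner h (iter d.+1 T k) end.
Proof.
case E : (n - m) => [d|d].
  by rewrite (zpow_shift hU) E zpow_nat dil_inner.
rewrite (zpow_shiftr hU) -opprB E NegzE opprK zpow_nat innerC dil_inner.
by rewrite -innerC.
Qed.

Lemma iterST n h : iter n T (T h) = iter n.+1 T h.
Proof. by rewrite iterSr. Qed.

Lemma inner_iter_adj n h k : inner (iter n T h) k = inner h (iter n Ts k).
Proof. by elim: n k => //= n ih k; rewrite dil_adj ih -iterSr. Qed.

Lemma lam_ortho_nat d h k : inner (iter d.+1 U (lam h)) (lam k) = 0.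
Proof.
rewrite /lam (iterB hU) innerBl !innerBr -!iterSr dil_innerU !dil_inner.
by rewrite [iter d.+1 U _]/= (unitaryT_inner hU) dil_inner !iterST subrr.
Qed.

Lemma lams_ortho_nat d h k : inner (iter d.+1 U (lams h)) (lams k) = 0.
Proof.
rewrite /lams (iterB hU) innerBl !innerBr -!iterSr dil_innerU !dil_inner.
rewrite [iter d.+2 U _]/= (unitaryT_inner hU) -iterS dil_inner.
by rewrite -!dil_adj -!iterS subrr subrr subrr.
Qed.

Lemma lam_ortho (n m : int) h k : n <> m ->
  inner (zpow U n (lam h)) (zpow U m (lam k)) = 0.
Proof.
move=> nm; case E : (n - m) => [[|d]|d].
- by case: nm; apply/eqP; rewrite -subr_eq0 E.
- by rewrite (zpow_shift hU) E lam_ortho_nat.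
- rewrite (zpow_shiftr hU) -opprB E NegzE opprK; apply: inner_eq0C.
  exact: lam_ortho_nat.
Qed.

Lemma lams_ortho (n m : int) h k : n <> m ->
  inner (zpow U n (lams h)) (zpow U m (lams k)) = 0.
Proof.
move=> nm; case E : (n - m) => [[|d]|d].
- by case: nm; apply/eqP; rewrite -subr_eq0 E.
- by rewrite (zpow_shift hU) E lams_ortho_nat.
- rewrite (zpow_shiftr hU) -opprB E NegzE opprK; apply: inner_eq0C.
  exact: lams_ortho_nat.
Qed.

Lemma lam_inner h k : inner (lam h) (lam k) = inner h k - inner (T h) (T k).
Proof.
rewrite /lam innerBl !innerBr (unitaryT_inner hU) !dil_J.
have -> : inner (U (J h)) (J (T k)) = inner (T h) (T k) by exact: (dil_inner 1).
rewrite (innerC (J _)) (_ : inner (U (J k)) (J (T h)) = inner (T k) (T h)).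
  by rewrite -innerC subrr subr0.
exact: (dil_inner 1).
Qed.

Lemma lams_inner h k : inner (lams h) (lams k) = inner h k - inner (Ts h) (Ts k).
Proof.
rewrite /lams innerBl !innerBr (unitaryT_inner hU) !dil_J.
have -> : inner (U (J (adj T h))) (J k) = inner (Ts h) (Ts k).
  by rewrite -dil_adj; exact: (dil_inner 1).
rewrite (innerC (J _)) (_ : inner (U (J (adj T k))) (J h) = inner (Ts k) (Ts h)).
  by rewrite -innerC subrr subr0.
by rewrite -dil_adj; exact: (dil_inner 1).
Qed.

(** These are the coefficients of negative order; their vanishing is the analyticity of the
    characteristic function. *)
Lemma cross_pos d h k : inner (iter d.+1 U (lam h)) (lams k) = 0.
Proof.
rewrite /lam /lams (iterB hU) innerBl !innerBr -!iterSr !dil_innerU !dil_inner.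
by rewrite -!dil_adj -!iterS -!iterSr !subrr.
Qed.

Lemma cross_zero h k :
  inner (lam h) (lams k) = - (inner (T h) k - inner (Ts (T h)) (Ts k)).
Proof.
rewrite /lam /lams innerBl !innerBr (unitaryT_inner hU) !dil_J.
rewrite (dil_inner 1) -(dil_adj h) subrr sub0r; congr (- (_ - _)).
rewrite innerC (dil_inner 1) -innerC.
by rewrite innerC dil_adj -innerC.
Qed.

Lemma cross_neg e h k : inner (lam h) (iter e.+1 U (lams k)) =
  inner (h - Ts (T h)) (iter e T (k - T (Ts k))).
Proof.
have iTB n x y : iter n T (x - y) = iter n T x - iter n T y.
  by elim: n => //= n ->; rewrite dil_TB.
rewrite /lam /lams (iterB hU) innerBl !innerBr -!iterSr.
rewrite !(innerC _ (iter _ U _)) [iter e.+1 U _]/= (unitaryT_inner hU) -iterS.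
rewrite [iter e.+2 U _]/= (unitaryT_inner hU) -!iterS !dil_inner -!innerC.
rewrite iTB !innerBl !innerBr !iterST.
rewrite (innerC (Ts _)) -dil_adj -innerC -iterS.
rewrite (innerC (Ts _) (iter e.+1 T _)) -dil_adj -innerC -iterS.
ring.
Qed.

(** Telescoping: U^(n+1) J h = U^n lam h + U^n J T h in one direction, U^(-n-1) J h = U^(-n-1) lams
    h + U^(-n) J T^* h in the other. *)
Lemma dil_residual_generators n h :
  cspan ([set x | exists k, x = J k] `|` [set x | exists (n : nat) k, x = iter n U (lam k)]
    `|` [set x | exists (n : nat) k, x = zpow U (Negz n) (lams k)]) (zpow U n (J h)).
Proof.
set G := _ `|` _; have sG : subspace (cspan G) by apply/closed_subspaceW/cspan_closed.
case: n => [n|n].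
  elim: n h => [|n ih] h; first by apply: cspan_sub; left; left; exists h.
  have -> : zpow U n.+1 (J h) = iter n U (lam h) + zpow U n (J (T h)).
    by rewrite /lam (iterB hU) -iterSr subrK.
  by apply: (sub_D sG) => //; apply: cspan_sub; left; right; exists n, h.
elim: n h => [|n ih] h.
  have -> : zpow U (Negz 0) (J h) = zpow U (Negz 0) (lams h) + J (Ts h).
    by rewrite /lams (zpowB hU) /= (unitaryK hU) subrK.
  apply: (sub_D sG) => //; apply: cspan_sub; first by right; exists 0%N, h.
  by left; left; exists (Ts h).
have -> : zpow U (Negz n.+1) (J h) = zpow U (Negz n.+1) (lams h) + zpow U (Negz n) (J (Ts h)).
  have E : zpow U (Negz n.+1) (U (J (Ts h))) = zpow U (Negz n) (J (Ts h)).
    by rewrite /zpow iterSr (unitaryK hU).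
  by rewrite /lams (zpowB hU) E subrK.
by apply: (sub_D sG) => //; apply: cspan_sub; right; exists n.+1, h.
Qed.

Lemma J_ortho_lam n h k : inner (J k) (iter n U (lam h)) = 0.
Proof.
rewrite /lam (iterB hU) innerBr -iterSr !(innerC (J k)) !dil_inner iterST.
by rewrite subrr.
Qed.

Lemma J_ortho_lams n h k : inner (J k) (zpow U (Negz n) (lams h)) = 0.
Proof.
rewrite -(zpow0 U (J k)) (zpow_shift hU) NegzE opprK add0r zpow_nat /lams innerBr.
by rewrite dil_inner dil_innerU -dil_adj subrr.
Qed.

(* K is the orthogonal sum of the [U^n L] (n >= 0), of [J H] and of the
   [U^(-n-1) L_*] (n >= 0). *)
Lemma dil_range_char x : (forall (n : nat) h, inner x (iter n U (lam h)) = 0) ->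
  (forall (n : nat) h, inner x (zpow U (Negz n) (lams h)) = 0) -> range J x.
Proof.
move=> h1 h2; have [pJ hp] := projP dil_range_closed x.
suff /eqP : x - proj (range J) x = 0 by rewrite subr_eq0 => /eqP ->.
apply: inner_self0; have := @cspan_ortho _ _ [set x | exists n h, x = zpow U n (J h)].
rewrite hmin; apply => // _ [n [h ->]].
apply: cspan_ortho (dil_residual_generators n h) => _ [[[k ->]|[m [k ->]]]|[m [k ->]]].
- by apply: hp; exists k.
- rewrite innerBl h1; case: pJ => k' _ <-; by rewrite J_ortho_lam subrr.
- rewrite innerBl h2; case: pJ => k' _ <-; by rewrite J_ortho_lams subrr.
Qed.

(** The orthogonal complement N of these vectors reduces U and lies in J H by [dil_range_char].
    There U J = J T and U^* J = J T^*, so N comes from a reducing subspace on which T is unitary,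
    and that subspace is zero. *)
Lemma dil_total : cnu T ->
  cspan ([set x | exists n h, x = zpow U n (lam h)] `|`
         [set x | exists n h, x = zpow U n (lams h)]) = setT.
Proof.
move=> hcnu; apply: cspan_total => x hx.
pose N := [set x : K | (forall n h, inner x (zpow U n (lam h)) = 0) /\
                       (forall n h, inner x (zpow U n (lams h)) = 0)].
have Nx : N x by split => n h; apply: hx; [left|right]; exists n, h.
have NJ y : N y -> range J y.
  by move=> [h1 h2]; apply: dil_range_char => n h; [apply: (h1 n)|apply: h2].
have NE : N = ocompl setT ([set x | exists n h, x = zpow U n (lam h)] `|`
         [set x | exists n h, x = zpow U n (lams h)]).
  apply/seteqP; split => [y [h1 h2]|y [_ h]]; first split => // _ [[n [h ->]]|[n [h ->]]] //.
  by split => n k; apply: h; [left|right]; exists n, k.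
have cN : closed_subspace N by rewrite NE; apply: ocompl_closed.
have NU y : N y -> N (U y).
  move=> [h1 h2]; have E : U y = zpow U 1 y by [].
  by rewrite E; split => n h; rewrite (zpow_shiftr hU).
have NV y : N y -> N (adj U y).
  move=> [h1 h2]; have E : adj U y = zpow U (-1) y by [].
  by rewrite E; split => n h; rewrite (zpow_shiftr hU).
pose M := [set h | N (J h)].
have UT h : M h -> U (J h) = J (T h).
  move=> Mh; rewrite -(hdil 1); apply/esym/(proj_eq (closed_subspaceW dil_range_closed)).
    by apply: NJ; apply: NU.
  by move=> a _; rewrite subrr inner0l.
have VT h : M h -> adj U (J h) = J (Ts h).
  move=> Mh; have [k _ Ek] := NJ _ (NV _ Mh); rewrite -Ek; congr J.
  apply: (inner_eq_sub (subspaceT H)) => // y _.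
  rewrite -dil_J Ek (innerC (adj U _)) -(unitary_adj_inner hU) (dil_inner 1).
  by rewrite /= dil_adj -innerC.
have sN := closed_subspaceW cN.
have M0 : M = [set 0].
  apply: hcnu.
  - split.
    + by rewrite /M /= (lin_0 (subspaceT H) dil_Jlin); exact: sub_0.
    + by move=> a y z My Mz; rewrite /M /= dil_Jlin //; apply: sub_L.
    + apply/closedP => z h; have [_ _ /closedP cN'] := cN; apply: cN'.
      move=> e /h [a Ma za]; exists (J a) => //.
      have /isometryP[_ _ nJ] := hJ.
      by rewrite -dil_JB nJ.
  - by move=> _ [h Mh <-]; rewrite /M /= -UT //; apply: NU.
  - by move=> _ [h Mh <-]; rewrite /M /= -VT //; apply: NV.
  - apply/unitaryP; split.
    + by move=> a y z _ _; rewrite dil_Tlin.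
    + by move=> h Mh; rewrite /M /= -UT //; apply: NU.
    + move=> h Mh; have MT : M (Ts h) by rewrite /M /= -VT //; apply: NV.
      exists (Ts h) => //; apply: (inner_eq_sub (subspaceT H)) => // y _.
      by rewrite -!dil_J -UT // -VT // (unitaryVK hU).
    + move=> h Mh; have /isometryP[_ _ nJ] := hJ.
      have /unitaryP[_ _ _ nU] := hU.
      by rewrite -nJ // -UT // nU // nJ.
have [h _ Eh] := NJ _ Nx.
have : M h by rewrite /M /= Eh.
by rewrite M0 => h0; rewrite -Eh h0 (lin_0 (subspaceT H) dil_Jlin).
Qed.

Lemma lam_lin : linear_on setT lam.
Proof.
move=> a x y _ _; have [lU _ _] := hU.
by rewrite /lam dil_Tlin // !dil_Jlin // lU // scalerBr opprD addrACA.
Qed.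

Lemma lams_lin : linear_on setT lams.
Proof.
move=> a x y _ _; have [lU _ _] := hU; have [lTs _ _] := contraction_adj hT.
by rewrite /lams lTs // !dil_Jlin // lU // scalerBr opprD addrACA.
Qed.

Lemma wanderingE : wandering J U T = cspan (range lams).
Proof.
rewrite cspan_subspace //.
exact: (linear_image_subspace (subspaceT H) lams_lin).
Qed.

Lemma wanderingL : closure (range lam) = cspan (range lam).
Proof.
rewrite cspan_subspace //.
exact: (linear_image_subspace (subspaceT H) lam_lin).
Qed.

Lemma bilateralE (f : H -> K) : bilateral U (cspan (range f)) =
  cspan [set x | exists n h, x = zpow U n (f h)].
Proof.
apply/seteqP; split; last first.
  apply: cspan_min; first exact: cspan_closed.
  move=> _ [n [h ->]]; apply: cspan_sub; exists n, (f h); split => //.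
  by apply: cspan_sub; exists h.
apply: cspan_min; first exact: cspan_closed.
move=> _ [n [a [ha ->]]].
set G := [set x | _]; have cG := cspan_closed G; have sG := closed_subspaceW cG.
have /unitaryP[lU _ _ nU] := unitary_zpow hU n.
have := @cspan_min _ _ (range f) [set a | cspan G (zpow U n a)] _ _ a ha; apply.
- split.
  + by rewrite /= (lin_0 (subspaceT K) lU); exact: sub_0.
  + by move=> b x y hx hy; rewrite /= lU //; apply: (sub_L sG).
  + apply/closedP => z h; have [_ _ /closedP cG'] := cG; apply: cG'.
    move=> e /h[b hb zb]; exists (zpow U n b) => //.
    by rewrite -(zpowB hU) nU.
- by move=> _ [h _ <-]; apply: cspan_sub; exists n, h.
Qed.

Definition residual : set K := ocompl setT (bilateral U (wandering J U T)).

Lemma residual_closed : closed_subspace residual.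
Proof. exact: ocompl_closed. Qed.

Lemma residualP x : residual x <-> forall n h, inner x (zpow U n (lams h)) = 0.
Proof.
rewrite /residual wanderingE bilateralE; split => [[_ h] n k|h].
  by apply: h; apply: cspan_sub; exists n, k.
by split => // y; apply: cspan_ortho => _ [n [k ->]].
Qed.

Lemma residual_U x n : residual x -> residual (zpow U n x).
Proof. by move=> /residualP h; apply/residualP => m k; rewrite (zpow_shiftr hU). Qed.

Lemma proj_residual_lim h :
  seq_lim (fun n => iter n U (J (iter n Ts h))) (proj residual (J h)).
Proof.
set a := fun n => _.
have /contractionP[_ _ nTs] := contraction_adj hT.
have /isometryP[_ _ nJ] := hJ.
have nU n x : nrm (iter n U x) = nrm x.
  by have /unitaryP[_ _ _ ->] := unitary_iter hU n.
have nrma n : nrm (a n) = nrm (iter n Ts h) by rewrite /a nU nJ.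
have aa n d : dot (a n) (a (n + d)%N) = nrm (a (n + d)%N) ^+ 2.
  rewrite nrma -dotxx /a /dot iterD.
  rewrite (isometryT_inner (unitary_isometry (unitary_iter hU n))).
  rewrite innerC dil_inner inner_iter_adj -innerC addnC iterD.
  by [].
have aB n d : nrm (a n - a (n + d)%N) ^+ 2 = nrm (a n) ^+ 2 - nrm (a (n + d)%N) ^+ 2.
  by rewrite nrmB_sqr aa; ring.
pose S := [set nrm (a n) ^+ 2 | n in [set: nat]].
have hS : has_inf S.
  by split; [exists (nrm (a 0) ^+ 2); exists 0%N|exists 0 => _ [n _ <-]; exact: sqr_ge0].
have Sle n : inf S <= nrm (a n) ^+ 2.
  by apply: ge_inf; [case: hS|exists n].
have [e e0|z hz] := @complete_seq _ _ a.
  have e2 : 0 < (e / 2) ^+ 2 by rewrite exprn_gt0 // divr_gt0.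
  have [_ [N _ <-] hN] := inf_adherent e2 hS.
  have hh n : (N <= n)%N -> nrm (a N - a n) < e / 2.
    move=> Nn; rewrite -ltr_sqr ?nnegrE ?nrm_ge0 //; last lra.
    rewrite -(subnKC Nn) aB; have := Sle (N + (n - N))%N; lra.
  exists N => m n /hh hm /hh hn.
  have := nrm_triB (a N) (a m) (a n); rewrite (nrmC (a m) (a N)); lra.
have rz : residual z.
  apply/residualP => m k; apply: cabs_eq0.
  apply: (@eps0 _ _ (nrm (zpow U m (lams k)))) => [|e e0]; first exact: cabs_ge0.
  have [N hN] := hz e e0.
  (* For n > m the vector a n is orthogonal to U^m L_*, hence so is the limit. *)
  have [M hM] : exists M : nat, forall n : nat, (M <= n)%N -> exists d : nat, n%:Z - m = d.+1.
    exists (absz m).+1 => n hn; exists (absz (n%:Z - m)).-1.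
    by case: m hn => m; lia.
  have h1 := hN _ (leq_maxl N M); have [d hd] := hM _ (leq_maxr N M).
  have h2 : inner (a (maxn N M)) (zpow U m (lams k)) = 0.
    rewrite /a -zpow_nat (zpow_shift hU) hd zpow_nat /lams innerBr.
    by rewrite dil_inner dil_innerU -dil_adj -iterS subrr.
  have -> : inner z (zpow U m (lams k)) =
    - inner (a (maxn N M) - z) (zpow U m (lams k)).
    by rewrite innerBl h2 sub0r opprK.
  rewrite cabsN; apply: le_trans (cabs_inner_le _ _) _.
  by rewrite ler_wpM2r ?nrm_ge0 // ltW.
suff -> : proj residual (J h) = z by [].
apply: (proj_eq (closed_subspaceW residual_closed)) => // y /residualP ry.
apply: cabs_eq0; apply: (@eps0 _ _ (nrm y)) => [|e e0]; first exact: cabs_ge0.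
have [N hN] := hz e e0.
have h0 n : inner (J h - a n) y = 0.
  elim: n => [|n ih]; first by rewrite subrr inner0l.
  have -> : J h - a n.+1 = J h - a n + zpow U n (lams (iter n Ts h)).
    by rewrite /lams (zpowB hU) !zpow_nat -iterSr -iterS /a addrA subrK.
  by rewrite innerDl ih add0r innerC ry rmorph0.
have -> : inner (J h - z) y = inner (a N - z) y.
  have -> : J h - z = (J h - a N) + (a N - z) by rewrite addrA subrK.
  by rewrite innerDl h0 add0r.
apply: le_trans (cabs_inner_le _ _) _.
by rewrite ler_wpM2r ?nrm_ge0 // ltW // hN.
Qed.

(** |T^*n h| is the norm of U^n J T^*n h, and these vectors converge to P_R J h. *)
Lemma residual_null h : proj residual (J h) = 0 ->
  forall e : R, 0 < e -> exists N, forall n, (N <= n)%N -> nrm (iter n Ts h) < e.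
Proof.
move=> h0 e /(proj_residual_lim h) [N hN]; exists N => n /hN.
have /isometryP[_ _ nJ] := hJ.
have /unitaryP[_ _ _ nU] := unitary_iter hU n.
by rewrite h0 subr0 nU // nJ.
Qed.

End Dilation.

(** * Taylor coefficients of the characteristic function *)

Section CharacteristicCoefficients.
Variables (R : realType) (H : hilbertType R) (T : H -> H).
Hypothesis hT : contraction setT setT T.
Hypothesis hD : forall h, nrm (defect T h) ^+ 2 = nrm h ^+ 2 - nrm (T h) ^+ 2.

Local Notation Ts := (adj T).
Local Notation D := (defect T).
Local Notation Ds := (defect Ts).
Local Notation DT := (defect_space T).
Local Notation DTs := (defect_space Ts).

(* Theta_T(z) = sum_d z^d (char_coef d). *)
Definition char_coef (d : int) (x : H) : H :=
  match d with
  | Posz 0 => - T x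
  | Posz e.+1 => Ds (iter e Ts (D x))
  | Negz _ => 0
  end.

Let hTs := contraction_adj hT.

Lemma defect_contraction : contraction setT setT D.
Proof.
apply/contractionP; split => //; first exact: defect_linear.
move=> x _; rewrite -ler_sqr ?nnegrE ?nrm_ge0 // hD gerBl; exact: sqr_ge0.
Qed.

Lemma iter_contraction n : contraction setT setT (iter n Ts).
Proof.
by elim: n => [|n ih]; [apply/contractionP|exact: (contraction_comp hTs ih)].
Qed.

End CharacteristicCoefficients.

Section CharacteristicCoefficientsTheory.
Variables (R : realType) (H : hilbertType R) (T : H -> H).
Hypothesis hT : contraction setT setT T.
Hypothesis hD : forall h, nrm (defect T h) ^+ 2 = nrm h ^+ 2 - nrm (T h) ^+ 2.
Hypothesis hDs : forall h, nrm (defect (adj T) h) ^+ 2 = nrm h ^+ 2 - nrm (adj T h) ^+ 2.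

Local Notation Ts := (adj T).
Local Notation D := (defect T).
Local Notation Ds := (defect Ts).
Local Notation DT := (defect_space T).
Local Notation DTs := (defect_space Ts).
Let hTs := contraction_adj hT.

Lemma char_coef_contraction d : contraction setT setT (char_coef T d).
Proof.
case: d => [[|e]|e] /=.
- have /contractionP[l _ n] := hT; apply/contractionP; split => //.
    by move=> a x y _ _; rewrite /= l // opprD scalerN.
  by move=> x _; rewrite nrmN n.
- apply: (contraction_comp (defect_contraction hTs hDs)).
  exact: (contraction_comp (iter_contraction hT e) (defect_contraction hT hD)).
- apply/contractionP; split => //.
    by move=> a x y _ _; rewrite scaler0 addr0.
  by move=> x _; rewrite nrm0 nrm_ge0.
Qed.

(** At order 0 the reason is T D_T = D_{T^*} T, which sends the defect space of T into that of
    T^*. *)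
Lemma char_coef_mem d x : DT x -> DTs (char_coef T d x).
Proof.
have cs := defect_space_closed hTs hDs; have ss := closed_subspaceW cs.
case: d => [[|e]|e] /=; last by move=> _; exact: sub_0.
  rewrite (defect_space_cspan hT hD) => hx; apply: (sub_N ss).
  have /contractionP[lT _ nT] := hT.
  have := @cspan_min _ _ (range D) [set x | DTs (T x)] _ _ x hx; apply.
  - split.
    + by rewrite /= (lin_0 (subspaceT H) lT); exact: sub_0.
    + by move=> a y z hy hz; rewrite /= lT //; apply: (sub_L ss).
    + apply/closedP => z h; have [_ _ /closedP] := cs; apply => e /h[a ha za].
      exists (T a) => //; rewrite -(lin_B (subspaceT H) lT) //.
      by apply: le_lt_trans (nT _ I) za.
  - move=> _ [h _ <-]; rewrite /= -(defect_intertwine hT hD hDs).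
    exact: (defect_mem hTs hDs).
by move=> _; apply: (defect_mem hTs hDs).
Qed.

Section WithDilation.
Variables (K : hilbertType R) (J : H -> K) (U : K -> K).
Hypothesis hJ : isometry setT setT J.
Hypothesis hU : unitary setT setT U.
Hypothesis hdil : forall n h, proj (range J) (iter n U (J h)) = J (iter n T h).

(** Both D_T h and lam h have the Gram matrix <h, k> - <T h, T k>. This identifies the defect space
    with the wandering subspace L, and [lams_extension] does so for L_*. *)
Lemma lam_extension : exists2 L : H -> K,
  unitary DT (cspan (range (lam T J U))) L & forall h, L (D h) = lam T J U h.
Proof.
rewrite (defect_space_cspan hT hD); apply: isometric_extension => i j.
by rewrite (defect_inner hT hD) (lam_inner hJ hU hdil).
Qed.

Lemma lams_extension : exists2 L : H -> K,
  unitary DTs (cspan (range (lams T J U))) L & forall h, L (Ds h) = lams T J U h.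
Proof.
rewrite (defect_space_cspan hTs hDs); apply: isometric_extension => i j.
by rewrite (defect_inner hTs hDs) (lams_inner hT hJ hU hdil).
Qed.

(** The cases are the relative positions of n and m. Writing I - T^*T and I - T T^* as squares of
    the defect operators leaves exactly one Taylor coefficient of Theta_T between D_T h and D_{T^*}
    k. *)
Lemma cross_gram n m h k :
  inner (zpow U n (lam T J U h)) (zpow U m (lams T J U k)) =
  inner (char_coef T (m - n) (D h)) (Ds k).
Proof.
have [_ DD] := defectP hT hD; have [_ DDs] := defectP hTs hDs.
case E : (m - n) => [[|e]|e] /=.
- have -> : n = m by apply/eqP; rewrite eq_sym -subr_eq0 E.
  rewrite (zpow_inner hU) (cross_zero hT hJ hU hdil) -(defect_intertwine hT hD hDs).
  by rewrite innerNl (defect_inner hTs hDs).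
- rewrite (zpow_shiftr hU) E zpow_nat (cross_neg hT hJ hU hdil) -DD.
  have -> : k - T (Ts k) = Ds (Ds k) by rewrite DDs (adj_adj hT).
  rewrite innerC (inner_iter_adj hT) -innerC.
  by rewrite (defect_selfadj hTs hDs).
- rewrite (zpow_shift hU) -opprB E NegzE opprK zpow_nat (cross_pos hT hJ hU hdil).
  by rewrite inner0l.
Qed.

Variables (L Ls : H -> K).
Hypotheses (hL : unitary DT (cspan (range (lam T J U))) L)
  (hLD : forall h, L (D h) = lam T J U h)
  (hLs : unitary DTs (cspan (range (lams T J U))) Ls)
  (hLsD : forall h, Ls (Ds h) = lams T J U h).

Lemma cross_gram_ext n m x y : DT x -> DTs y ->
  inner (zpow U n (L x)) (zpow U m (Ls y)) = inner (char_coef T (m - n) x) y.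
Proof.
move=> hx hy.
have bz (E : hilbertType R) (A : set E) (B : set K) p (f : E -> K) : unitary A B f ->
    bounded_op A setT (fun x => zpow U p (f x)).
  move=> /unitaryP[l _ _ nf]; have /unitaryP[lz _ _ nz] := unitary_zpow hU p.
  apply/boundedP; split => //; first by move=> a v w Av Aw; rewrite l // lz.
  by exists 1 => // v Av; rewrite nz // nf // mul1r.
have bw (A : set H) (f : H -> H) : contraction setT setT f -> bounded_op A setT f.
  move=> /contractionP[l _ nf]; apply/boundedP; split => //.
    by move=> a v w _ _; rewrite l.
  by exists 1 => // v _; rewrite mul1r nf.
have step k : inner (zpow U n (L x)) (zpow U m (lams T J U k)) =
    inner (char_coef T (m - n) x) (Ds k).
  move: (hx); rewrite (defect_space_cspan hT hD).
  apply: (cspan_agree_inner (f := fun x => zpow U n (L x)) (g := char_coef T (m - n))).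
  - by rewrite -(defect_space_cspan hT hD); exact: bz hL.
  - exact/bw/char_coef_contraction.
  - by move=> _ [h _ <-]; rewrite hLD cross_gram.
rewrite innerC [RHS]innerC; congr Num.conj.
move: (hy); rewrite (defect_space_cspan hTs hDs).
apply: (@cspan_agree_inner _ _ _ _ _ (fun y => zpow U m (Ls y)) id).
- by rewrite -(defect_space_cspan hTs hDs); exact: bz hLs.
- by apply: (bw _ id); apply/contractionP.
- by move=> _ [h _ <-]; rewrite hLsD innerC step -innerC.
Qed.

Lemma lam_gram_ext n m x y : DT x -> DT y ->
  inner (zpow U n (L x)) (zpow U m (L y)) = if n == m then inner x y else 0.
Proof.
move=> hx hy; have sD := closed_subspaceW (defect_space_closed hT hD).
case: eqP => [->|nm].
  by rewrite (zpow_inner hU) (isometry_inner sD (unitary_isometry hL)).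
have /unitaryP[_ LL _ _] := hL.
apply: (zpow_ortho_cspan hU) (LL _ hx) (LL _ hy) => h k.
by apply: (lam_ortho hJ hU hdil).
Qed.

Lemma lams_gram_ext n m x y : DTs x -> DTs y ->
  inner (zpow U n (Ls x)) (zpow U m (Ls y)) = if n == m then inner x y else 0.
Proof.
move=> hx hy; have sD := closed_subspaceW (defect_space_closed hTs hDs).
case: eqP => [->|nm].
  by rewrite (zpow_inner hU) (isometry_inner sD (unitary_isometry hLs)).
have /unitaryP[_ LL _ _] := hLs.
apply: (zpow_ortho_cspan hU) (LL _ hx) (LL _ hy) => h k.
by apply: (lams_ortho hT hJ hU hdil).
Qed.

End WithDilation.
End CharacteristicCoefficientsTheory.

(** * Taylor coefficients recovered from values of the characteristic function *)

Section CoefficientUniqueness.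
Variables (R : realType) (H H' : hilbertType R) (T : H -> H) (T' : H' -> H').
Hypotheses (hT : contraction setT setT T) (hT' : contraction setT setT T').
Hypothesis hD : forall h, nrm (defect T h) ^+ 2 = nrm h ^+ 2 - nrm (T h) ^+ 2.
Hypothesis hDs : forall h, nrm (defect (adj T) h) ^+ 2 = nrm h ^+ 2 - nrm (adj T h) ^+ 2.
Hypothesis hDs' : forall h, nrm (defect (adj T') h) ^+ 2 = nrm h ^+ 2 - nrm (adj T' h) ^+ 2.
Variables (u : H -> H') (us : H -> H').
Hypothesis hus : unitary (defect_space (adj T)) (defect_space (adj T')) us.
Hypothesis hTheta : forall z x, cabs z < 1 -> defect_space T x ->
  us (- T x + z *: defect (adj T) (op_inverse (fun y => y - z *: adj T y) (defect T x))) =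
  - T' (u x) + z *: defect (adj T')
     (op_inverse (fun y => y - z *: adj T' y) (defect T' (u x))).

Let hTs := contraction_adj hT.
Let hTs' := contraction_adj hT'.

(** One step of peeling off Taylor coefficients: boundedness of r near 0 lets t tend to 0 and gives
    q = 0, after which t can be cancelled. *)
Lemma small_quotient (E : hilbertType R) (q : E) (r : R -> E) (M : R) :
  (forall t, 0 < t -> t < 1 -> q + t%:C *: r t = 0) ->
  (forall t, 0 < t -> t < 1 / 2 -> nrm (r t) <= M) ->
  q = 0 /\ forall t, 0 < t -> t < 1 -> r t = 0.
Proof.
move=> h hM; have q0 : q = 0.
  apply: nrm_eq0; apply: (@eps0 _ _ M) => [|e e0]; first exact: nrm_ge0.
  (* The bound 1 / 4 keeps t within the range where r is bounded. *)
  pose t := Num.min e (1 / 4).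
  have t0 : 0 < t by rewrite lt_min e0; lra.
  have t2 : t < 1 / 2 by rewrite gt_min; apply/orP; right; lra.
  have te : t <= e by rewrite ge_min lexx.
  have hMt := hM t t0 t2.
  have /eqP := h t t0 ltac:(lra); rewrite addr_eq0 => /eqP ->.
  rewrite nrmN nrmZ cabsr; last exact: ltW.
  apply: le_trans (_ : e * nrm (r t) <= _).
    by rewrite ler_wpM2r ?nrm_ge0.
  by rewrite ler_wpM2l // ltW.
split => // t t0 t1; have /eqP := h t t0 t1.
rewrite q0 add0r scaler_eq0 => /orP[/eqP /(@complexI _ _ 0) t00|/eqP //].
by rewrite t00 ltxx in t0.
Qed.

(** Coefficients are compared one at a time along real t -> 0. The resolvent equation g = D_T x + t
    T^* g turns the remainder r N into c N + t r (N + 1), and for t < 1/2 it gives |g| <= 2 |D_T x|,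
    the uniform bound that [small_quotient] requires. *)
Lemma char_coef_equiv d x : defect_space T x ->
  us (char_coef T d x) = char_coef T' d (u x).
Proof.
move=> hx.
have cs := defect_space_closed hTs hDs; have ss := closed_subspaceW cs.
have /unitaryP[lus _ _ nus] := hus.
have Dm := defect_mem hTs hDs.
have hTx : defect_space (adj T) (- T x) := char_coef_mem hT hD hDs (d := Posz 0) hx.
have /contractionP[lDs _ nDs] := defect_contraction hTs hDs.
have /contractionP[lDs' _ nDs'] := defect_contraction hTs' hDs'.
have /contractionP[lTs _ nTs] := hTs.
have /contractionP[lTs' _ nTs'] := hTs'.
pose g (t : R) := op_inverse (fun y => y - t%:C *: adj T y) (defect T x).
pose g' (t : R) := op_inverse (fun y => y - t%:C *: adj T' y) (defect T' (u x)).
have ct (t : R) : 0 < t -> t < 1 -> cabs t%:C < 1 by move=> t0 t1; rewrite cabsr // ltW.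
have gE t : 0 < t -> t < 1 -> g t = defect T x + t%:C *: adj T (g t).
  move=> t0 t1; have [_ /(_ (defect T x))] := resolvent_exists hTs (ct t t0 t1).
  by move=> /eqP; rewrite subr_eq => /eqP.
have gE' t : 0 < t -> t < 1 -> g' t = defect T' (u x) + t%:C *: adj T' (g' t).
  move=> t0 t1; have [_ /(_ (defect T' (u x)))] := resolvent_exists hTs' (ct t t0 t1).
  by move=> /eqP; rewrite subr_eq => /eqP.
have gb t : 0 < t -> t < 1 / 2 -> nrm (g t) <= 2 * nrm (defect T x).
  move=> t0 t1; have := nrmD (defect T x) (t%:C *: adj T (g t)).
  rewrite -gE ?nrmZ ?cabsr; try lra.
  by have := nTs (g t) I; have := nrm_ge0 (adj T (g t)); nra.
have gb' t : 0 < t -> t < 1 / 2 -> nrm (g' t) <= 2 * nrm (defect T' (u x)).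
  move=> t0 t1; have := nrmD (defect T' (u x)) (t%:C *: adj T' (g' t)).
  rewrite -gE' ?nrmZ ?cabsr; try lra.
  by have := nTs' (g' t) I; have := nrm_ge0 (adj T' (g' t)); nra.
pose c N := us (defect (adj T) (iter N (adj T) (defect T x))) -
  defect (adj T') (iter N (adj T') (defect T' (u x))).
pose r N t := us (defect (adj T) (iter N (adj T) (g t))) -
  defect (adj T') (iter N (adj T') (g' t)).
have rb N t : 0 < t -> t < 1 / 2 ->
    nrm (r N t) <= 2 * nrm (defect T x) + 2 * nrm (defect T' (u x)).
  move=> t0 t1; apply: le_trans (nrmD _ _) _; rewrite nrmN nus // lerD //.
    apply: le_trans (nDs _ I) _; apply: le_trans (gb _ t0 t1).
    by have /contractionP[_ _ n] := iter_contraction hT N; apply: n.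
  apply: le_trans (nDs' _ I) _; apply: le_trans (gb' _ t0 t1).
  by have /contractionP[_ _ n] := iter_contraction hT' N; apply: n.
have rS N t : 0 < t -> t < 1 -> r N t = c N + t%:C *: r N.+1 t.
  move=> t0 t1; rewrite /r {1}(gE t) // {1}(gE' t) //.
  have /contractionP[lN _ _] := iter_contraction hT N.
  have /contractionP[lN' _ _] := iter_contraction hT' N.
  rewrite ![iter N.+1 _ _]iterSr.
  rewrite (lin_D lN) // (lin_D lN') // (lin_Z (subspaceT H) lN) //.
  rewrite (lin_Z (subspaceT H') lN') // (lin_D lDs) // (lin_D lDs') //.
  rewrite (lin_Z (subspaceT H) lDs) // (lin_Z (subspaceT H') lDs') //.
  rewrite (lin_D lus) //; last exact: (sub_Z ss).
  rewrite (lin_Z ss lus) // /c scalerBr opprD addrACA.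
  by [].
have base : us (char_coef T (Posz 0) x) - char_coef T' (Posz 0) (u x) = 0 /\
    forall t, 0 < t -> t < 1 -> r 0%N t = 0.
  apply: (small_quotient (M := 2 * nrm (defect T x) + 2 * nrm (defect T' (u x)))).
    move=> t t0 t1; have := hTheta (ct t t0 t1) hx; rewrite -/(g t) -/(g' t).
    rewrite (lin_D lus); [|exact: hTx|exact: (sub_Z ss)].
    rewrite (lin_Z ss lus) // => h.
    by rewrite /r /= scalerBr addrACA h -opprD subrr.
  by move=> t t0 t1; apply: rb.
have step N : (forall t, 0 < t -> t < 1 -> r N t = 0) ->
    c N = 0 /\ forall t, 0 < t -> t < 1 -> r N.+1 t = 0.
  move=> hN; apply: (small_quotient (M := 2 * nrm (defect T x) + 2 * nrm (defect T' (u x)))).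
    by move=> t t0 t1; rewrite -rS // hN.
  by move=> t t0 t1; apply: rb.
have all N : forall t, 0 < t -> t < 1 -> r N t = 0.
  by elim: N => [|N /step[]] //; case: base.
case: d => [[|e]|e].
- by apply/eqP; rewrite -subr_eq0; apply/eqP; case: base.
- by apply/eqP; rewrite -subr_eq0; apply/eqP; case: (step e (all e)).
- by rewrite /= (lin_0 ss lus).
Qed.

End CoefficientUniqueness.

(** * Functions on the circle *)

Section CircleL2.
Variable R : realType.
Implicit Types E F : hilbertType R.

Import HBNNSimple.

Local Notation mu := (@lebesgue_measure R).
Local Notation I01 := (`[0%R, 1%R]%classic : set R).

Lemma ae_lebesgue_filter : Filter (nbhs (almost_everywhere mu)).
Proof. exact: ae_filter_ringOfSetsType. Qed.
#[local] Existing Instance ae_lebesgue_filter.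

Lemma aeT_imp2 (P Q S : R[i] -> Prop) : (forall z, P z -> Q z -> S z) ->
  aeT P -> aeT Q -> aeT S.
Proof.
by move=> h; rewrite /aeT; apply: filterS2 => t hP hQ t01; apply: h; [exact: hP|exact: hQ].
Qed.

Lemma aeT_imp (P Q : R[i] -> Prop) : (forall z, P z -> Q z) -> aeT P -> aeT Q.
Proof. by move=> h hP; apply: aeT_imp2 (hP) (hP) => z /h. Qed.

Lemma cabs_circ (t : R) : cabs (circ t) = 1.
Proof.
apply/eqP; rewrite -(@eqrXn2 _ 2) ?cabs_ge0 // cabs_sqr expr1n /=.
by rewrite cos2Dsin2.
Qed.

Lemma aeT_all (P : R[i] -> Prop) : (forall z, cabs z = 1 -> P z) -> aeT P.
Proof.
by move=> h; apply: aeW => t _; apply: h; exact: cabs_circ.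
Qed.

Lemma aeT_circle (P : R[i] -> Prop) : aeT P -> aeT (fun z => cabs z = 1 /\ P z).
Proof.
by apply: aeT_imp2 (aeT_all (fun z h => h)) => z.
Qed.

Lemma eqT_sym E (f g : R[i] -> E) : eqT f g -> eqT g f.
Proof. exact: aeT_imp. Qed.

Lemma eqT_trans E (g f h : R[i] -> E) : eqT f g -> eqT g h -> eqT f h.
Proof. by apply: aeT_imp2 => z ->. Qed.

(** Stated for arbitrary nonnegative functions: the integral is a supremum over simple functions,
    and a simple function below f, cut off on the exceptional null set, lies below g and has the
    same integral. *)
Lemma le_integral_ae (f g : R -> \bar R) :
  (forall t, (0 <= f t)%E) -> (forall t, (0 <= g t)%E) ->
  {ae mu, forall t : R, t \in `[0%R, 1%R] -> (f t <= g t)%E} ->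
  (\int[mu]_(t in `[0%R, 1%R]) f t <= \int[mu]_(t in `[0%R, 1%R]) g t)%E.
Proof.
move=> f0 g0 [N [mN N0 hN]].
rewrite !ge0_integralE; try by move=> *; auto.
apply: ge_ereal_sup => _ /= [h hf <-].
pose h' := proj_nnsfun h (measurableC mN).
have -> : sintegral mu h = sintegral mu h'.
  rewrite -!integralT_nnsfun; apply: ae_eq_integral => //.
  - exact/measurable_EFinP/measurable_funPT.
  - exact/measurable_EFinP/measurable_funPT.
  - exists N; split => // t /= ht; apply: contrapT => nN; apply: ht => _.
    by rewrite mindicE mem_set // mulr1.
apply: ereal_sup_ubound; exists h' => //= t.
rewrite mindicE; have [tN|tN] := pselect (N t).
  rewrite memNset ?mulr0; last by move=> /(_ tN).
  by rewrite /patch; case: ifP.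
rewrite mem_set // mulr1; apply: le_trans (hf t) _.
rewrite /patch; case: ifPn => // t01.
apply: contrapT => ht; apply: tN; apply: hN => /= /(_ _)/ht; apply.
by rewrite inE in t01.
Qed.

Lemma L2sqnorm_le_ae E F (f : R[i] -> E) (g : R[i] -> F) :
  aeT (fun z => nrm (f z) <= nrm (g z)) -> (L2sqnorm f <= L2sqnorm g)%E.
Proof.
move=> h; apply: le_integral_ae.
- by move=> t; rewrite lee_fin sqr_ge0.
- by move=> t; rewrite lee_fin sqr_ge0.
- by move: h; rewrite /aeT; apply: filterS => t ht t01; rewrite lee_fin ler_sqr ?nnegrE ?nrm_ge0 ?ht.
Qed.

Lemma L2sqnorm_ae E F (f : R[i] -> E) (g : R[i] -> F) :
  aeT (fun z => nrm (f z) = nrm (g z)) -> L2sqnorm f = L2sqnorm g.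
Proof.
move=> h; apply/eqP; rewrite eq_le; apply/andP.
by split; apply: L2sqnorm_le_ae; apply: aeT_imp h => z ->.
Qed.

Lemma L2sqnorm_eqT E (f g : R[i] -> E) : eqT f g -> L2sqnorm f = L2sqnorm g.
Proof. by move=> h; apply: L2sqnorm_ae; apply: aeT_imp h => z ->. Qed.

Lemma L2sqnorm_const E (x : E) : L2sqnorm (fun=> x) = (nrm x ^+ 2)%:E.
Proof.
rewrite /L2sqnorm integral_cst //= lebesgue_measure_itv /= lte_fin ltr01.
by rewrite oppr0 adde0 mule1.
Qed.

Lemma strongly_measurable_eqT E (f g : R[i] -> E) : eqT f g ->
  strongly_measurable f -> strongly_measurable g.
Proof.
move=> fg [s [hs sf]]; exists s; split => //.
move: fg sf; rewrite /eqT /aeT; apply: filterS2 => t h1 h2 t01.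
by rewrite -h1 //; apply: h2.
Qed.

Lemma L2_eqT E (D : set E) (f g : R[i] -> E) : eqT f g -> L2 D f -> L2 D g.
Proof.
move=> fg [h1 h2 h3]; split.
- exact: strongly_measurable_eqT h1.
- by apply: aeT_imp2 fg h2 => z ->.
- by rewrite -(L2sqnorm_eqT fg).
Qed.

Lemma L2closure_eqT E (S : set (R[i] -> E)) f g : eqT f g ->
  L2closure S f -> L2closure S g.
Proof.
move=> fg [h1 h2]; split; first exact: L2_eqT h1.
move=> e /h2[k Sk hk]; exists k => //.
rewrite -(@L2sqnorm_eqT _ (fun z => f z - k z)) //.
by apply: aeT_imp fg => z ->.
Qed.

(** phi is injective, so a level set of phi composed with a simple function is a level set of that
    function or empty. *)
Lemma strongly_measurable_amp E F (phi : E -> F) (f : R[i] -> E) :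
  isometry setT setT phi -> strongly_measurable f -> strongly_measurable (amp phi f).
Proof.
move=> /isometryP[lphi _ nphi] [s [hs sf]].
have phiB x y : phi (x - y) = phi x - phi y by rewrite (lin_B (subspaceT E) lphi).
exists (fun n t => phi (s n t)); split.
  move=> n; have [h1 h2] := hs n; split.
    have -> : range (fun t => phi (s n t)) = phi @` range (s n).
      by rewrite image_comp.
    exact: finite_image.
  move=> y; have [[x xy]|nx] := pselect (exists x, phi x = y).
    have -> : (fun t => phi (s n t)) @^-1` [set y] = s n @^-1` [set x].
      apply/seteqP; split => t /= ht; last by rewrite ht.
      apply/eqP; rewrite -subr_eq0; apply/eqP/nrm_eq0.
      by rewrite -nphi // phiB ht xy subrr nrm0.
    exact: h2.
  have -> : (fun t => phi (s n t)) @^-1` [set y] = set0; last exact: measurable0.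
  by apply/seteqP; split => t //= ht; apply: nx; exists (s n t).
apply: filterS sf => t h t01; apply/cvg_seq_lim => e e0.
have /cvg_seq_lim /(_ e e0)[N hN] := h t01.
by exists N => n /hN; rewrite /amp -phiB nphi.
Qed.

Lemma L2_amp E F (phi : E -> F) (D : set E) (D' : set F) (f : R[i] -> E) :
  isometry setT setT phi -> (forall x, D x -> D' (phi x)) ->
  L2 D f -> L2 D' (amp phi f).
Proof.
move=> iphi hD [h1 h2 h3]; split.
- exact: strongly_measurable_amp.
- by apply: aeT_imp h2 => z /hD.
- have /isometryP[_ _ n] := iphi.
  rewrite (@L2sqnorm_ae _ _ _ f) //; apply: aeT_all => z _; exact: n.
Qed.

Lemma L2sqnorm_amp E F (phi : E -> F) (f : R[i] -> E) : isometry setT setT phi ->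
  L2sqnorm (amp phi f) = L2sqnorm f.
Proof.
by move=> /isometryP[_ _ n]; apply: L2sqnorm_ae; apply: aeT_all => z _; exact: n.
Qed.

Section ClosureRange.
Variables (E : hilbertType R) (D : set E) (cD : closed_subspace D).

Let dist (x : E) := nrm (x - proj D x).

Let dist_le x a : D a -> dist x <= nrm (x - a).
Proof.
move=> Da; have [Dp hp] := projP cD x.
rewrite /dist -ler_sqr ?nnegrE ?nrm_ge0 //.
have -> : x - a = (x - proj D x) + (proj D x - a) by rewrite addrA subrK.
rewrite (nrmD_sqr (x - proj D x)).
have -> : dot (x - proj D x) (proj D x - a) = 0.
  by rewrite /dot hp //; apply: (sub_B (closed_subspaceW cD)).
by rewrite mulr0 addr0 lerDl sqr_ge0.
Qed.

Let dist_lip x y : dist x <= nrm (x - y) + dist y.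
Proof.
have [Dp _] := projP cD y.
by apply: le_trans (dist_le _ Dp) _; exact: nrm_triB.
Qed.

Let dist_mem x : dist x = 0 -> D x.
Proof.
by move=> /nrm_eq0/eqP; rewrite subr_eq0 => /eqP ->; case: (projP cD x).
Qed.

(** The distance from f(z) to D is at most |f(z) - g(z)| for every D-valued g, so its square has
    integral 0. A Chebyshev estimate then makes it vanish almost everywhere; the sets involved are
    built from the simple approximants of f, which makes them measurable. *)
Lemma L2closure_range (S : set (R[i] -> E)) f :
  (forall g, S g -> aeT (fun z => D (g z))) -> L2closure S f ->
  aeT (fun z => D (f z)).
Proof.
move=> hS [[[s [hs sf]] _ _] hf].
have int0 (e : R) : 0 < e ->
    (\int[mu]_(t in `[0%R, 1%R]) ((dist (f (circ t))) ^+ 2)%:E < e%:E)%E.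
  move=> /hf[g /hS Sg]; apply: le_lt_trans; apply: le_integral_ae.
  - by move=> t; rewrite lee_fin sqr_ge0.
  - by move=> t; rewrite lee_fin sqr_ge0.
  - move: Sg; rewrite /aeT; apply: filterS => t ht t01.
    by rewrite lee_fin ler_sqr ?nnegrE ?nrm_ge0 //; apply: dist_le; apply: ht.
pose A (e : R) n := [set t : R | e < dist (s n t)].
have mA e n : measurable (A e n).
  have [h1 h2] := hs n.
  have -> : A e n = \bigcup_(x in range (s n) `&` [set x | e < dist x]) (s n @^-1` [set x]).
    apply/seteqP; split => [t ht|t [x [_ hx] /= st]]; last by rewrite /A /= st.
    by exists (s n t) => //; split => //; exists t.
  apply: fin_bigcup_measurable; last by move=> x _; exact: h2.
  exact: finite_setIl.
(* Upper limit of the sets where the approximants are farther than e from D. Up to null sets it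
   contains {dist f > e} and is contained in {dist f >= e}. *)
pose B e := \bigcap_N \bigcup_(n in [set n | (N <= n)%N]) A e n.
have mB e : measurable (B e).
  apply: bigcap_measurable; first by exists 0%N.
  by move=> N _; apply: bigcup_measurable => n _; exact: mA.
have B0 (e : R) : 0 < e -> mu (B e `&` I01) = 0%E.
  move=> e0; apply/eqP; rewrite eq_le measure_ge0 andbT.
  apply/lee_addgt0Pr => d d0; rewrite add0e.
  have ed : 0 < e ^+ 2 * d by rewrite mulr_gt0 // exprn_gt0.
  have := int0 _ ed.
  have e2 : (0 < (e ^+ 2)%:E)%E by rewrite lte_fin exprn_gt0.
  move=> /ltW h; rewrite -(lee_pmul2l _ e2) ?fin_numE //; apply: le_trans h.
  have mI : measurable I01 by exact: measurable_itv.
  rewrite -(integral_indic mu mI (mB e)).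
  rewrite -ge0_integralZl //=.
  - apply: le_integral_ae.
    + by move=> t; rewrite mule_ge0 // lee_fin ?sqr_ge0.
    + by move=> t; rewrite lee_fin sqr_ge0.
    + apply: filterS sf => t st t01; rewrite indicE.
      case: (boolP (t \in B e)) => [tB|_]; last by rewrite mule0 lee_fin sqr_ge0.
      rewrite mule1 lee_fin ler_sqr ?nnegrE ?nrm_ge0 //; last exact: ltW.
      apply: (@le_eps _ _ _ 1) => d' d'0.
      have /cvg_seq_lim /(_ d' d'0)[N hN] := st t01.
      rewrite inE in tB; have [n /= Nn ht] := tB N I.
      have := hN n Nn; have := dist_lip (s n t) (f (circ t)).
      by move: ht; rewrite /A /= /dist; lra.
  - by apply/measurable_EFinP; apply: measurable_indic; exact: mB.
  - exact: ltW.
rewrite /aeT.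
have hk : {ae mu, forall t : R, forall k : nat, t \in `[0, 1] ->
     dist (f (circ t)) <= k.+1%:R^-1}.
  apply/ae_foralln => k; have k0 : 0 < k.+1%:R^-1 :> R by rewrite invr_gt0.
  have nB : {ae mu, forall t, ~ (B k.+1%:R^-1 `&` I01) t}.
    exists (B k.+1%:R^-1 `&` I01); split => //.
    - by apply: measurableI; [exact: mB|exact: measurable_itv].
    - exact: B0.
    - by move=> t /= /contrapT.
  apply: filterS2 nB sf => t nB st t01; rewrite leNgt; apply/negP => hlt.
  apply: nB; split; last by [].
  move=> N _; pose d := dist (f (circ t)) - k.+1%:R^-1.
  have d0 : 0 < d by rewrite subr_gt0.
  have /cvg_seq_lim /(_ d d0)[M hM] := st t01.
  exists (maxn N M); first exact: leq_maxl.
  have := hM _ (leq_maxr N M); have := dist_lip (f (circ t)) (s (maxn N M) t).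
  rewrite /A /= [X in _ <= X + _]nrmC /d.
  set x1 := dist _; set x2 := dist _; set x3 := nrm _.
  by move: (k.+1%:R^-1) => c; lra.
apply: filterS hk => t ht t01; apply: dist_mem; apply/eqP.
rewrite eq_le nrm_ge0 andbT; apply: (@le_eps _ _ _ 1) => e e0; rewrite add0r mulr1.
have := near_infty_natSinv_lt (PosNum e0) => -[N _ /(_ N (leqnn N))] /= hN.
by apply: le_trans (ht N t01) _; exact: ltW.
Qed.

End ClosureRange.
End CircleL2.

(** * Unitaries from Hilbert spaces onto subspaces of L^2 *)

Section UnitaryToL2.
Variable R : realType.
Implicit Types E F K : hilbertType R.

Lemma toL2_inj E F (A : set E) (S : set (R[i] -> F)) w : subspace A ->
  unitary_toL2 A S w -> forall x y, A x -> A y -> eqT (w x) (w y) -> x = y.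
Proof.
move=> sA [wl _ _ wn] x y Ax Ay xy; apply/eqP; rewrite -subr_eq0; apply/eqP/nrm_eq0.
have h : eqT (w (x - y)) (fun=> 0).
  have := wl (-1) y x Ay Ax; rewrite scaleN1r [- y + x]addrC => h.
  by apply: aeT_imp2 h xy => z -> ->; rewrite scaleN1r addNr.
have := wn _ (sub_B sA Ax Ay).
rewrite (L2sqnorm_eqT h) L2sqnorm_const nrm0 expr0n /= => -[] /eqP.
by rewrite eq_sym sqrf_eq0 => /eqP.
Qed.

Lemma toL2_B E F (A : set E) (S : set (R[i] -> F)) w :
  unitary_toL2 A S w -> forall x y, A x -> A y ->
  eqT (w (x - y)) (fun z => w x z - w y z).
Proof.
move=> [wl _ _ _] x y Ax Ay; have := wl (-1) y x Ay Ax.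
rewrite scaleN1r [- y + x]addrC; apply: aeT_imp => z ->.
by rewrite scaleN1r addrC.
Qed.

(* Pulling [amp phi (w x)] back through [w'] gives an isometry of [A] into [A'],
   so that only Hilbert space continuity is needed. *)
Lemma toL2_transport E E' F F' (A : set E) (A' : set E') (S : set (R[i] -> F))
    (S' : set (R[i] -> F')) w w' (Psi : E -> E') (phi : F -> F') (G : set E) :
  closed_subspace A -> closed_subspace A' ->
  unitary_toL2 A S w -> unitary_toL2 A' S' w' ->
  isometry A A' Psi -> isometry setT setT phi ->
  (forall f, S f -> S' (amp phi f)) ->
  G `<=` A -> A `<=` cspan G ->
  (forall g, G g -> eqT (w' (Psi g)) (amp phi (w g))) ->
  forall x, A x -> eqT (w' (Psi x)) (amp phi (w x)).
Proof.
move=> cA cA' uw uw' iPsi iphi hS GA AG hG x Ax.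
have sA := closed_subspaceW cA; have sA' := closed_subspaceW cA'.
have [wl wS wo wn] := uw; have [wl' wS' wo' wn'] := uw'.
have /isometryP[lP PA' nP] := iPsi.
have /isometryP[lphi _ _] := iphi.
have hk y : exists p, A y -> A' p /\ eqT (w' p) (amp phi (w y)).
  have [Ay|nA] := pselect (A y); last by exists 0.
  by have [p A'p hp] := wo' _ (hS _ (wS _ Ay)); exists p.
have /choice[k {}hk] := hk.
have kA' y : A y -> A' (k y) by case/hk.
have kE y : A y -> eqT (w' (k y)) (amp phi (w y)) by case/hk.
have lk : linear_on A k.
  move=> a y z Ay Az; have Ayz := sub_L sA a Ay Az.
  have h1 := kE _ Ayz; have h2 := wl' a _ _ (kA' _ Ay) (kA' _ Az).
  apply: (toL2_inj sA' uw'); [exact: kA'| |].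
    by apply: (sub_L sA'); apply: kA'.
  apply: eqT_trans h1 _; apply: eqT_sym; apply: eqT_trans h2 _.
  have h3 : eqT (fun u => a *: w' (k y) u + w' (k z) u)
      (fun u => a *: phi (w y u) + phi (w z u)).
    by apply: aeT_imp2 (kE _ Ay) (kE _ Az) => u -> ->.
  apply: eqT_trans h3 _; apply: aeT_imp (wl a _ _ Ay Az) => u hu.
  by rewrite /amp hu lphi.
have nk y : A y -> nrm (k y) = nrm y.
  move=> Ay; apply/eqP; rewrite -(@eqrXn2 _ 2) ?nrm_ge0 //; apply/eqP.
  have := wn' _ (kA' _ Ay); rewrite (L2sqnorm_eqT (kE _ Ay)) L2sqnorm_amp //.
  by rewrite wn // => -[].
suff -> : Psi x = k x by exact: kE.
have [|s Gs|] := @cspan_min _ _ G [set y | A y /\ Psi y = k y] _ _ x (AG _ Ax).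
- apply: (agree_closed cA).
    exact: isometric_bounded.
  exact: isometric_bounded.
- split; first exact: GA.
  apply: (toL2_inj sA' uw'); [exact/PA'/GA|exact/kA'/GA|].
  by apply: eqT_trans (hG _ Gs) _; apply: eqT_sym; apply: kE; apply: GA.
- by [].
Qed.

End UnitaryToL2.

Section DefectSpaceTransport.
Variables (R : realType) (H H' : hilbertType R) (T : H -> H) (T' : H' -> H').
Variable phi : H -> H'.
Hypotheses (hT : contraction setT setT T) (hT' : contraction setT setT T').
Hypothesis hphi : unitary setT setT phi.
Hypothesis phiT : forall x, phi (T x) = T' (phi x).

Lemma unitary_inv_intertwine y : adj phi (T' y) = T (adj phi y).
Proof.
by rewrite -{1}(unitary_adjVK hphi y) -phiT (unitary_adjK hphi).
Qed.

Lemma defect_space_sub x : defect_space T x -> defect_space T' (phi x).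
Proof.
move=> /closureP h; apply/closureP => e /h[_ [k _ <-] hk].
have /unitaryP[lphi _ _ nphi] := hphi.
exists (defect T' (phi k)); first by exists (phi k).
by rewrite -(defect_equiv hT hT' hphi phiT) -(lin_B (subspaceT H) lphi) // nphi.
Qed.

End DefectSpaceTransport.

Lemma defect_space_unitary (R : realType) (H H' : hilbertType R) (T : H -> H)
    (T' : H' -> H') (phi : H -> H') :
  contraction setT setT T -> contraction setT setT T' ->
  unitary setT setT phi -> (forall x, phi (T x) = T' (phi x)) ->
  unitary (defect_space T) (defect_space T') phi.
Proof.
move=> hT hT' hphi phiT.
have /unitaryP[lphi _ _ nphi] := hphi.
have hpsi := unitary_inv (subspaceT H) hphi.
apply/unitaryP; split => //.
- by move=> a x y _ _; rewrite lphi.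
- exact: defect_space_sub.
- move=> y hy; exists (adj phi y); last exact: unitary_adjVK.
  exact: (defect_space_sub hT' hT hpsi (unitary_inv_intertwine hphi phiT)).
- by move=> x _; exact: nphi.
Qed.

(** * Boundary values, Delta and the closure of Delta L^2 under a unitary *)

Section DeltaTransport.
Variables (R : realType) (E E' Es Es' : hilbertType R).
Variables (D : set E) (D' : set E') (Ds : set Es) (Ds' : set Es').
Variables (Th : R[i] -> E -> Es) (Th' : R[i] -> E' -> Es').
Variables (phi : E -> E') (phis : Es -> Es').
Hypotheses (cD : closed_subspace D) (cD' : closed_subspace D').
Hypothesis cDs : closed_subspace Ds.
Hypotheses (hphi : isometry setT setT phi) (uphi : unitary D D' phi).
Hypotheses (hphis : isometry setT setT phis) (uphis : unitary Ds Ds' phis).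
Hypothesis Th_mem : forall z x, cabs z < 1 -> D x -> Ds (Th z x).
Hypothesis Th_bnd : has_boundary_values D Th.
Hypothesis Th_eq : forall z x, cabs z < 1 -> D x -> Th' z (phi x) = phis (Th z x).

Lemma radial_near (z : R[i]) : cabs z = 1 ->
  \forall r \near (1 : R)^'-, cabs (r%:C * z) < 1.
Proof.
move=> z1; near=> r; have r0 : 0 < r by near: r; apply: nbhs_left_gt; exact: ltr01.
by rewrite cabsM z1 mulr1 cabsr ?ltW //; near: r; exact: nbhs_left_lt.
Unshelve. all: by end_near. Qed.

Lemma boundary_mem z x : cabs z = 1 ->
  cvg (Th (r%:C * z) x @[r --> (1 : R)^'-]) -> D x -> Ds (boundary Th z x).
Proof.
move=> z1 cv Dx; have [_ _ cl] := cDs.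
refine (@closed_cvg _ _ _ _ (fun r : R => Th (r%:C * z) x) Ds cl _ _ cv).
by apply: filterS (radial_near z1) => r hr; apply: Th_mem.
Qed.

Lemma boundary_equiv z x : cabs z = 1 ->
  cvg (Th (r%:C * z) x @[r --> (1 : R)^'-]) -> D x ->
  boundary Th' z (phi x) = phis (boundary Th z x).
Proof.
move=> z1 cv Dx; have /isometryP[lp _ np] := hphis.
apply/cvg_lim; first exact: norm_hausdorff.
apply/cvgrPdist_lt => e e0; have /cvgrPdist_lt /(_ e e0) := cv.
apply: filterS2 (radial_near z1) => r hr; rewrite !nrmE Th_eq //.
by rewrite -(lin_B (subspaceT Es) lp) // np.
Qed.

(** At every point where the radial limits exist, the boundary value, its adjoint and the square
    root are transported in turn. *)
Lemma Delta_equiv : aeT (fun z => forall x, D x ->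
  Delta D' Ds' Th' z (phi x) = phi (Delta D Ds Th z x)).
Proof.
apply: aeT_imp (aeT_circle Th_bnd) => z [z1 cv] x Dx.
have sD := closed_subspaceW cD; have sDs := closed_subspaceW cDs.
have sD' := closed_subspaceW cD'.
have /isometryP[lp _ _] := hphi.
have aE y : Ds y -> adjoint D' Ds' (boundary Th' z) (phis y) =
    phi (adjoint D Ds (boundary Th z) y).
  apply: (adjoint_equiv sD sDs sD' uphi uphis) => w Dw.
    by apply: boundary_mem => //; apply: cv.
  by apply: boundary_equiv => //; apply: cv.
have am y : Ds y -> D (adjoint D Ds (boundary Th z) y).
  rewrite /adjoint; case: xgetP => [g _ [h _] Dy|_ _]; last exact: sub_0.
  by apply: h; exists y.
apply: (psqrt_equiv sD sD' uphi) => // y Dy.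
  by apply: (sub_B sD) => //; apply: am; apply: boundary_mem => //; apply: cv.
rewrite (lin_B (subspaceT E) lp) // boundary_equiv //; last exact: cv.
by rewrite aE //; apply: boundary_mem => //; apply: cv.
Qed.

Lemma mulDelta_equiv f : aeT (fun z => D (f z)) ->
  eqT (mulDelta D' Ds' Th' (amp phi f)) (amp phi (mulDelta D Ds Th f)).
Proof. by apply: aeT_imp2 Delta_equiv => z h Df; rewrite /mulDelta /amp h. Qed.

Lemma DeltaL2_amp f : DeltaL2 D Ds Th f -> DeltaL2 D' Ds' Th' (amp phi f).
Proof.
have /unitaryP[_ pD _ _] := uphi; have /isometryP[lp _ np] := hphi.
move=> [h1 h2]; split; first exact: (L2_amp hphi _ h1).
move=> e /h2[_ [g [hg1 hg2 hg3] <-] hge].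
exists (mulDelta D' Ds' Th' (amp phi g)).
  by exists (amp phi g) => //; apply: (L2_amp hphi pD).
apply: le_lt_trans hge; apply: L2sqnorm_le_ae.
apply: aeT_imp (mulDelta_equiv hg2) => z ->.
by rewrite /amp -(lin_B (subspaceT E) lp) // np.
Qed.

Lemma Delta_mem z x : D x -> D (Delta D Ds Th z x).
Proof.
rewrite /Delta /psqrt; case: xgetP => [g _ [[/boundedP[_ gD _] _] _]|_ _].
  exact: gD.
exact: (sub_0 (closed_subspaceW cD)).
Qed.

Lemma DeltaL2_range f : DeltaL2 D Ds Th f -> aeT (fun z => D (f z)).
Proof.
apply: (L2closure_range cD) => _ [g [_ hg _] <-].
by apply: aeT_imp hg => z; exact: Delta_mem.
Qed.

End DeltaTransport.

(** * Transport of the functional models *)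

Section Models.
Variables (R : realType) (H : hilbertType R) (T : H -> H).

Local Notation DT := (defect_space T).
Local Notation DTs := (defect_space (adj T)).

(** The part of the canonical data common to both indices k: the dilation, the Fourier
    representation of M(L) and omega_NF. *)
Definition nf_model (Th : R[i] -> H -> H) (K : hilbertType R) (J : H -> K)
    (U : K -> K) (iota omega : K -> R[i] -> H) :=
  let L := bilateral U (closure (range (lam T J U))) in
  [/\ isometry setT setT J, unitary setT setT U,
      forall n h, proj (range J) (iter n U (J h)) = J (iter n T h),
      cspan [set x | exists n h, x = zpow U n (J h)] = setT &
      [/\ unitary_toL2 L (L2 DT) iota,
          forall n h, eqT (iota (zpow U n (lam T J U h))) (fun z => z ^ n *: defect T h),
          unitary_toL2 (residual T J U) (DeltaL2 DT DTs Th) omega &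
          forall l, L l ->
            eqT (omega (proj (residual T J U) l)) (mulDelta DT DTs Th (iota l))]].

(* [v] is the map h |-> Q h from H into the space of W_D, and [Wd] stands for
   W_{partial k}, whose adjoint extends Q h |-> Q S^* h with S = T_k. *)
Definition residual_model (S : H -> H) (K : hilbertType R) (J : H -> K)
    (U : K -> K) (RD : hilbertType R) (v : H -> RD) (WD Wd : RD -> RD)
    (omegaD : K -> RD) :=
  [/\ unitary setT setT WD, unitary setT setT Wd,
      forall y, adj Wd (adj WD y) = adj WD (adj Wd y),
      forall h, adj Wd (v h) = v (adj S h) &
      [/\ cspan [set y | exists n h, y = iter n WD (v h)] = setT,
          unitary (residual T J U) setT omegaD &
          forall n h, omegaD (iter n U (proj (residual T J U) (J h))) = iter n WD (v h)]].

End Models.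

Section ModelTransport.
Variables (R : realType) (H H' : hilbertType R) (T : H -> H) (T' : H' -> H').
Variable phi : H -> H'.
Hypotheses (hT : contraction setT setT T) (hT' : contraction setT setT T').
Hypothesis hphi : unitary setT setT phi.
Hypothesis phiT : forall x, phi (T x) = T' (phi x).
Variables (K K' : hilbertType R) (J : H -> K) (U : K -> K) (J' : H' -> K') (U' : K' -> K').

Let phiTs x : phi (adj T x) = adj T' (phi x).
Proof. exact: unitary_adj_intertwine. Qed.
Let phi_dot x y : inner (phi x) (phi y) = inner x y.
Proof. exact: (isometryT_inner (unitary_isometry hphi)). Qed.
Let phi_iter n x : phi (iter n T x) = iter n T' (phi x).
Proof. by elim: n => //= n <-. Qed.

(** By [zpow_gram] both Gram matrices depend only on the powers of T and T', which phi intertwines;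
    minimality makes the resulting isometry a unitary of the whole spaces. *)
Lemma dilation_transport :
  isometry setT setT J -> unitary setT setT U ->
  (forall n h, proj (range J) (iter n U (J h)) = J (iter n T h)) ->
  cspan [set x | exists n h, x = zpow U n (J h)] = setT ->
  isometry setT setT J' -> unitary setT setT U' ->
  (forall n h, proj (range J') (iter n U' (J' h)) = J' (iter n T' h)) ->
  cspan [set x | exists n h, x = zpow U' n (J' h)] = setT ->
  exists2 Psi : K -> K', unitary setT setT Psi &
    forall n h, Psi (zpow U n (J h)) = zpow U' n (J' (phi h)).
Proof.
move=> hJ hU hd hm hJ' hU' hd' hm'.
pose x (i : int * H) := zpow U i.1 (J i.2).
pose y (i : int * H) := zpow U' i.1 (J' (phi i.2)).
have [|Psi uP PE] := @isometric_extension _ _ _ _ x y.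
  move=> [n h] [m k]; rewrite /x /y /= (zpow_gram hJ hU hd) (zpow_gram hJ' hU' hd').
  by case: (n - m) => d; rewrite -phi_iter phi_dot.
exists Psi; last by move=> n h; rewrite -[zpow U n _]/(x (n, h)) PE.
move: uP; have -> : cspan (range x) = setT.
  rewrite -hm; congr cspan; apply/seteqP; split => [_ [[n h] _ <-]|_ [n [h ->]]].
    by exists n, h.
  by exists (n, h).
suff -> : cspan (range y) = setT by [].
rewrite -hm'; congr cspan; apply/seteqP; split => [_ [[n h] _ <-]|_ [n [h ->]]].
  by exists n, (phi h).
by exists (n, adj phi h) => //; rewrite /y /= (unitary_adjVK hphi).
Qed.

Variables (Th : R[i] -> H -> H) (Th' : R[i] -> H' -> H').
Local Notation DT := (defect_space T).
Local Notation DTs := (defect_space (adj T)).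
Local Notation DT' := (defect_space T').
Local Notation DTs' := (defect_space (adj T')).

Hypothesis cDT : closed_subspace DT.
Hypothesis cDTs : closed_subspace DTs.
Hypothesis cDT' : closed_subspace DT'.
Hypothesis Th_mem : forall z x, cabs z < 1 -> DT x -> DTs (Th z x).
Hypothesis Th_bnd : has_boundary_values DT Th.
Hypothesis Th_eq : forall z x, cabs z < 1 -> DT x -> Th' z (phi x) = phi (Th z x).

Let uDT := defect_space_unitary hT hT' hphi phiT.
Let uDTs := defect_space_unitary (contraction_adj hT) (contraction_adj hT') hphi phiTs.

Lemma model_DeltaL2_amp f : DeltaL2 DT DTs Th f -> DeltaL2 DT' DTs' Th' (amp phi f).
Proof.
exact: (DeltaL2_amp cDT cDT' cDTs (unitary_isometry hphi) uDT (unitary_isometry hphi) uDTs).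
Qed.

Variables (iota omega : K -> R[i] -> H) (iota' omega' : K' -> R[i] -> H').
Hypothesis hM : nf_model T Th J U iota omega.
Hypothesis hM' : nf_model T' Th' J' U' iota' omega'.
Variable Psi : K -> K'.
Hypothesis hPsi : unitary setT setT Psi.
Hypothesis PsiJ : forall n h, Psi (zpow U n (J h)) = zpow U' n (J' (phi h)).

Local Notation Res := (residual T J U).
Local Notation Res' := (residual T' J' U').

Let PB x y : Psi (x - y) = Psi x - Psi y.
Proof. by have [l _ _] := hPsi; rewrite (lin_B (subspaceT K) l). Qed.
Let P_dot x y : inner (Psi x) (Psi y) = inner x y.
Proof. exact: (isometryT_inner (unitary_isometry hPsi)). Qed.

Lemma Psi_lam n h : Psi (zpow U n (lam T J U h)) = zpow U' n (lam T' J' U' (phi h)).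
Proof.
have [_ hU _ _ _] := hM; have [_ hU' _ _ _] := hM'.
rewrite /lam (zpowB hU) (zpowB hU') PB PsiJ phiT; congr (_ - _).
by rewrite -(zpowD hU n 1) PsiJ (zpowD hU' n 1).
Qed.

Lemma Psi_lams n h : Psi (zpow U n (lams T J U h)) = zpow U' n (lams T' J' U' (phi h)).
Proof.
have [_ hU _ _ _] := hM; have [_ hU' _ _ _] := hM'.
rewrite /lams (zpowB hU) (zpowB hU') PB PsiJ -phiTs; congr (_ - _).
by rewrite -(zpowD hU n 1) PsiJ (zpowD hU' n 1).
Qed.

Lemma Psi_zpow n x : Psi (zpow U n x) = zpow U' n (Psi x).
Proof.
have [_ hU _ hm _] := hM; have [_ hU' _ _ _] := hM'.
have /unitaryP[lz _ _ nz] := unitary_zpow hU n.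
have /unitaryP[lz' _ _ nz'] := unitary_zpow hU' n.
have /unitaryP[lP _ _ nP] := hPsi.
have := @cspan_agree _ _ _ [set x | exists n h, x = zpow U n (J h)]
  (fun x => Psi (zpow U n x)) (fun x => zpow U' n (Psi x)); rewrite hm; apply => //.
- apply: isometric_bounded => [a y z _ _|y _]; first by rewrite lz // lP.
  by rewrite nP // nz.
- apply: isometric_bounded => [a y z _ _|y _]; first by rewrite lP // lz'.
  by rewrite nz' // nP.
- by move=> _ [m [h ->]]; rewrite -(zpowD hU) !PsiJ (zpowD hU').
Qed.

Lemma Psi_residual x : Res x <-> Res' (Psi x).
Proof.
have [hJ hU _ _ _] := hM; have [hJ' hU' _ _ _] := hM'.
split=> [/(residualP hT hJ hU) h|/(residualP hT' hJ' hU') h].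
  apply/(residualP hT' hJ' hU') => n k.
  by rewrite -(unitary_adjVK hphi k) -Psi_lams P_dot.
by apply/(residualP hT hJ hU) => n k; rewrite -P_dot Psi_lams.
Qed.

Lemma Psi_unitary_residual : unitary Res Res' Psi.
Proof.
have /unitaryP[lP _ oP nP] := hPsi; apply/unitaryP; split.
- by move=> a x y _ _; rewrite lP.
- by move=> x /Psi_residual.
- by move=> y ry; have [x _ xy] := oP y I; exists x => //; apply/Psi_residual; rewrite xy.
- by move=> x _; exact: nP.
Qed.

Lemma Psi_proj x : Psi (proj Res x) = proj Res' (Psi x).
Proof.
have [h1 h2] := projP (residual_closed T J U) x.
apply/esym/(proj_eq (closed_subspaceW (residual_closed T' J' U'))).
  exact/Psi_residual.
move=> a ra; rewrite -(unitary_adjVK hPsi a) -PB P_dot; apply: h2.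
by apply/Psi_residual; rewrite (unitary_adjVK hPsi).
Qed.

Let Lg := [set x | exists n h, x = zpow U n (lam T J U h)].
Let LE : bilateral U (closure (range (lam T J U))) = cspan Lg.
Proof.
have [hJ hU _ _ _] := hM.
by rewrite (wanderingL hT hJ hU) (bilateralE hU).
Qed.

Let Lg' := [set x | exists n h, x = zpow U' n (lam T' J' U' h)].
Let LE' : bilateral U' (closure (range (lam T' J' U'))) = cspan Lg'.
Proof.
have [hJ hU _ _ _] := hM'.
by rewrite (wanderingL hT' hJ hU) (bilateralE hU).
Qed.

Lemma Psi_bilateral x : cspan Lg x -> cspan Lg' (Psi x).
Proof.
have /unitaryP[lP _ _ nP] := hPsi; have cL := cspan_closed Lg'.
apply: (@cspan_min _ _ Lg [set x | cspan Lg' (Psi x)]).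
  split.
  - rewrite /= (lin_0 (subspaceT K) lP); exact: (sub_0 (closed_subspaceW cL)).
  - by move=> a y z hy hz; rewrite /= lP //; apply: (sub_L (closed_subspaceW cL)).
  - apply/closedP => z h; have [_ _ /closedP] := cL; apply => e /h[a ha za].
    by exists (Psi a) => //; rewrite -PB nP.
by move=> _ [n [h ->]]; apply: cspan_sub; exists n, (phi h); rewrite Psi_lam.
Qed.

Lemma iota_transport l : cspan Lg l -> eqT (iota' (Psi l)) (amp phi (iota l)).
Proof.
have /unitaryP[lP _ _ nP] := hPsi; have /unitaryP[lphi _ _ _] := hphi.
have [_ _ _ _ [ui hi _ _]] := hM; have [_ _ _ _ [ui' hi' _ _]] := hM'.
rewrite LE in ui; rewrite LE' in ui'.
have /unitaryP[_ uD _ _] := uDT.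
apply: (toL2_transport (cspan_closed _) (cspan_closed _) ui ui' _ (unitary_isometry hphi)
  _ (@cspan_sub _ _ Lg) (fun x => id)).
- apply/isometryP; split; [by move=> a x y _ _; rewrite lP|exact: Psi_bilateral|].
  by move=> x _; exact: nP.
- by move=> f; apply: (L2_amp (unitary_isometry hphi)).
- move=> _ [n [h ->]]; rewrite Psi_lam; apply: eqT_trans (hi' _ _) _.
  apply: aeT_imp (hi n h) => z hz.
  rewrite /amp hz (lin_Z (subspaceT H) lphi) //.
  by rewrite (defect_equiv hT hT' hphi phiT).
Qed.

(** The vectors P_R l with l in M(L) span a dense part of R: omega_NF maps R onto the closure of
    Delta L^2(D_T), and each Delta g is omega_NF P_R l for the l with iota l = g. On these vectors
    the claim reduces to the transport of iota and of Delta. *)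
Lemma omega_transport x : Res x -> eqT (omega' (Psi x)) (amp phi (omega x)).
Proof.
have [_ _ _ _ [ui hi uo ho]] := hM; have [_ _ _ _ [ui' hi' uo' ho']] := hM'.
have cR := residual_closed T J U; have sR := closed_subspaceW cR.
have [wl wS wo wn] := uo.
apply: (toL2_transport cR (residual_closed T' J' U') uo uo'
  (unitary_isometry Psi_unitary_residual) (unitary_isometry hphi) _
  (G := [set y | exists2 l, cspan Lg l & y = proj Res l])).
- exact: model_DeltaL2_amp.
- by move=> _ [l _ ->]; case: (projP cR l).
- move=> y ry; have [_ _ /closedP] := cspan_closed [set y | exists2 l, cspan Lg l & y = proj Res l].
  apply=> e e0; have [_ /(_ (e ^+ 2))] := wS _ ry.
  rewrite exprn_gt0 // => /(_ isT) [_ [g gL <-] hg].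
  have [_ _ io _] := ui; have [l] := io _ gL; rewrite LE => Ll lg.
  have [rp _] := projP cR l.
  exists (proj Res l); first by apply: cspan_sub; exists l.
  have h1 : eqT (omega (proj Res l)) (mulDelta DT DTs Th g).
    apply: (@eqT_trans _ _ (mulDelta DT DTs Th (iota l))).
      by apply: ho; rewrite LE.
    by apply: aeT_imp lg => z; rewrite /mulDelta => ->.
  rewrite -ltr_sqr ?nnegrE ?nrm_ge0 ?ltW // -lte_fin -wn; last exact: sub_B.
  apply: le_lt_trans hg; rewrite (L2sqnorm_eqT (toL2_B uo ry rp)).
  by apply: L2sqnorm_le_ae; apply: aeT_imp h1 => z ->.
move=> _ [l Ll ->]; rewrite Psi_proj.
have Ll' := Psi_bilateral Ll.
apply: (@eqT_trans _ _ (mulDelta DT' DTs' Th' (iota' (Psi l)))).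
  by apply: ho'; rewrite LE'.
apply: (@eqT_trans _ _ (mulDelta DT' DTs' Th' (amp phi (iota l)))).
  by apply: aeT_imp (iota_transport Ll) => z; rewrite /mulDelta => ->.
have hl : eqT (omega (proj Res l)) (mulDelta DT DTs Th (iota l)).
  by apply: ho; rewrite LE.
have iD : aeT (fun z => DT (iota l z)).
  have [_ iS _ _] := ui; have [] := iS l; first by rewrite LE.
  by [].
apply: eqT_trans (mulDelta_equiv cDT cDT' cDTs (unitary_isometry hphi) uDT
  (unitary_isometry hphi) uDTs Th_mem Th_bnd Th_eq iD) _.
by apply: aeT_imp hl => z; rewrite /amp => ->.
Qed.

(** * The residual part and the unitaries W_k *)

Section Residual.
Variables (S : H -> H) (S' : H' -> H').
Variables (RD RD' : hilbertType R) (v : H -> RD) (v' : H' -> RD').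
Variables (WD Wd : RD -> RD) (WD' Wd' : RD' -> RD') (omegaD : K -> RD) (omegaD' : K' -> RD').
Hypothesis hR : residual_model T S J U v WD Wd omegaD.
Hypothesis hR' : residual_model T' S' J' U' v' WD' Wd' omegaD'.

Let w := adjoint Res setT omegaD.
Let w' := adjoint Res' setT omegaD'.

(** The unitary between the spaces of W_D and W_D' that phi induces through the dilations; in the
    functional model it becomes [amp phi]. *)
Definition residual_map (x : RD) : RD' := omegaD' (Psi (w x)).

Let uw : unitary setT Res w.
Proof.
have [_ _ _ _ [_ uo _]] := hR.
exact: (unitary_inv (closed_subspaceW (residual_closed T J U)) uo).
Qed.

Let wK x : Res x -> w (omegaD x) = x.
Proof.
have [_ _ _ _ [_ uo _]] := hR.
by have [_ h _] := unitary_adjoint (closed_subspaceW (residual_closed T J U)) uo; exact: h.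
Qed.

Let wK' x : Res' x -> w' (omegaD' x) = x.
Proof.
have [_ _ _ _ [_ uo _]] := hR'.
by have [_ h _] := unitary_adjoint (closed_subspaceW (residual_closed T' J' U')) uo; exact: h.
Qed.

Lemma residual_map_unitary : unitary setT setT residual_map.
Proof.
have [_ _ _ _ [_ /unitaryP[lo oT oo no] _]] := hR'.
have /unitaryP[lw wR ow nw] := uw.
have /unitaryP[lP PR oP nP] := Psi_unitary_residual.
apply/unitaryP; split => //.
- move=> a x y _ _; rewrite /residual_map lw // lP; try exact: wR.
  by rewrite lo //; apply: PR; apply: wR.
- move=> y _; have [p rp <-] := oo y I; have [q rq <-] := oP _ rp.
  by have [x _ <-] := ow _ rq; exists x.
- by move=> x _; rewrite /residual_map no ?nP ?nw //; [apply: wR|apply: PR; apply: wR].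
Qed.

Lemma residual_map_gen n h : residual_map (iter n WD (v h)) = iter n WD' (v' (phi h)).
Proof.
have [_ hU _ _ _] := hM; have [_ hU' _ _ _] := hM'.
have [_ _ _ _ [_ _ E]] := hR; have [_ _ _ _ [_ _ E']] := hR'.
have [rp _] := projP (residual_closed T J U) (J h).
have [hJ _ _ _ _] := hM.
rewrite -E /residual_map wK; last exact: (residual_U hT hJ hU n rp).
by rewrite (Psi_zpow n) Psi_proj (PsiJ 0) -E'.
Qed.

Lemma residual_map_omega x : eqT (omega' (w' (residual_map x))) (amp phi (omega (w x))).
Proof.
have /unitaryP[_ wR _ _] := uw; have rw := wR x I.
rewrite /residual_map wK'; last by apply/Psi_residual.
exact: omega_transport.
Qed.

Let adj_Wd_iter n y : adj Wd (iter n WD y) = iter n WD (adj Wd y).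
Proof.
have [uD uW com _ _] := hR.
elim: n => //= n <-; rewrite -{2}(unitaryK uD (iter n WD y)) com.
by rewrite (unitaryVK uD).
Qed.

Let adj_Wd_iter' n y : adj Wd' (iter n WD' y) = iter n WD' (adj Wd' y).
Proof.
have [uD uW com _ _] := hR'.
elim: n => //= n <-; rewrite -{2}(unitaryK uD (iter n WD' y)) com.
by rewrite (unitaryVK uD).
Qed.

(** The adjoints are compared on the spanning vectors W_D^n v h: there Wd^* commutes with W_D^n and
    sends v h to v S^* h. Unitarity then turns the relation for adjoints into the one for Wd. *)
Lemma residual_map_Wd : (forall h, phi (adj S h) = adj S' (phi h)) ->
  forall x, residual_map (Wd x) = Wd' (residual_map x).
Proof.
move=> hS; have [uD uW _ hv [hspan _ _]] := hR; have [uD' uW' _ hv' _] := hR'.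
have /unitaryP[lm _ _ nm] := residual_map_unitary.
have /unitaryP[la _ _ na] := unitary_adj uW.
have /unitaryP[la' _ _ na'] := unitary_adj uW'.
have h x : residual_map (adj Wd x) = adj Wd' (residual_map x).
  have := @cspan_agree _ _ _ [set y | exists n h, y = iter n WD (v h)]
    (fun x => residual_map (adj Wd x)) (fun x => adj Wd' (residual_map x)).
  rewrite hspan; apply => //.
  - apply: isometric_bounded => [a y z _ _|y _]; first by rewrite la // lm.
    by rewrite nm // na.
  - apply: isometric_bounded => [a y z _ _|y _]; first by rewrite lm // la'.
    by rewrite na' // nm.
  - move=> _ [n [k ->]].
    by rewrite adj_Wd_iter hv !residual_map_gen adj_Wd_iter' hv' hS.
by move=> x; rewrite -{2}(unitaryK uW x) h (unitaryVK uW').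
Qed.

Lemma residual_map_Wd_inv : (forall x, residual_map (Wd x) = Wd' (residual_map x)) ->
  forall h, v' (phi (adj S h)) = v' (adj S' (phi h)).
Proof.
move=> hW h; have [uD uW _ hv _] := hR; have [uD' uW' _ hv' _] := hR'.
have g k : residual_map (v k) = v' (phi k) by exact: (residual_map_gen 0).
by rewrite -hv' -!g -hv -[LHS](unitaryK uW') -hW (unitaryVK uW).
Qed.

Variables (W : (R[i] -> H) -> R[i] -> H) (W' : (R[i] -> H') -> R[i] -> H').
Local Notation S0 := (DeltaL2 DT DTs Th).
Local Notation S0' := (DeltaL2 DT' DTs' Th').
Hypothesis hW : unitary_L2 S0 W.
Hypothesis hW' : unitary_L2 S0' W'.
Hypothesis hWu : forall x, eqT (W (omega (w x))) (omega (w (Wd x))).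
Hypothesis hWu' : forall x, eqT (W' (omega' (w' x))) (omega' (w' (Wd' x))).
Variable u : H -> H'.
Hypothesis hu : unitary DT DT' u.
Hypothesis hu_phi : forall x, DT x -> u x = phi x.

Let uadj := adjoint DT DT' u.

Let omega_mem x : S0 (omega (w x)).
Proof.
have [_ _ _ _ [_ _ [_ h _ _] _]] := hM; apply: h.
by have /unitaryP[_ wR _ _] := uw; apply: wR.
Qed.

Let omega_mem' x : Res' (w' x) /\ S0' (omega' (w' x)).
Proof.
have [_ _ _ _ [_ _ [_ h _ _] _]] := hM'; have [_ _ _ _ [_ uo _]] := hR'.
have [hw _ _] := unitary_adjoint (closed_subspaceW (residual_closed T' J' U')) uo.
by have rw : Res' (w' x) by [exact: hw]; split => //; apply: h.
Qed.

Let omega_DT x : aeT (fun z => DT (omega (w x) z)).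
Proof. exact: (DeltaL2_range cDT (omega_mem x)). Qed.

Let amp_u f : aeT (fun z => DT (f z)) -> eqT (amp u f) (amp phi f).
Proof. by apply: aeT_imp => z hz; rewrite /amp hu_phi. Qed.

Let amp_uadj x f : eqT f (amp phi (omega (w x))) -> eqT (amp uadj f) (omega (w x)).
Proof.
have [_ k _] := unitary_adjoint (closed_subspaceW cDT) hu.
apply: aeT_imp2 (omega_DT x) => z hz; rewrite /amp => ->.
by rewrite -hu_phi // /uadj k.
Qed.

Let amp_uadj_mem x f : eqT f (amp phi (omega (w x))) -> S0 (amp uadj f).
Proof.
by move=> /amp_uadj /eqT_sym h; apply: L2closure_eqT h (omega_mem x).
Qed.

Let S0_omega f : S0' f -> exists2 x, eqT f (amp phi (omega (w x))) &
  eqT f (omega' (w' (residual_map x))).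
Proof.
have [_ _ _ _ [_ _ [_ _ oo _] _]] := hM'; have [_ _ _ _ [_ uo _]] := hR'.
move=> /oo [y ry yf].
have /unitaryP[_ _ om _] := residual_map_unitary.
have [x _ xE] := om (omegaD' y) I.
have fE : eqT f (omega' (w' (residual_map x))).
  by rewrite xE wK' //; apply: eqT_sym.
by exists x => //; apply: eqT_trans fE (residual_map_omega x).
Qed.

(** u is known to agree with phi on D_T only; since functions in the closure of Delta L^2 take
    values in D_T almost everywhere, u and phi may be exchanged, and W acts through Wd by the
    definition of W_k. *)
Let W_chain x f : S0' f -> eqT f (amp phi (omega (w x))) ->
  eqT (amp u (W (amp uadj f))) (omega' (w' (residual_map (Wd x)))).
Proof.
have [Wc _ WS _ _] := hW.
move=> Sf fE; have h1 := amp_uadj fE; have Sg := amp_uadj_mem fE.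
have h2 := Wc _ _ Sg (omega_mem x) h1.
have h3 : eqT (W (amp uadj f)) (omega (w (Wd x))) by apply: eqT_trans h2 (hWu x).
apply: eqT_trans (eqT_sym (residual_map_omega (Wd x))).
apply: eqT_trans (amp_u (omega_DT (Wd x))).
by apply: aeT_imp h3 => z; rewrite /amp => ->.
Qed.

Lemma W_transport : (forall h, phi (adj S h) = adj S' (phi h)) ->
  forall f, S0' f -> eqT (W' f) (amp u (W (amp uadj f))).
Proof.
move=> hS f Sf; have [x fE fE'] := S0_omega Sf; have [Wc' _ _ _ _] := hW'.
have h1 := Wc' _ _ Sf (omega_mem' (residual_map x)).2 fE'.
apply: eqT_trans h1 _; apply: eqT_trans (hWu' _) _.
by rewrite -residual_map_Wd //; apply: eqT_sym; apply: W_chain.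
Qed.

(** Injectivity of omega_NF' carries the equality from L^2 back to a commutation of [residual_map]
    with Wd and Wd', which is then evaluated at the vectors v h. *)
Lemma W_transport_inv : (forall f, S0' f -> eqT (W' f) (amp u (W (amp uadj f)))) ->
  forall h, v' (phi (adj S h)) = v' (adj S' (phi h)).
Proof.
move=> hf; apply: residual_map_Wd_inv => x.
have [_ _ _ _ [_ _ uo' _]] := hM'; have [_ _ _ _ [_ uoD _]] := hR'.
have [_ _ k3] := unitary_adjoint (closed_subspaceW (residual_closed T' J' U')) uoD.
have [Res1 Sf] := omega_mem' (residual_map x).
have h1 := hf _ Sf.
have h2 := W_chain Sf (residual_map_omega x).
have h3 := hWu' (residual_map x).
have h4 : eqT (omega' (w' (residual_map (Wd x)))) (omega' (w' (Wd' (residual_map x)))).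
  by apply: eqT_trans (eqT_sym h2) _; apply: eqT_trans (eqT_sym h1) h3.
have := toL2_inj (closed_subspaceW (residual_closed T' J' U')) uo'
  (omega_mem' _).1 (omega_mem' _).1 h4.
by move=> /(congr1 omegaD'); rewrite /w' !k3.
Qed.

End Residual.
End ModelTransport.

(** omega_D is injective on R and sends P_R J h to v h, so v a = v b forces P_R J (a - b) = 0. *)
Lemma residual_model_null (R : realType) (H K RD : hilbertType R) (T S : H -> H)
    (J : H -> K) (U : K -> K) (v : H -> RD) (WD Wd : RD -> RD) (omegaD : K -> RD) :
  contraction setT setT T -> isometry setT setT J -> unitary setT setT U ->
  (forall n h, proj (range J) (iter n U (J h)) = J (iter n T h)) ->
  residual_model T S J U v WD Wd omegaD ->
  forall a b, v a = v b -> forall e : R, 0 < e ->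
    exists N, forall n, (N <= n)%N -> nrm (iter n (adj T) (a - b)) < e.
Proof.
move=> cT hJ hU hd [_ _ _ _ [_ uo E]] a b ab.
apply: (residual_null cT hJ hU hd).
have cR := residual_closed T J U; have sR := closed_subspaceW cR.
have [_ k _] := unitary_adjoint sR uo.
have [ra ha] := projP cR (J a); have [rb hb] := projP cR (J b).
have pab : proj (residual T J U) (J a) = proj (residual T J U) (J b).
  by rewrite -(k _ ra) -(k _ rb) (E 0%N) (E 0%N) /= ab.
have [lJ _ _] := hJ; apply: (proj_eq sR); first exact: sub_0.
move=> y ry; rewrite subr0 (lin_B (subspaceT H) lJ) //.
have -> : J a - J b = (J a - proj (residual T J U) (J a)) -
    (J b - proj (residual T J U) (J b)).
  by rewrite pab opprB addrA subrK.
by rewrite innerBl ha // hb // subrr.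
Qed.

(** * Intrinsic form of the characteristic triple *)

Section IntrinsicForm.
Variables (R : realType) (H : hilbertType R) (T1 T2 : H -> H).
Hypothesis hT12 : commuting_contractions T1 T2.

Local Notation T := (T1 \o T2).

Lemma product_contraction : contraction setT setT T.
Proof. by have [c1 c2 _] := hT12; exact: contraction_comp. Qed.

Lemma adj_product12 h : adj T2 (adj T1 h) = adj T h.
Proof. by have [c1 c2 _] := hT12; rewrite adj_comp. Qed.

Lemma adj_product21 h : adj T1 (adj T2 h) = adj T h.
Proof.
have [c1 c2 com] := hT12; rewrite -adj_comp //; congr (adj _ h).
by apply/funext => x; rewrite /= com.
Qed.

Lemma psqrt_linear (f : H -> H) : linear_on setT (psqrt setT f).
Proof.
rewrite /psqrt; case: xgetP => [g _ [[/boundedP[lg _ _] _] _] //|_ a x y _ _].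
by rewrite scaler0 addr0.
Qed.

(** Composing the inclusion j with Q puts the data on H itself. The vectors W_D^n Q h still span,
    because Ran Q is dense in its closure and W_D^n is isometric. *)
Lemma char_unitaries_model Th W1 W2 : char_unitaries T1 T2 Th W1 W2 ->
  exists (K RD : hilbertType R) (J : H -> K) (U : K -> K)
    (iota omega : K -> R[i] -> H) (v : H -> RD) (WD Wd1 Wd2 : RD -> RD)
    (omegaD : K -> RD),
    [/\ nf_model T Th J U iota omega,
        residual_model T T1 J U v WD Wd1 omegaD,
        residual_model T T2 J U v WD Wd2 omegaD &
        let u x := omega (adjoint (residual T J U) setT omegaD x) in
        (forall x, eqT (W1 (u x)) (u (Wd1 x))) /\
        (forall x, eqT (W2 (u x)) (u (Wd2 x)))].
Proof.
move=> [RD [j [X1s [X2s [WD [Wd1 [Wd2 [K [J [U [iota [omegaD [omega]]]]]]]]]]]]].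
move=> [[[iX1 iX2 hX1 hX2] ij [uD hWD spanD] [u1 u2 com] [h1 h2 h12]]].
move=> [iJ uU dil mn] [ui hi] [uo ho un hn] [e1 e2].
pose Q := Qop T1 T2; pose v h := j (Q h).
have Qc h : closure (range Q) (Q h).
  by apply: subset_closure; exists h.
have sQ : subspace (closure (range Q)).
  apply/closed_subspaceW/closure_subspace.
  exact: (linear_image_subspace (subspaceT H) (@psqrt_linear _)).
have span : cspan [set y | exists n h, y = iter n WD (v h)] = setT.
  apply/seteqP; split => // x _; set G := [set y | _].
  have cG := cspan_closed G.
  have : setT x by []; rewrite -spanD; apply: (@cspan_min _ _ _ (cspan G)) => //.
  move=> _ [n [q [Qq ->]]]; have [_ _ /closedP] := cG; apply => e.
  move: (Qq) => /closureP h /h [_ [k _ <-] hk].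
  exists (iter n WD (v k)); first by apply: cspan_sub; exists n, k.
  have /isometryP[lj _ nj] := ij; have /unitaryP[_ _ _ nn] := unitary_iter uD n.
  rewrite -(iterB uD) nn // -(lin_B sQ lj) ?nj //; try exact: Qc.
  by apply: (sub_B sQ) => //; exact: Qc.
exists K, RD, J, U, iota, omega, v, WD, Wd1, Wd2, omegaD; split.
- by split.
- split; [exact: uD|exact: u1| | |split; [exact: span|exact: uo|exact: ho]].
  + by move=> y; rewrite -!h12 com.
  + by move=> h; rewrite /v h1 // hX1.
- split; [exact: uD|exact: u2| | |split; [exact: span|exact: uo|exact: ho]].
  + by move=> y; rewrite -!h12 !com.
  + by move=> h; rewrite /v h2 // hX2.
- by split.
Qed.

(** iota preserves norms and sends (U - T) h, of squared norm |h|^2 - |T h|^2, to the constant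
    function D_T h. Any characteristic triple thus supplies the identity from which [defectP]
    starts. *)
Lemma nf_model_defect Th (K : hilbertType R) (J : H -> K) U iota omega :
  nf_model T Th J U iota omega ->
  forall h, nrm (defect T h) ^+ 2 = nrm h ^+ 2 - nrm (T h) ^+ 2.
Proof.
have hT := product_contraction.
move=> [hJ hU hd _ [ui hi _ _]] h; have [_ _ _ wn] := ui.
have hl : bilateral U (closure (range (lam T J U))) (lam T J U h).
  rewrite (wanderingL hT hJ hU) (bilateralE hU).
  by apply: cspan_sub; exists 0, h.
have := wn _ hl; have /L2sqnorm_eqT := hi 0 h; rewrite zpow0 => ->.
rewrite (_ : (fun z => z ^ 0 *: defect T h) = fun=> defect T h); last first.
  by apply/funext => z; rewrite expr0z scale1r.
rewrite L2sqnorm_const => -[] ->; apply: complexI.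
by rewrite -inner_nrm (lam_inner hJ hU hd) !inner_nrm -rmorphB.
Qed.

(** * Wandering vectors of the Ando dilation and the operators G_k *)

Section Ando.
Variables (K : hilbertType R) (J : H -> K).
Hypothesis hJ : isometry setT setT J.

Let Jlin : linear_on setT J. Proof. by case: hJ. Qed.
Let Jdot x y : inner (J x) (J y) = inner x y. Proof. exact: isometryT_inner. Qed.

Lemma wandering_vector_inner (V : K -> K) (A : H -> H) : isometry setT setT V ->
  (forall h, adj V (J h) = J (adj A h)) -> forall h k,
  inner (J h - V (J (adj A h))) (J k - V (J (adj A k))) =
  inner h k - inner (adj A h) (adj A k).
Proof.
move=> iV hV h k.
have VA x y : inner (V x) y = inner x (adj V y).
  exact: (contraction_adjP (isometry_contraction iV)).
rewrite innerBl !innerBr (isometryT_inner iV) !VA !hV !Jdot.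
rewrite (innerC (J h)) VA hV Jdot -innerC.
ring.
Qed.

Lemma wandering_vector_linear (V : K -> K) (A : H -> H) : isometry setT setT V ->
  contraction setT setT A -> linear_on setT (fun h => J h - V (J (adj A h))).
Proof.
move=> [lV _ _] /contraction_adj[lA _ _] a x y _ _.
by rewrite lA // !Jlin // lV // scalerBr opprD addrACA.
Qed.

Lemma wandering_closed (V : K -> K) (A : H -> H) : isometry setT setT V ->
  contraction setT setT A -> closed_subspace (wandering J V A).
Proof.
move=> iV cA; apply: closure_subspace.
exact: (linear_image_subspace (subspaceT H) (wandering_vector_linear iV cA)).
Qed.

Lemma wandering_mem (V : K -> K) (A : H -> H) h : wandering J V A (J h - V (J (adj A h))).
Proof. by apply: subset_closure; exists h. Qed.

End Ando.

(** On the generators Lambda and U are explicit. For G_1 only the L_{2*} components survive, leaving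
    <T_1^* h, k> - <T_2^* T_1^* h, T_2^* k>; for G_2 only the L_{1*} components. The norm identity
    for D_{T^*} comes from iota_* being isometric. *)
Lemma char_contractions_spec G1 G2 : char_contractions T1 T2 G1 G2 ->
  [/\ forall h, nrm (defect (adj T) h) ^+ 2 = nrm h ^+ 2 - nrm (adj T h) ^+ 2,
      forall h k, inner (G1 (defect (adj T) h)) (defect (adj T) k) =
                  inner (adj T1 h - T2 (adj T h)) k &
      forall h k, inner (G2 (defect (adj T) h)) (defect (adj T) k) =
                  inner (adj T2 h - T1 (adj T h)) k].
Proof.
have [c1 c2 com] := hT12; have cT := product_contraction.
move=> [K [F [J [V1 [V2 [iota [e1 [e2 [N [Lambda [U]]]]]]]]]]].
move=> [[iJ [iV1 iV2] _ hV1 hV2] [uiota hiota] [ie1 ie2 _ [ort _ _] _] _].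
move=> [iL hL [uU hU] hG1 hG2].
pose V := V1 \o V2.
have iV : isometry setT setT V.
  have /isometryP[l1 _ n1] := iV1; have /isometryP[l2 _ n2] := iV2.
  apply/isometryP; split => //; first by move=> a x y _ _; rewrite /V /= l2 // l1.
  by move=> x _; rewrite /V /= n1 // n2.
have hV h : adj V (J h) = J (adj T h).
  rewrite /V (adj_comp (isometry_contraction iV1) (isometry_contraction iV2)).
  by rewrite hV1 hV2 adj_product12.
pose IV h := J h - V (J (adj T h)).
pose I1 h := J h - V1 (J (adj T1 h)).
pose I2 h := J h - V2 (J (adj T2 h)).
have cLs := wandering_closed iJ iV cT; have sLs := closed_subspaceW cLs.
have cL1 := wandering_closed iJ iV1 c1; have sL1 := closed_subspaceW cL1.
have cL2 := wandering_closed iJ iV2 c2.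
have mV h : wandering J V T (IV h) by exact: wandering_mem.
have m1 h : wandering J V1 T1 (I1 h) by exact: wandering_mem.
have m2 h : wandering J V2 T2 (I2 h) by exact: wandering_mem.
have /unitaryP[li iD _ ni] := uiota.
have iota_dot x y : wandering J V T x -> wandering J V T y ->
    inner (iota x) (iota y) = inner x y by exact: (iso_inner sLs li ni).
have [_ iotaK _] := unitary_adjoint sLs uiota.
have [Lm La] := adjointP cLs (contraction_bounded (isometry_contraction iL)).
have DsE h : defect (adj T) h = iota (IV h) by rewrite -hiota.
have DsD h : defect_space (adj T) (defect (adj T) h).
  by rewrite DsE; apply: iD.
have e1_dot := isometry_inner sL1 ie1.
have e2_dot := isometry_inner (closed_subspaceW cL2) ie2.
have o12' a b : inner (e1 (I1 a)) (e2 (I2 b)) = 0.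
  by apply: ort; [exists (I1 a)|exists (I2 b)].
have PE a b : proj (e1 @` wandering J V1 T1) (e1 (I1 a) + e2 (I2 b)) = e1 (I1 a).
  have [le1 _ _] := ie1.
  apply: proj_eq; first exact: linear_image_subspace le1.
    by exists (I1 a).
  move=> x xL; rewrite addrAC subrr add0r; apply: inner_eq0C; apply: ort => //.
  by exists (I2 b).
have fin y k : inner (iota (adjoint (wandering J V T) setT Lambda y)) (iota (IV k)) =
    inner y (e1 (I1 (adj T2 k)) + e2 (I2 k)).
  rewrite iota_dot //; last exact: Lm.
  by rewrite innerC -La // -hL -innerC.
split.
- move=> h; rewrite DsE ni //; apply: complexI.
  by rewrite -inner_nrm (wandering_vector_inner iJ iV hV) !inner_nrm -rmorphB.
- move=> h k; rewrite hG1 // (DsE h) iotaK // hL hU PE addrAC subrr add0r (DsE k) fin.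
  rewrite -/(I2 (adj T1 h)) innerDr (inner_eq0C (o12' _ _)) add0r e2_dot //.
  rewrite (wandering_vector_inner iJ iV2 hV2) adj_product12 innerBl.
  by rewrite (contraction_adjP c2).
- move=> h k; rewrite hG2 // (DsE h) iotaK // hL PE (DsE k) fin.
  rewrite innerC -(unitary_adj_inner uU) hU -innerC -/(I1 k) -/(I2 (adj T1 k)).
  rewrite innerDr o12' addr0 e1_dot //.
  rewrite (wandering_vector_inner iJ iV1 hV1) adj_product21 innerBl.
  by rewrite (contraction_adjP c1).
Qed.

End IntrinsicForm.

(** * The intertwining unitary *)

Section DilationOrthogonality.
Variables (R : realType) (H K : hilbertType R) (T : H -> H) (J : H -> K) (U : K -> K).
Hypothesis hT : contraction setT setT T.
Hypotheses (hJ : isometry setT setT J) (hU : unitary setT setT U).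
Hypothesis hd : forall n h, proj (range J) (iter n U (J h)) = J (iter n T h).

Lemma J_ortho_cspan_lam (n : nat) h b : cspan (range (lam T J U)) b ->
  inner (J h) (zpow U n b) = 0.
Proof.
move=> hb; rewrite -(zpow0 U (J h)) (zpow_shift hU); apply: cspan_ortho hb.
by move=> _ [k _ <-]; rewrite -(zpow_shift hU); apply: (J_ortho_lam hJ hU hd).
Qed.

Lemma J_ortho_cspan_lams (n : nat) h b : cspan (range (lams T J U)) b ->
  inner (J h) (zpow U (Negz n) b) = 0.
Proof.
move=> hb; rewrite -(zpow0 U (J h)) (zpow_shift hU); apply: cspan_ortho hb.
by move=> _ [k _ <-]; rewrite -(zpow_shift hU); apply: (J_ortho_lams hT hJ hU hd).
Qed.

End DilationOrthogonality.

Section ModelUnitary.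
Variables (R : realType) (H H' : hilbertType R) (T : H -> H) (T' : H' -> H').
Hypotheses (hT : contraction setT setT T) (hT' : contraction setT setT T').
Hypothesis hD : forall h, nrm (defect T h) ^+ 2 = nrm h ^+ 2 - nrm (T h) ^+ 2.
Hypothesis hDs : forall h, nrm (defect (adj T) h) ^+ 2 = nrm h ^+ 2 - nrm (adj T h) ^+ 2.
Hypothesis hD' : forall h, nrm (defect T' h) ^+ 2 = nrm h ^+ 2 - nrm (T' h) ^+ 2.
Hypothesis hDs' : forall h, nrm (defect (adj T') h) ^+ 2 = nrm h ^+ 2 - nrm (adj T' h) ^+ 2.
Hypotheses (hcnu : cnu T) (hcnu' : cnu T').
Variables (u us : H -> H').
Local Notation DT := (defect_space T).
Local Notation DTs := (defect_space (adj T)).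
Local Notation DT' := (defect_space T').
Local Notation DTs' := (defect_space (adj T')).
Hypothesis hu : unitary DT DT' u.
Hypothesis hus : unitary DTs DTs' us.
Hypothesis coef : forall d x, DT x -> us (char_coef T d x) = char_coef T' d (u x).
Variables (K K' : hilbertType R) (J : H -> K) (U : K -> K) (J' : H' -> K') (U' : K' -> K').
Hypotheses (hJ : isometry setT setT J) (hU : unitary setT setT U).
Hypothesis hd : forall n h, proj (range J) (iter n U (J h)) = J (iter n T h).
Hypothesis hm : cspan [set x | exists n h, x = zpow U n (J h)] = setT.
Hypotheses (hJ' : isometry setT setT J') (hU' : unitary setT setT U').
Hypothesis hd' : forall n h, proj (range J') (iter n U' (J' h)) = J' (iter n T' h).
Hypothesis hm' : cspan [set x | exists n h, x = zpow U' n (J' h)] = setT.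

Let hTs := contraction_adj hT.
Let hTs' := contraction_adj hT'.

(** By [dil_range_char], J H is the set of vectors orthogonal to all U^n L and U^(-n-1) L_* with n
    >= 0. The unitary Psi between the dilation spaces matches these subspaces with their primed
    versions, so it carries J H onto J' H', and phi is its restriction. *)
Lemma model_unitary : exists phi : H -> H',
  [/\ unitary setT setT phi, forall x, phi (T x) = T' (phi x),
      forall x, DT x -> u x = phi x & forall x, DTs x -> us x = phi x].
Proof.
have cD := defect_space_closed hT hD; have sD := closed_subspaceW cD.
have cDs := defect_space_closed hTs hDs; have sDs := closed_subspaceW cDs.
have cD' := defect_space_closed hT' hD'; have sD' := closed_subspaceW cD'.
have cDs' := defect_space_closed hTs' hDs'; have sDs' := closed_subspaceW cDs'.
have [L uL LD] := lam_extension hT hD hJ hU hd.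
have [Ls uLs LsD] := lams_extension hT hDs hJ hU hd.
have [L' uL' LD'] := lam_extension hT' hD' hJ' hU' hd'.
have [Ls' uLs' LsD'] := lams_extension hT' hDs' hJ' hU' hd'.
have /unitaryP[lu uD uo nu] := hu; have /unitaryP[lus usD uso nus] := hus.
have /unitaryP[_ LL _ _] := uL; have /unitaryP[_ LLs _ _] := uLs.
have /unitaryP[_ LL' _ _] := uL'; have /unitaryP[_ LLs' _ _] := uLs'.
(* Indices pair a power of U with a vector of D_T or of D_{T^*}, so that one family covers all the
   U^n L and U^n L_*. *)
pose I := ((int * {x : H | DT x}) + (int * {x : H | DTs x}))%type.
pose x (i : I) : K := match i with
  | inl (n, a) => zpow U n (L (sval a)) | inr (n, b) => zpow U n (Ls (sval b)) end.
pose y (i : I) : K' := match i with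
  | inl (n, a) => zpow U' n (L' (u (sval a)))
  | inr (n, b) => zpow U' n (Ls' (us (sval b))) end.
have cross n m a b : DT a -> DTs b ->
    inner (zpow U n (L a)) (zpow U m (Ls b)) =
    inner (zpow U' n (L' (u a))) (zpow U' m (Ls' (us b))).
  move=> Da Db; rewrite (cross_gram_ext hT hD hDs hJ hU hd uL LD uLs LsD) //.
  rewrite (cross_gram_ext hT' hD' hDs' hJ' hU' hd' uL' LD' uLs' LsD'); last 2 first.
  - exact: uD.
  - exact: usD.
  rewrite -coef // (iso_inner sDs lus nus) //; exact: (char_coef_mem hT hD hDs).
have [|Psi uP PE] := @isometric_extension _ _ _ _ x y.
  move=> [[n [a Da]]|[n [a Da]]] [[m [b Db]]|[m [b Db]]]; rewrite /x /y /=.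
  - rewrite (lam_gram_ext hT hD hJ hU hd uL) //.
    rewrite (lam_gram_ext hT' hD' hJ' hU' hd' uL' _ _ (uD _ Da) (uD _ Db)).
    by rewrite (iso_inner sD lu nu).
  - exact: cross.
  - by rewrite innerC cross // -innerC.
  - rewrite (lams_gram_ext hT hDs hJ hU hd uLs) //.
    rewrite (lams_gram_ext hT' hDs' hJ' hU' hd' uLs' _ _ (usD _ Da) (usD _ Db)).
    by rewrite (iso_inner sDs lus nus).
have PL n a : DT a -> Psi (zpow U n (L a)) = zpow U' n (L' (u a)).
  by move=> Da; exact: (PE (inl (n, exist _ a Da))).
have PLs n a : DTs a -> Psi (zpow U n (Ls a)) = zpow U' n (Ls' (us a)).
  by move=> Da; exact: (PE (inr (n, exist _ a Da))).
have dD := defect_mem hT hD; have dDs := defect_mem hTs hDs.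
have dD' := defect_mem hT' hD'; have dDs' := defect_mem hTs' hDs'.
have sx : cspan (range x) = setT.
  apply/seteqP; split => // z _; have : setT z by [].
  rewrite -(dil_total hT hJ hU hd hm hcnu).
  apply: (cspan_min (cspan_closed _)) => _ [[n [h ->]]|[n [h ->]]].
    by apply: cspan_sub; exists (inl (n, exist _ _ (dD h))); rewrite //= LD.
  by apply: cspan_sub; exists (inr (n, exist _ _ (dDs h))); rewrite //= LsD.
have sy : cspan (range y) = setT.
  apply/seteqP; split => // z _; have : setT z by [].
  rewrite -(dil_total hT' hJ' hU' hd' hm' hcnu').
  apply: (cspan_min (cspan_closed _)) => _ [[n [h ->]]|[n [h ->]]].
    have [a Da ua] := uo _ (dD' h).
    by apply: cspan_sub; exists (inl (n, exist _ _ Da)); rewrite //= ua LD'.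
  have [a Da ua] := uso _ (dDs' h).
  by apply: cspan_sub; exists (inr (n, exist _ _ Da)); rewrite //= ua LsD'.
rewrite sx sy in uP; have /unitaryP[lP _ oP nP] := uP.
have P_dot a b : inner (Psi a) (Psi b) = inner a b.
  exact: (isometryT_inner (unitary_isometry uP)).
have PU z : Psi (U z) = U' (Psi z).
  have /unitaryP[lU _ _ nU] := hU; have /unitaryP[lU' _ _ nU'] := hU'.
  have := @cspan_agree _ _ _ (range x) (fun z => Psi (U z)) (fun z => U' (Psi z)).
  rewrite sx; apply => //.
  - by apply: isometric_bounded => [a b c _ _|b _]; rewrite ?lU ?lP // nP // nU.
  - by apply: isometric_bounded => [a b c _ _|b _]; rewrite ?lP ?lU' // nU' // nP.
  - move=> _ [[[n [a Da]]|[n [a Da]]] _ <-]; rewrite /x /=.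
      by rewrite -(zpow_add1 hU) PL // PL // (zpow_add1 hU').
    by rewrite -(zpow_add1 hU) PLs // PLs // (zpow_add1 hU').
have PJ h : exists k, J' k = Psi (J h).
  suff [k _ E] : range J' (Psi (J h)) by exists k.
  apply: (dil_range_char hT' hJ' hU' hd' hm') => n k.
    have [a Da ua] := uo _ (dD' k); rewrite -LD' -ua -zpow_nat -PL // P_dot.
    by apply: (J_ortho_cspan_lam hJ hU hd); apply: LL.
  have [a Da ua] := uso _ (dDs' k); rewrite -LsD' -ua -PLs // P_dot.
  by apply: (J_ortho_cspan_lams hT hJ hU hd); apply: LLs.
have PJ' k : exists h, J' k = Psi (J h).
  have [z _ zE] := oP (J' k) Logic.I.
  suff [h _ E] : range J z by exists h; rewrite E zE.
  apply: (dil_range_char hT hJ hU hd hm) => n h.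
    rewrite -LD -zpow_nat -P_dot PL // zE.
    by apply: (J_ortho_cspan_lam hJ' hU' hd'); exact: LL' (uD _ (dD h)).
  rewrite -LsD -P_dot PLs // zE.
  by apply: (J_ortho_cspan_lams hT' hJ' hU' hd'); exact: LLs' (usD _ (dDs h)).
have /choice[phi phiE] := PJ.
have /isometryP[lJ _ nJ] := hJ; have /isometryP[lJ' _ nJ'] := hJ'.
have J'inj a b : J' a = J' b -> a = b by exact: (isometry_inj (subspaceT H') hJ').
have uphi : unitary setT setT phi.
  apply/unitaryP; split => //.
  - by move=> a b c _ _; apply: J'inj; rewrite lJ' // !phiE lJ // lP.
  - move=> k _; have [h hE] := PJ' k; exists h => //.
    by apply: J'inj; rewrite phiE.
  - by move=> h _; rewrite -nJ' // phiE nP // nJ.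
(* T and T' are the compressions of U and U', and Psi intertwines U with U' and maps J H onto J'
   H'. *)
have phiT h : phi (T h) = T' (phi h).
  apply: J'inj; rewrite -(hd' 1) phiE /= phiE -PU; apply/esym.
  apply: (proj_eq (closed_subspaceW (isometry_range_closed hJ'))).
    by exists (phi (T h)) => //; rewrite phiE.
  move=> _ [k _ <-]; have [g ->] := PJ' k.
  rewrite -(lin_B (subspaceT K) lP) // P_dot innerBl (dil_inner hJ hd 1).
  by rewrite (isometryT_inner hJ) subrr.
have phiTs h : phi (adj T h) = adj T' (phi h) by exact: unitary_adj_intertwine.
have P_lam h : Psi (lam T J U h) = lam T' J' U' (phi h).
  by rewrite /lam (lin_B (subspaceT K) lP) // PU -!phiE phiT.
have P_lams h : Psi (lams T J U h) = lams T' J' U' (phi h).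
  by rewrite /lams (lin_B (subspaceT K) lP) // PU -!phiE phiTs.
have /unitaryP[lphi _ _ nphi] := uphi.
exists phi; split => //.
- move=> z; rewrite (defect_space_cspan hT hD); apply: cspan_agree.
  + by rewrite -(defect_space_cspan hT hD); exact: isometric_bounded.
  + by apply: isometric_bounded => [a b c _ _|b _]; [rewrite lphi|rewrite nphi].
  (* L' is injective, so u D_T h = D_{T'} phi h may be checked in the wandering subspace, where both
     sides become lam (phi h) for T'. *)
  + move=> _ [h _ <-]; rewrite (defect_equiv hT hT' uphi phiT).
    apply: (isometry_inj sD' (unitary_isometry uL')); [exact: uD|exact: dD'|].
    by rewrite LD' -P_lam -LD (PL 0).
- move=> z; rewrite (defect_space_cspan hTs hDs); apply: cspan_agree.
  + by rewrite -(defect_space_cspan hTs hDs); exact: isometric_bounded.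
  + by apply: isometric_bounded => [a b c _ _|b _]; [rewrite lphi|rewrite nphi].
  + move=> _ [h _ <-]; rewrite (defect_equiv hTs hTs' uphi phiTs).
    apply: (isometry_inj sDs' (unitary_isometry uLs')); [exact: usD|exact: dDs'|].
    by rewrite LsD' -P_lams -LsD (PLs 0).
Qed.

End ModelUnitary.

(* A := phi T1^* - T1'^* phi satisfies <A h, phi k> = <A T^* h, phi T^* k>, hence
   <A h, phi k> = <T'^*n A h, phi T^*n k> -> 0. *)
Lemma intertwine_of_null (R : realType) (H H' : hilbertType R)
    (T T1 T2 : H -> H) (T' T1' T2' : H' -> H') (phi : H -> H') :
  contraction setT setT T -> contraction setT setT T' ->
  contraction setT setT T1 -> contraction setT setT T2 ->
  contraction setT setT T1' -> contraction setT setT T2' ->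
  unitary setT setT phi ->
  (forall h, phi (adj T h) = adj T' (phi h)) ->
  (forall h, adj T1 (adj T h) = adj T (adj T1 h)) ->
  (forall h, adj T1' (adj T' h) = adj T' (adj T1' h)) ->
  (forall h, phi (adj T1 h - T2 (adj T h)) = adj T1' (phi h) - T2' (adj T' (phi h))) ->
  (forall h, phi (adj T2 h - T1 (adj T h)) = adj T2' (phi h) - T1' (adj T' (phi h))) ->
  (forall h (e : R), 0 < e -> exists N, forall n, (N <= n)%N ->
     nrm (iter n (adj T') (phi (adj T1 h) - adj T1' (phi h))) < e) ->
  forall h, phi (adj T1 h) = adj T1' (phi h).
Proof.
move=> cT cT' c1 c2 c1' c2' uphi phiTs com com' A1 A2 null.
have /unitaryP[lphi _ ophi nphi] := uphi.
have phiB a b : phi (a - b) = phi a - phi b by rewrite (lin_B (subspaceT H) lphi).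
have phi_dot a b : inner (phi a) (phi b) = inner a b.
  exact: (isometryT_inner (unitary_isometry uphi)).
have [lTs' _ _] := contraction_adj cT'.
have nTs : forall n k, nrm (iter n (adj T) k) <= nrm k.
  by move=> n k; have /contractionP[_ _ h] := iter_contraction cT n; apply: h.
pose a h := phi (adj T1 h) - adj T1' (phi h).
pose b h := phi (adj T2 h) - adj T2' (phi h).
have aE h : a h = phi (T2 (adj T h)) - T2' (phi (adj T h)).
  have := A1 h; rewrite phiB -phiTs => /eqP; rewrite subr_eq => /eqP E.
  by rewrite /a E addrAC (addrAC (adj T1' _)) subrr sub0r addrC.
have bE h : b h = phi (T1 (adj T h)) - T1' (phi (adj T h)).
  have := A2 h; rewrite phiB -phiTs => /eqP; rewrite subr_eq => /eqP E.
  by rewrite /b E addrAC (addrAC (adj T2' _)) subrr sub0r addrC.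
(* Each swap trades one defect of intertwining for the other: <a h, phi k> = <phi T^* h, b k> = <a
   T^* h, phi T^* k>. *)
have swap2 p q : inner (phi (T2 p) - T2' (phi p)) (phi q) = inner (phi p) (b q).
  rewrite innerBl phi_dot (contraction_adjP c2) (contraction_adjP c2') /b.
  by rewrite innerBr phi_dot.
have swap1 p q : inner (phi (T1 p) - T1' (phi p)) (phi q) = inner (phi p) (a q).
  rewrite innerBl phi_dot (contraction_adjP c1) (contraction_adjP c1') /a.
  by rewrite innerBr phi_dot.
have key h k : inner (a h) (phi k) = inner (a (adj T h)) (phi (adj T k)).
  by rewrite aE swap2 bE innerC swap1 -innerC.
have aT h : a (adj T h) = adj T' (a h).
  by rewrite /a com phiTs (lin_B (subspaceT H') lTs') // -com' phiTs.
have keyn n h k : inner (a h) (phi k) =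
    inner (iter n (adj T') (a h)) (phi (iter n (adj T) k)).
  elim: n h k => [|n ih] h k //.
  by rewrite key ih aT -!iterSr.
move=> h; apply/eqP; rewrite -subr_eq0 -/(a h); apply/eqP.
apply: (inner_eq_sub (subspaceT H')) => // y _; rewrite inner0l.
have [k _ <-] := ophi y I; apply: cabs_eq0; apply: (@eps0 _ _ (nrm k)) => [|e e0].
  exact: cabs_ge0.
have [N hN] := null h e e0; rewrite (keyn N).
apply: le_trans (cabs_inner_le _ _) _; apply: ler_pM; rewrite ?nrm_ge0 //.
  by apply: ltW; apply: hN.
by rewrite nphi // nTs.
Qed.

(** * Coincidence of characteristic triples *)

Section DefectOperators.
Variables (R : realType) (H H' : hilbertType R) (T : H -> H) (T' : H' -> H').
Variables (phi us : H -> H').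
Hypotheses (hT : contraction setT setT T) (hT' : contraction setT setT T').
Hypothesis hDs : forall h, nrm (defect (adj T) h) ^+ 2 = nrm h ^+ 2 - nrm (adj T h) ^+ 2.
Hypothesis hDs' : forall h, nrm (defect (adj T') h) ^+ 2 = nrm h ^+ 2 - nrm (adj T' h) ^+ 2.
Hypothesis hphi : unitary setT setT phi.
Hypothesis phiT : forall x, phi (T x) = T' (phi x).
Local Notation DTs := (defect_space (adj T)).
Local Notation DTs' := (defect_space (adj T')).
Hypothesis hus : unitary DTs DTs' us.
Hypothesis us_phi : forall x, DTs x -> us x = phi x.
Variables (G A : H -> H) (G' A' : H' -> H').
Hypotheses (hG : contraction DTs DTs G) (hG' : contraction DTs' DTs' G').
Hypothesis GA : forall h k,
  inner (G (defect (adj T) h)) (defect (adj T) k) = inner (A h) k.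
Hypothesis GA' : forall h k,
  inner (G' (defect (adj T') h)) (defect (adj T') k) = inner (A' h) k.

Let hTs := contraction_adj hT.
Let hTs' := contraction_adj hT'.
Let sDs := closed_subspaceW (defect_space_closed hTs hDs).
Let sDs' := closed_subspaceW (defect_space_closed hTs' hDs').
Let phiTs x : phi (adj T x) = adj T' (phi x).
Proof. exact: unitary_adj_intertwine. Qed.
Let us_defect h : us (defect (adj T) h) = defect (adj T') (phi h).
Proof. by rewrite us_phi ?(defect_equiv hTs hTs') //; exact: defect_mem. Qed.
Let us_dot x y : DTs x -> DTs y -> inner (us x) (us y) = inner x y.
Proof. exact: (isometry_inner sDs (unitary_isometry hus)). Qed.

(** The vectors D_{T^*} h are dense in the defect space, so the form <G D_{T^*} h, D_{T^*} k> = <A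
    h, k> determines G, and u_* D_{T^*} = D_{T'^*} phi carries one form to the other. *)
Lemma compression_equiv : (forall h, phi (A h) = A' (phi h)) ->
  forall y, DTs' y -> G' y = us (G (adjoint DTs DTs' us y)).
Proof.
move=> hA y Dy; have /unitaryP[lus usD uso nus] := hus.
have [_ usK _] := unitary_adjoint sDs hus.
have /contractionP[lG GD nG] := hG; have /contractionP[lG' GD' nG'] := hG'.
have [x Dx <-] := uso _ Dy; rewrite usK //.
move: x Dx; rewrite (defect_space_cspan hTs hDs); apply: cspan_agree.
- apply: contraction_bounded; rewrite -(defect_space_cspan hTs hDs).
  apply/contractionP; split => // [a b c Db Dc|b Db].
    by rewrite lus // lG' //; exact: usD.
  by rewrite -(nus b) //; apply/nG'/usD.
- apply: contraction_bounded; rewrite -(defect_space_cspan hTs hDs).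
  apply/contractionP; split => // [a b c Db Dc|b Db].
    by rewrite lG // lus //; exact: GD.
  by rewrite nus ?nG //; exact: GD.
move=> _ [h _ <-].
have DG : DTs (G (defect (adj T) h)) by apply/GD/(defect_mem hTs hDs).
have DG' : DTs' (G' (us (defect (adj T) h))).
  by apply/GD'/usD/(defect_mem hTs hDs).
apply: (inner_eq_sub sDs') => //; first exact: usD.
move=> a; rewrite (defect_space_cspan hTs' hDs') => Da.
apply/eqP; rewrite -subr_eq0 -innerBl; apply/eqP; apply: cspan_ortho Da.
move=> _ [k _ <-]; rewrite -(unitary_adjVK hphi k) -us_defect innerBl us_dot //; last first.
  exact: (defect_mem hTs hDs).
rewrite GA !us_defect GA' -hA (isometryT_inner (unitary_isometry hphi)).
exact: subrr.
Qed.

Lemma compression_equiv_inv :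
  (forall y, DTs' y -> G' y = us (G (adjoint DTs DTs' us y))) ->
  forall h, phi (A h) = A' (phi h).
Proof.
move=> hy h; apply: (inner_eq_sub (subspaceT H')) => // y _.
have /unitaryP[lus usD uso nus] := hus.
have [_ usK _] := unitary_adjoint sDs hus.
have /contractionP[_ GD _] := hG.
have dm k : DTs (defect (adj T) k) by exact: (defect_mem hTs hDs).
rewrite -(unitary_adjVK hphi y) -GA' -!us_defect hy; last exact/usD/dm.
rewrite usK // us_dot //; last exact: GD.
by rewrite GA (isometryT_inner (unitary_isometry hphi)).
Qed.

End DefectOperators.

Section TripleFacts.
Variables (R : realType) (H : hilbertType R) (T1 T2 : H -> H) (t : triple H H).
Hypothesis hT12 : commuting_contractions T1 T2.
Hypothesis ht : characteristic_triple T1 T2 t.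

Local Notation T := (T1 \o T2).
Local Notation DT := (defect_space T).
Local Notation DTs := (defect_space (adj T)).

Lemma triple_defect h : nrm (defect T h) ^+ 2 = nrm h ^+ 2 - nrm (T h) ^+ 2.
Proof.
have [_ _ _ _ /char_unitaries_model] := ht.
move=> [K [RD [J [U [iota [omega [v [WD [Wd1 [Wd2 [omegaD [hM _ _ _]]]]]]]]]]]].
exact: (nf_model_defect hT12 hM).
Qed.

Lemma triple_Theta_mem z x : cabs z < 1 -> DT x -> DTs (tTheta t z x).
Proof.
have [dT cT _ _ _] := ht; rewrite -dT -cT => z1 Dx.
have [_ /(_ z)] := tTheta_analytic t.
rewrite cabsE ltcR => /(_ z1) /contractionP[_ h _]; exact: h.
Qed.

Lemma triple_Theta z x : cabs z < 1 -> DT x -> tTheta t z x = char_fun T1 T2 z x.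
Proof. by have [_ _ h _ _] := ht; move=> z1 Dx; apply: h; rewrite ?cabsE ?ltcR. Qed.

Lemma triple_boundary : has_boundary_values DT (tTheta t).
Proof. by have [<- _ _ _ _] := ht; exact: tTheta_boundary. Qed.

Lemma triple_W : unitary_L2 (DeltaL2 DT DTs (tTheta t)) (tW1 t) /\
  unitary_L2 (DeltaL2 DT DTs (tTheta t)) (tW2 t).
Proof.
by have [<- <- _ _ _] := ht; split; [exact: tW1_unitary|exact: tW2_unitary].
Qed.

Lemma triple_G : contraction DTs DTs (tG1 t) /\ contraction DTs DTs (tG2 t).
Proof.
by have [_ <- _ _ _] := ht; split; [exact: tG1_contraction|exact: tG2_contraction].
Qed.

End TripleFacts.

Lemma char_fun_equiv (R : realType) (H H' : hilbertType R) (T1 T2 : H -> H)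
    (T1' T2' : H' -> H') (phi : H -> H') z x :
  contraction setT setT (T1 \o T2) -> contraction setT setT (T1' \o T2') ->
  unitary setT setT phi -> (forall h, phi (T1 (T2 h)) = T1' (T2' (phi h))) ->
  char_fun T1' T2' z (phi x) = phi (char_fun T1 T2 z x).
Proof.
move=> cT cT' hphi phiT; have [lphi _ _] := hphi.
have cTs := contraction_adj cT; have cTs' := contraction_adj cT'.
have phiTs := unitary_adj_intertwine cT cT' hphi phiT.
rewrite /char_fun addrC (addrC (- _)) lphi // (lin_N (subspaceT H) lphi) //= phiT.
rewrite (defect_equiv cTs cTs' hphi phiTs); congr (_ *: defect _ _ + _).
rewrite -(defect_equiv cT cT' hphi phiT); apply: (op_inverse_equiv hphi) => y.
by rewrite (lin_B (subspaceT H) lphi) // (lin_Z (subspaceT H) lphi) // phiTs.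
Qed.

Section Coincidence.
Variables (R : realType) (H H' : hilbertType R).
Variables (T1 T2 : H -> H) (T1' T2' : H' -> H').
Hypotheses (hT : commuting_contractions T1 T2) (hT' : commuting_contractions T1' T2').
Variables (t : triple H H) (t' : triple H' H').
Hypotheses (ht : characteristic_triple T1 T2 t) (ht' : characteristic_triple T1' T2' t').

Local Notation T := (T1 \o T2).
Local Notation T' := (T1' \o T2').

Let cT := product_contraction hT.
Let cT' := product_contraction hT'.
Let hD := triple_defect hT ht.
Let hD' := triple_defect hT' ht'.

Lemma unitarily_equivalent_coincide :
  unitarily_equivalent T1 T2 T1' T2' -> coincide t t'.
Proof.
move=> [phi [hphi phi1 phi2]]; exists phi, phi.
have phiT x : phi (T x) = T' (phi x) by rewrite /= phi1 phi2.
have cTs := contraction_adj cT; have cTs' := contraction_adj cT'.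
have phiTs := unitary_adj_intertwine cT cT' hphi phiT.
have [c1 c2 _] := hT; have [c1' c2' _] := hT'.
have phi1s := unitary_adj_intertwine c1 c1' hphi phi1.
have phi2s := unitary_adj_intertwine c2 c2' hphi phi2.
have /unitaryP[lphi _ _ _] := hphi.
have [dT dTs _ gT wT] := ht; have [dT' dTs' _ gT' wT'] := ht'.
have [hDs G1 G2] := char_contractions_spec hT gT.
have [hDs' G1' G2'] := char_contractions_spec hT' gT'.
have [cG1 cG2] := triple_G ht; have [cG1' cG2'] := triple_G ht'.
have uD := defect_space_unitary cT cT' hphi phiT.
have uDs := defect_space_unitary cTs cTs' hphi phiTs.
have Th_eq z x : cabs z < 1 -> defect_space T x ->
    tTheta t' z (phi x) = phi (tTheta t z x).
  move=> z1 Dx; have /unitaryP[_ pD _ _] := uD.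
  rewrite (triple_Theta ht') ?(triple_Theta ht) ?(char_fun_equiv z x cT cT' hphi phiT) //.
  exact: pD.
have phiB a b : phi (a - b) = phi a - phi b by rewrite (lin_B (subspaceT H) lphi).
rewrite dT dTs dT' dTs'; split.
- by [].
- by move=> z x; rewrite cabsE ltcR => z1 Dx; rewrite Th_eq.
- split; [apply: (compression_equiv cT cT' hDs hDs' hphi phiT uDs _ cG1 cG1' G1 G1')
         |apply: (compression_equiv cT cT' hDs hDs' hphi phiT uDs _ cG2 cG2' G2 G2')] => //.
  + by move=> h; rewrite phiB phi1s phi2 phiTs.
  + by move=> h; rewrite phiB phi2s phi1 phiTs.
all: have [K [RD [J [U [iota [omega [v [WD [Wd1 [Wd2 [omegaD]]]]]]]]]]] :=
  char_unitaries_model wT.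
all: have [K' [RD' [J' [U' [iota' [omega' [v' [WD' [Wd1' [Wd2' [omegaD']]]]]]]]]]] :=
  char_unitaries_model wT'.
all: move=> [hM' hR1' hR2' [W1u' W2u']] [hM hR1 hR2 [W1u W2u]].
all: have [hJ hU hd hm _] := hM; have [hJ' hU' hd' hm' _] := hM'.
all: have [Psi hPsi PsiJ] := dilation_transport hphi phiT hJ hU hd hm hJ' hU' hd' hm'.
all: have cD := defect_space_closed cT hD; have cDs := defect_space_closed cTs hDs.
all: have cD' := defect_space_closed cT' hD'; have cDs' := defect_space_closed cTs' hDs'.
all: have [hW1 hW2] := triple_W ht; have [hW1' hW2'] := triple_W ht'.
- apply: (W_transport cT cT' hphi phiT cD cDs cD' (triple_Theta_mem ht)
    (triple_boundary ht) Th_eq hM hM' hPsi PsiJ hR1 hR1' hW1 hW1' W1u W1u' uD) => //.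
- apply: (W_transport cT cT' hphi phiT cD cDs cD' (triple_Theta_mem ht)
    (triple_boundary ht) Th_eq hM hM' hPsi PsiJ hR2 hR2' hW2 hW2' W2u W2u' uD) => //.
Qed.

Lemma coincide_unitarily_equivalent : cnu T -> cnu T' ->
  coincide t t' -> unitarily_equivalent T1 T2 T1' T2'.
Proof.
move=> cnuT cnuT' [u [us]].
have [dT dTs _ gT wT] := ht; have [dT' dTs' _ gT' wT'] := ht'.
rewrite dT dTs dT' dTs' => -[[uu uus] Th_u [Geq1 Geq2] Weq1 Weq2].
have cTs := contraction_adj cT; have cTs' := contraction_adj cT'.
have [c1 c2 com] := hT; have [c1' c2' com'] := hT'.
have [hDs G1 G2] := char_contractions_spec hT gT.
have [hDs' G1' G2'] := char_contractions_spec hT' gT'.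
have [cG1 cG2] := triple_G ht; have [cG1' cG2'] := triple_G ht'.
have /unitaryP[_ uD _ _] := uu; have /unitaryP[_ usD _ _] := uus.
have Th_us z x : cabs z < 1 -> defect_space T x ->
    us (char_fun T1 T2 z x) = char_fun T1' T2' z (u x).
  move=> z1 Dx; rewrite -(triple_Theta ht) // -(triple_Theta ht') //; last exact: uD.
  by apply: Th_u; rewrite ?cabsE ?ltcR.
have coef := char_coef_equiv cT cT' hD hDs hDs' uus Th_us.
have [K [RD [J [U [iota [omega [v [WD [Wd1 [Wd2 [omegaD]]]]]]]]]]] :=
  char_unitaries_model wT.
have [K' [RD' [J' [U' [iota' [omega' [v' [WD' [Wd1' [Wd2' [omegaD']]]]]]]]]]] :=
  char_unitaries_model wT'.
move=> [hM' hR1' hR2' [W1u' W2u']] [hM hR1 hR2 [W1u W2u]].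
have [hJ hU hd hm _] := hM; have [hJ' hU' hd' hm' _] := hM'.
have [phi [hphi phiT u_phi us_phi]] := model_unitary cT cT' hD hDs hD' hDs' cnuT cnuT'
  uu uus coef hJ hU hd hm hJ' hU' hd' hm'.
have phiTs := unitary_adj_intertwine cT cT' hphi phiT.
have Th_eq z x : cabs z < 1 -> defect_space T x ->
    tTheta t' z (phi x) = phi (tTheta t z x).
  move=> z1 Dx; rewrite -(us_phi (tTheta t z x)); last exact: (triple_Theta_mem ht).
  by rewrite -u_phi // Th_u // cabsE ltcR.
have [Psi hPsi PsiJ] := dilation_transport hphi phiT hJ hU hd hm hJ' hU' hd' hm'.
have cD := defect_space_closed cT hD; have cDs := defect_space_closed cTs hDs.
have cD' := defect_space_closed cT' hD'.
have [hW1 hW2] := triple_W ht; have [hW1' hW2'] := triple_W ht'.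
have v1 := W_transport_inv cT cT' hphi phiT cD cDs cD' (triple_Theta_mem ht)
    (triple_boundary ht) Th_eq hM hM' hPsi PsiJ hR1 hR1' hW1 W1u W1u' uu u_phi Weq1.
have v2 := W_transport_inv cT cT' hphi phiT cD cDs cD' (triple_Theta_mem ht)
    (triple_boundary ht) Th_eq hM hM' hPsi PsiJ hR2 hR2' hW2 W2u W2u' uu u_phi Weq2.
have A1 := compression_equiv_inv cT cT' hDs hphi phiT uus us_phi cG1 G1 G1' Geq1.
have A2 := compression_equiv_inv cT cT' hDs hphi phiT uus us_phi cG2 G2 G2' Geq2.
have n1 h := residual_model_null cT' hJ' hU' hd' hR1' (v1 h).
(* Both residual models share the map v', so the model for T_1' also yields the decay for the second
   index. *)
have n2 h := residual_model_null cT' hJ' hU' hd' hR1' (v2 h).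
have comm1 h : adj T1 (adj T h) = adj T (adj T1 h).
  by rewrite -(adj_product12 hT h) (adj_product21 hT).
have comm2 h : adj T2 (adj T h) = adj T (adj T2 h).
  by rewrite -(adj_product21 hT h) (adj_product12 hT).
have comm1' h : adj T1' (adj T' h) = adj T' (adj T1' h).
  by rewrite -(adj_product12 hT' h) (adj_product21 hT').
have comm2' h : adj T2' (adj T' h) = adj T' (adj T2' h).
  by rewrite -(adj_product21 hT' h) (adj_product12 hT').
have phi1 := intertwine_of_null cT cT' c1 c2 c1' c2' hphi phiTs comm1 comm1' A1 A2 n1.
have phi2 := intertwine_of_null cT cT' c2 c1 c2' c1' hphi phiTs comm2 comm2' A2 A1 n2.
exists phi; split => // x.
- rewrite -[T1](adj_adj c1) -[T1'](adj_adj c1').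
  by apply: unitary_adj_intertwine => //; exact: contraction_adj.
- rewrite -[T2](adj_adj c2) -[T2'](adj_adj c2').
  by apply: unitary_adj_intertwine => //; exact: contraction_adj.
Qed.

End Coincidence.

Theorem theorem4p10 (R : realType) (H H' : hilbertType R)
    (T1 T2 : H -> H) (T1' T2' : H' -> H')
    (hT : commuting_contractions T1 T2)
    (hT' : commuting_contractions T1' T2')
    (cnuT : cnu (T1 \o T2)) (cnuT' : cnu (T1' \o T2'))
    (t : triple H H) (t' : triple H' H')
    (ht : characteristic_triple T1 T2 t)
    (ht' : characteristic_triple T1' T2' t') :
  unitarily_equivalent T1 T2 T1' T2' <-> coincide t t'.
Proof.
split; first exact: unitarily_equivalent_coincide.
exact: coincide_unitarily_equivalent.
Qed.
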